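(* Let $M$ be a matroid that has no loops and let $\leq$ be a linear order on $E(M)$. The following statements are equivalent: (1) $\leq$ is a positroid order for $M$; (2) $\leq$ is a base-sorting order for $M$; (3) if $F$ is a flat of $M$ for which $2\leq |F|\leq |E(M)|-2$ and $M|F$ is connected, then $$M/F = (M/F|U_1)\oplus (M/F|U_2)\oplus \cdots \oplus (M/F|U_h),$$ where $U_1,U_2,\ldots,U_h$ are the maximal cyclic intervals of $\leq$ that are disjoint from $F$; (4) $\leq$ has the cyclic interval property.
   Context: A linear order $\leq$ on $E(M)$, for a matroid $M$ of rank $r$ with $|E(M)|=n$, is a positroid order for $M$ if, when the elements of $E(M)$ are listed in the order $\leq$, there is an $r\times n$ real matrix whose columns (in that order) represent $M$ and all of whose $r\times r$ submatrices have nonnegative determinant; $M$ is a positroid if it has a positroid order. For a linear order $e_1<e_2<\cdots<e_n$, its $i$-shift is the order $e_i<e_{i+1}<\cdots<e_n<e_1<\cdots<e_{i-1}$; a cyclic interval of $\leq$ is a set that is an interval in some $i$-shift of $\leq$ (equivalently, $A$ or $E-A$ is an interval of $\leq$). For bases $B,B'$ of a rank-$r$ matroid, list the multiset union $B\cup B'$ in order as $x_1\leq x_2\leq\cdots\leq x_{2r}$ and set $B_e=\{x_{2i}: i\in[r]\}$, $B_o=\{x_{2i-1}: i\in[r]\}$. The order $\leq$ is a base-sorting order for $M$ if for every pair of bases $B,B'$ of $M$, both $B_e$ and $B_o$ are bases of $M$. A set $X$ is connected if $M|X$ is connected. For a matroid $M$ with no loops, a linear order on $E(M)$ has the cyclic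 interval property if, for each proper connected flat $F$ of $M$ with $|F|\geq 2$ and each connected component $K$ of the contraction $M/F$ with $|E(K)|\geq 2$, the set $E(K)$ is a subset of a cyclic interval that is disjoint from $F$. *)

(* Defs.v *)
From mathcomp Require Import all_boot all_order all_algebra.
From mathcomp Require Import reals.

Set Implicit Arguments.
Unset Strict Implicit.
Unset Printing Implicit Defensive.

(* The ground set is a subset of the carrier type, so that minors of a matroid
   on T are again matroids on T. *)
Record matroid (T : finType) := Matroid {
  ground : {set T};
  indep : {set {set T}};
  indep_ground : forall I : {set T}, I \in indep -> I \subset ground;
  indep0 : set0 \in indep;
  indepS : forall I J : {set T}, J \subset I -> I \in indep -> J \in indep;
  indep_aug : forall I J : {set T}, I \in indep -> J \in indep -> #|I| < #|J| ->
    exists2 x, x \in J :\: I & x |: I \in indep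
}.

Section Matroids.
Variable T : finType.
Implicit Types (M N : matroid T) (X Y I J B C F K U A : {set T}) (le : rel T).

Definition bases M : {set {set T}} :=
  [set B : {set T} | maxset [pred I : {set T} | I \in indep M] B].

Definition rank_of M X : nat := \max_(I : {set T} | (I \in indep M) && (I \subset X)) #|I|.

Definition rank M : nat := rank_of M (ground M).

Definition circuits M : {set {set T}} :=
  [set C : {set T} | minset [pred X : {set T} | (X \subset ground M) && (X \notin indep M)] C].

Definition loopless M : Prop := forall e, e \in ground M -> [set e] \notin circuits M.

Definition closure_of M X : {set T} :=
  [set e in ground M | rank_of M (e |: X) == rank_of M X].

Definition flat M F : Prop := closure_of M F = F.

Section Restriction.
Variables (M : matroid T) (X : {set T}).

Definition restrict_indep : {set {set T}} := [set I : {set T} in indep M | I \subset X].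

Fact restrict_ground I : I \in restrict_indep -> I \subset ground M :&: X.
Proof. by rewrite inE subsetI => /andP[/indep_ground -> ->]. Qed.

Fact restrict0 : set0 \in restrict_indep.
Proof. by rewrite inE indep0 sub0set. Qed.

Fact restrictS I J : J \subset I -> I \in restrict_indep -> J \in restrict_indep.
Proof.
move=> sJI; rewrite !inE => /andP[iI sIX].
by rewrite (indepS sJI iI) (subset_trans sJI sIX).
Qed.

Fact restrict_aug I J :
  I \in restrict_indep -> J \in restrict_indep -> #|I| < #|J| ->
  exists2 x, x \in J :\: I & x |: I \in restrict_indep.
Proof.
rewrite !inE => /andP[iI sIX] /andP[iJ sJX] ltIJ.
have [x xJI ixI] := indep_aug iI iJ ltIJ; exists x => //.
rewrite inE ixI subUset sIX andbT sub1set (subsetP sJX) //.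
by move: xJI; rewrite inE => /andP[].
Qed.

Definition restrict : matroid T :=
  Matroid restrict_ground restrict0 restrictS restrict_aug.

End Restriction.

Lemma indep_extend M I J : I \in indep M -> J \in indep M -> #|I| <= #|J| ->
  exists Y, [/\ Y \subset J :\: I, I :|: Y \in indep M & #|I :|: Y| = #|J|].
Proof.
move=> iI iJ; move: {2}(#|J| - #|I|) (leqnn (#|J| - #|I|)) => n.
elim: n I iI => [|n IHn] I iI leJI leIJ.
  exists set0; rewrite sub0set setU0 iI; split=> //.
  by apply/eqP; rewrite eqn_leq leIJ -subn_eq0 -leqn0.
have [ltIJ|leJI'] := ltnP #|I| #|J|; last first.
  by exists set0; rewrite sub0set setU0; split=> //; apply/eqP; rewrite eqn_leq leIJ.
have [x /setDP[xJ xNI] ixI] := indep_aug iI iJ ltIJ.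
have cxI : #|x |: I| = #|I|.+1 by rewrite cardsU1 xNI.
have [||Y [sY iY cY]] := IHn _ ixI.
- by rewrite cxI subnS -(leq_add2r 1) !addn1 prednK ?subn_gt0.
- by rewrite cxI.
exists (x |: Y); rewrite setUCA setUA; split=> //.
rewrite subUset sub1set inE xNI xJ /=; apply: (subset_trans sY).
by rewrite setDS // subsetUr.
Qed.

Section Contraction.
Variables (M : matroid T) (F : {set T}).

Definition contract_indep : {set {set T}} :=
  [set I : {set T} | (I \subset ground M :\: F)
    && [exists B in bases (restrict M F), I :|: B \in indep M]].

Fact contract_ground I : I \in contract_indep -> I \subset ground M :\: F.
Proof. by rewrite inE => /andP[]. Qed.

Fact contract_ex_base : exists B, B \in bases (restrict M F).
Proof.
have [B maxB _] : {B | maxset [pred I : {set T} | I \in indep (restrict M F)] B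
                      & set0 \subset B}.
  by apply: maxset_exists; exact: indep0.
by exists B; rewrite inE.
Qed.

Fact contract0 : set0 \in contract_indep.
Proof.
rewrite inE sub0set; have [B BP] := contract_ex_base.
apply/existsP; exists B; rewrite BP set0U.
by move: BP; rewrite inE => /maxsetp /=; rewrite inE => /andP[].
Qed.

Fact contractS I J : J \subset I -> I \in contract_indep -> J \in contract_indep.
Proof.
move=> sJI; rewrite !inE => /andP[sI /existsP[B /andP[BP iB]]].
rewrite (subset_trans sJI sI); apply/existsP; exists B.
by rewrite BP (indepS _ iB) // setSU.
Qed.

Lemma contract_baseE I B : I \subset ground M :\: F ->
  B \in bases (restrict M F) -> (I \in contract_indep) = (I :|: B \in indep M).
Proof.
move=> sI BP; rewrite inE sI /=; apply/existsP/idP => [|iB]; last first.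
  by exists B; rewrite BP.
case=> B' /andP[BP' iB'].
have baseP B0 : B0 \in bases (restrict M F) ->
    [/\ B0 \in indep M, B0 \subset F &
      forall x, x \in F -> x |: B0 \in indep M -> x \in B0].
  rewrite inE => /maxsetP[/=]; rewrite inE => /andP[iB0 sB0] mB0; split=> // x xF ix.
  rewrite -(mB0 (x |: B0)) ?setU11 ?subsetUr //=.
  by rewrite inE ix subUset sub1set xF.
have leB B1 B2 : B1 \in bases (restrict M F) -> B2 \in bases (restrict M F) ->
    #|B1| <= #|B2|.
  move=> /baseP[i1 s1 _] /baseP[i2 s2 m2]; rewrite leqNgt; apply/negP => lt21.
  have [x /setDP[x1 xN2] ix] := indep_aug i2 i1 lt21.
  by rewrite (m2 x) // in xN2; apply: (subsetP s1).
have [iB0 sBF mB] := baseP _ BP; have [iB0' sBF' _] := baseP _ BP'.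
have dis (B0 : {set T}) : B0 \subset F -> #|I :|: B0| = #|I| + #|B0|.
  move=> sB0; apply/eqP; rewrite (leq_card_setU I B0).2.
  rewrite -setI_eq0 -subset0; apply/subsetP=> x /setIP[/(subsetP sI)/setDP[_ xNF]].
  by move/(subsetP sB0); rewrite (negPf xNF).
have cBB' : #|B| = #|B'| by apply/eqP; rewrite eqn_leq !leB.
have [|Y [sY iY cY]] := indep_extend iB0 iB'.
  by rewrite dis // cBB' leq_addl.
have sYI : Y \subset I.
  apply/subsetP => x xY; move: (subsetP sY _ xY).
  rewrite !inE => /andP[xNB /orP[//|xB']].
  case/negP: xNB; apply: mB; first exact: (subsetP sBF').
  by apply: indepS iY; rewrite subUset sub1set inE xY orbT subsetUl.
have/eqP <- : B :|: Y == I :|: B; last by [].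
rewrite eqEcard cY !dis // cBB' leqnn andbT.
by rewrite subUset subsetUr (subset_trans sYI) ?subsetUl.
Qed.

Fact contract_aug I J :
  I \in contract_indep -> J \in contract_indep -> #|I| < #|J| ->
  exists2 x, x \in J :\: I & x |: I \in contract_indep.
Proof.
move=> cI cJ ltIJ; have [B BP] := contract_ex_base.
have [sI sJ] := (contract_ground cI, contract_ground cJ).
move: cI cJ; rewrite !(contract_baseE _ BP) // => iI iJ.
have sBF : B \subset F.
  by move: BP; rewrite inE => /maxsetp /=; rewrite inE => /andP[].
have dis (K : {set T}) : K \subset ground M :\: F -> #|K :|: B| = #|K| + #|B|.
  move=> sK; apply/eqP; rewrite (leq_card_setU K B).2.
  rewrite -setI_eq0 -subset0; apply/subsetP=> x /setIP[/(subsetP sK)/setDP[_ xNF]].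
  by move/(subsetP sBF); rewrite (negPf xNF).
have [|x /setDP[+ xN] ix] := indep_aug iI iJ; first by rewrite !dis // ltn_add2r.
move: xN; rewrite !inE negb_or => /andP[xNI xNB]; rewrite (negPf xNB) orbF => xJ.
exists x; first by rewrite inE xNI.
rewrite (contract_baseE _ BP) -?setUA //.
by rewrite subUset sI sub1set (subsetP sJ).
Qed.

Definition contract : matroid T :=
  Matroid contract_ground contract0 contractS contract_aug.

End Contraction.

(* e and f are equal or lie in a common circuit *)
Definition joined M : rel T :=
  fun e f => (e == f) || [exists C in circuits M, (e \in C) && (f \in C)].

Definition connected M : Prop := {in ground M &, forall e f, joined M e f}.

Definition components M : {set {set T}} :=
  equivalence_partition (joined M) (ground M).

(* N is the direct sum of the matroids Ns U, for U in Us *)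
Definition is_direct_sum N (Us : {set {set T}}) (Ns : {set T} -> matroid T) : Prop :=
  [/\ {in Us &, forall U V, U != V -> [disjoint ground (Ns U) & ground (Ns V)]},
      ground N = \bigcup_(U in Us) ground (Ns U)
    & forall I, I \in indep N <->
        exists2 J : {set T} -> {set T},
          {in Us, forall U, J U \in indep (Ns U)} & I = \bigcup_(U in Us) J U].

Definition linear_order_on X le : Prop :=
  [/\ {in X &, antisymmetric le}, {in X & &, transitive le} & {in X &, total le}].

(* shift_order le p starts at p, runs up to the le-largest element, and then continues
   from the le-smallest element to the predecessor of p *)
Definition shift_order le (p : T) : rel T :=
  fun x y => if le p x == le p y then le x y else le p x.

Definition order_interval X le A : bool :=
  (A \subset X) &&
  [forall a in A, forall c in A, forall b in X, le a b && le b c ==> (b \in A)].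

Definition cyclic_interval X le A : bool :=
  [exists p in X, order_interval X (shift_order le p) A].

Definition max_cyclic_intervals X le F : {set {set T}} :=
  [set U : {set T} | maxset [pred A : {set T} | cyclic_interval X le A && [disjoint A & F]] U].

Definition cyclic_interval_property M le : Prop :=
  forall F, F \proper ground M -> flat M F -> connected (restrict M F) ->
    2 <= #|F| ->
    forall K, K \in components (contract M F) -> 2 <= #|K| ->
      exists A, [/\ cyclic_interval (ground M) le A, [disjoint A & F] & K \subset A].

(* the sorted multiset union x_1 <= ... <= x_2r, here indexed from 0 *)
Definition merged le B B' : seq T := sort le (enum B ++ enum B').

Definition even_part M le B B' : {set T} :=
  [set x | [exists i : 'I_(rank M), onth (merged le B B') i.*2.+1 == Some x]].

Definition odd_part M le B B' : {set T} :=
  [set x | [exists i : 'I_(rank M), onth (merged le B B') i.*2 == Some x]].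

Definition base_sorting_order M le : Prop :=
  {in bases M &, forall B B',
    even_part M le B B' \in bases M /\ odd_part M le B B' \in bases M}.

(* the i-th element of X in the order le; enum_val i is a dummy default value *)
Definition listing X le (i : 'I_#|X|) : T :=
  nth (enum_val i) (sort le (enum X)) i.

Definition represents (R : realType) M le (A : 'M[R]_(rank M, #|ground M|)) : Prop :=
  forall X, X \subset ground M ->
    (X \in indep M) =
    row_free (rowsub (@enum_val _ (mem [set j | listing le j \in X])) A^T).

Definition positroid_order (R : realType) M le : Prop :=
  exists A : 'M[R]_(rank M, #|ground M|),
    represents le A /\
    forall f : 'I_(rank M) -> 'I_#|ground M|,
      (forall i j : 'I_(rank M), i < j -> f i < f j) -> (0 <= \det (colsub f A))%R.

End Matroids.

(* Main.v *)
(* The cycle of implications goes through two auxiliary conditions on the bases. Local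
   sorting: if a < b < c < d and S+a+b, S+c+d are bases, so are S+a+c and S+b+d.
   Determination by cyclic intervals: an r-set B with |B n A| <= r(A) for all cyclic
   intervals A is a base.
   A totally nonnegative matrix sorts locally by the three-term Plucker relation, and
   a base-sorting order does so trivially. A circuit of a flat F crossed by a circuit of
   M/F yields, after contraction, four elements that contradict local sorting, which
   gives the cyclic interval property and hence the direct sums of (3). Given (3), a
   violated rank inequality can be chosen at a connected flat F, and it stays violated
   when the summands of M/F are added one by one until the whole ground set is reached.
   Determination by cyclic intervals implies base sorting, because sorting distributes
   the elements of B and B' evenly over every interval.
   It also yields a matrix, by induction on the number of bases. Take neighbours i < j
   such that i is spanned by the elements after it and j is not, and lower the rank of
   each cyclic interval that contains j but not i, and spans i, to its rank without j.
   The new rank bounds are submodular on crossing cyclic intervals, so they define a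
   smaller matroid; M is recovered from it by adding a multiple of column i to column j,
   which creates no cancellation in the maximal minors. *)
Require Import Defs.
From mathcomp Require Import all_boot all_order all_algebra.
From mathcomp Require Import reals zify ring.

Set Implicit Arguments.
Unset Strict Implicit.
Unset Printing Implicit Defensive.

(** * Rank, closure and circuits *)

(** The hard direction must produce a matrix from rank conditions alone. Subtracting a multiple of
    one column from a neighbour is a bridge, as in the bridge decompositions of positroid cells.
    There is no matrix yet to apply it to, so it is carried out on the rank bounds, and the smaller
    matroid must again be determined by cyclic intervals for the induction to continue. Two
    obstacles shape the argument. Lowered bounds are submodular only on pairs of convex sets that
    meet and do not cover the circle. The exchange axiom needs no other pairs: all tight sets in its
    proof avoid the element being exchanged, so no union of them is everything. Moreover, each
    bridge may create loops and coloops, and the two columns must count as neighbours across them.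
    Hence convexity is taken relative to the remaining elements, and a sign accounts for the coloops
    between the two columns. In the converse step any positive multiple, up to that sign, would do,
    since only the vanishing of sums of nonnegative minors matters; the multiple is taken to be
    1. *)

Section Rank.
Variables (T : finType) (M : matroid T).
Implicit Types (x y : T) (X Y Z I J B C : {set T}).
Local Notation r := (rank_of M).

(** Unlike [closure_of], this does not ask for [x] in the ground set; elements outside it are
    spanned by every set. *)
Definition spans X x := r (x |: X) == r X.

Lemma indep_le_rank I X : I \in indep M -> I \subset X -> #|I| <= r X.
Proof. by move=> iI sI; rewrite /rank_of; apply: leq_bigmax_cond; rewrite iI. Qed.

Lemma rank_witness X : exists I, [/\ I \in indep M, I \subset X & #|I| = r X].
Proof.
have n0 : 0 < #|[pred I : {set T} | (I \in indep M) && (I \subset X)]|.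
  by apply/card_gt0P; exists set0; rewrite inE indep0 sub0set.
by have [I /andP[iI sI] e] := eq_bigmax_cond (fun I : {set T} => #|I|) n0; exists I.
Qed.

Lemma rank_extend I X : I \in indep M -> I \subset X ->
  exists J, [/\ J \in indep M, I \subset J, J \subset X & #|J| = r X].
Proof.
move=> iI sI; have [J [iJ sJ cJ]] := rank_witness X.
have [|Y [sY iY cY]] := indep_extend iI iJ; first by rewrite cJ indep_le_rank.
exists (I :|: Y); rewrite iY subsetUl cY cJ; split=> //.
by rewrite subUset sI (subset_trans sY) // subDset (subset_trans sJ) ?subsetUr.
Qed.

Lemma rankS X Y : X \subset Y -> r X <= r Y.
Proof.
move=> sXY; have [I [iI sI <-]] := rank_witness X.
by apply: indep_le_rank => //; apply: subset_trans sXY.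
Qed.

Lemma rank_le_card X : r X <= #|X|.
Proof. by have [I [iI sI <-]] := rank_witness X; apply: subset_leq_card. Qed.

Lemma rank_indepE I : (I \in indep M) = (r I == #|I|).
Proof.
apply/idP/eqP => [iI|e]; first by apply/eqP; rewrite eqn_leq rank_le_card indep_le_rank.
have [J [iJ sJ cJ]] := rank_witness I.
by suff <- : J = I by []; apply/eqP; rewrite eqEcard sJ cJ e leqnn.
Qed.

Lemma rank_indep I : I \in indep M -> r I = #|I|.
Proof. by rewrite rank_indepE => /eqP. Qed.

Lemma rank_submod X Y : r (X :|: Y) + r (X :&: Y) <= r X + r Y.
Proof.
have [I [iI sI cI]] := rank_witness (X :&: Y).
have [|J [iJ sIJ sJ cJ]] := @rank_extend I (X :|: Y) iI.
  by apply: subset_trans sI _; rewrite (subset_trans (subsetIl _ _)) ?subsetUl.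
have hX : #|J :&: X| <= r X.
  by apply: indep_le_rank (subsetIr _ _); apply: indepS iJ; apply: subsetIl.
have hY : #|J :&: Y| <= r Y.
  by apply: indep_le_rank (subsetIr _ _); apply: indepS iJ; apply: subsetIl.
apply: leq_trans (leq_add hX hY).
rewrite -cardsUI -setIUr -setIIr -cJ -cI leq_add //; apply: subset_leq_card.
  by rewrite subsetI subxx.
by rewrite subsetI sIJ.
Qed.

Lemma rankU1_le x X : r (x |: X) <= (r X).+1.
Proof.
have := rank_submod [set x] X; have := rank_le_card [set x]; rewrite cards1; lia.
Qed.

Lemma rankD1_ge x X : r X <= (r (X :\ x)).+1.
Proof.
apply: leq_trans (rankU1_le x _); apply: rankS.
by rewrite -subDset.
Qed.

Lemma rank0 : r set0 = 0.
Proof. by have := rank_le_card set0; rewrite cards0; lia. Qed.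

Lemma spansS X Y x : X \subset Y -> spans X x -> spans Y x.
Proof.
move=> sXY /eqP e; rewrite /spans.
have [xY|xY] := boolP (x \in Y); first by rewrite (setUidPr _) ?sub1set.
have := rank_submod (x |: X) Y.
rewrite -setUA (setUidPr sXY) e => h.
have sX : X \subset (x |: X) :&: Y by rewrite subsetI subsetUr.
have := rankS sX; have : r Y <= r (x |: Y) by rewrite rankS ?subsetUr.
lia.
Qed.

Lemma spans_in X x : x \in X -> spans X x.
Proof. by move=> xX; rewrite /spans (setUidPr _) ?sub1set. Qed.

Lemma spansU X Y : (forall y, y \in Y -> spans X y) -> r (X :|: Y) = r X.
Proof.
have [n] := ubnP #|Y|; elim: n Y => // n IHn Y ltn h.
have [->|[y yY]] := set_0Vmem Y; first by rewrite setU0.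
have e : r (X :|: (Y :\ y)) = r X.
  apply: IHn => [|z]; first by rewrite (cardsD1 y) yY in ltn.
  by rewrite !inE => /andP[_ /h].
have /eqP := spansS (subsetUl X (Y :\ y)) (h _ yY).
by rewrite setUCA setD1K // e.
Qed.

Lemma spans_trans X Y x : (forall y, y \in Y -> spans X y) -> spans Y x -> spans X x.
Proof.
move=> h sY; have := spansS (subsetUr X Y) sY; rewrite /spans => /eqP e.
have eXY := spansU h.
apply/eqP/anti_leq; rewrite [r X <= _]rankS ?subsetUr // andbT.
by rewrite -eXY -e rankS // setUS // subsetUl.
Qed.

Lemma rank_full X : r (X :&: ground M) = r X.
Proof.
apply/anti_leq; rewrite rankS ?subsetIl //=.
have [I [iI sI <-]] := rank_witness X.
by apply: indep_le_rank; rewrite // subsetI sI indep_ground.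
Qed.

Lemma rank_le X : r X <= rank M.
Proof. by rewrite -rank_full rankS ?subsetIr. Qed.

Lemma basesP B : reflect (B \in indep M /\ #|B| = rank M) (B \in bases M).
Proof.
rewrite inE; apply: (iffP maxsetP) => [[iB mB]|[iB cB]]; split=> //=.
  have [J [iJ sBJ _ cJ]] := rank_extend iB (indep_ground iB).
  by rewrite /rank -cJ (mB J).
move=> J iJ sBJ; apply/esym/eqP; rewrite eqEcard sBJ cB.
by rewrite indep_le_rank // indep_ground.
Qed.

Lemma base_indep B : B \in bases M -> B \in indep M.
Proof. by case/basesP. Qed.

Lemma base_card B : B \in bases M -> #|B| = rank M.
Proof. by case/basesP. Qed.

Lemma base_ground B : B \in bases M -> B \subset ground M.
Proof. by move/base_indep/indep_ground. Qed.

Lemma rank_baseE B : #|B| = rank M -> (B \in bases M) = (r B == rank M).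
Proof.
move=> c; apply/basesP/eqP => [[iB _]|e]; first by rewrite rank_indep.
by rewrite rank_indepE e c.
Qed.

Lemma indep_base I : I \in indep M -> exists2 B, B \in bases M & I \subset B.
Proof.
move=> iI; have [B [iB sIB _ cB]] := rank_extend iI (indep_ground iI).
by exists B => //; apply/basesP.
Qed.

Lemma base_ex : exists B, B \in bases M.
Proof. by have [B ? _] := indep_base (indep0 M); exists B. Qed.

Lemma base_leq_rank B X : B \in bases M -> #|B :&: X| <= r X.
Proof.
move=> bB; apply: indep_le_rank (subsetIr _ _).
by apply: indepS (base_indep bB); apply: subsetIl.
Qed.

Lemma rank_base X : exists2 B, B \in bases M & #|B :&: X| = r X.
Proof.
have [I [iI sI cI]] := rank_witness X; have [B bB sIB] := indep_base iI.
exists B => //; apply/anti_leq; rewrite base_leq_rank // -cI subset_leq_card //.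
by rewrite subsetI sIB.
Qed.

Lemma circuitP C : reflect
  [/\ C \subset ground M, C \notin indep M & forall x, x \in C -> C :\ x \in indep M]
  (C \in circuits M).
Proof.
rewrite inE; apply: (iffP minsetP) => /= [[/andP[sC dC] mC]|[sC dC iC]].
  split=> // x xC; apply/negPn/negP => d.
  have := mC (C :\ x); rewrite d (subset_trans (subsetDl _ _) sC) => /(_ isT).
  by rewrite subsetDl => /(_ isT)/setP/(_ x); rewrite !inE xC eqxx.
split=> [|X /andP[sX dX] sXC]; first by rewrite sC.
apply/eqP; rewrite eqEsubset sXC; apply/subsetP => x xC; apply/negPn/negP => xX.
by case/negP: dX; apply: indepS (iC x xC); rewrite subsetD1 sXC.
Qed.

Lemma dep_circuit X : X \subset ground M -> X \notin indep M ->
  exists2 C, C \in circuits M & C \subset X.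
Proof.
move=> sX dX; pose P := [pred X : {set T} | (X \subset ground M) && (X \notin indep M)].
have [|C mC sC] := @minset_exists _ P X; first by rewrite /= sX.
by exists C; rewrite ?inE.
Qed.

Lemma circuit_spans C x : C \in circuits M -> x \in C -> spans (C :\ x) x.
Proof.
case/circuitP => sC dC iC xC; rewrite /spans setD1K // (rank_indep (iC x xC)).
have := rank_le_card C; have := rankS (subsetDl C [set x]); move: dC.
by rewrite rank_indepE (rank_indep (iC x xC)) (cardsD1 x C) xC => /eqP; lia.
Qed.

Lemma spans_circuit x Z : x \in ground M -> Z \subset ground M -> x \notin Z ->
  spans Z x -> exists C, [/\ C \in circuits M, x \in C & C \subset x |: Z].
Proof.
move=> xE sZ xNZ /eqP e; have [I [iI sI cI]] := rank_witness Z.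
have xNI : x \notin I by apply: contra xNZ; apply: (subsetP sI).
have [||C cC sC] := @dep_circuit (x |: I).
- by rewrite subUset sub1set xE (subset_trans sI).
- rewrite rank_indepE cardsU1 xNI cI; apply/eqP => e'.
  by have := rankS (setUS [set x] sI); rewrite e' e; lia.
exists C; rewrite cC (subset_trans sC) ?setUS //; split=> //.
apply/negPn/negP => xC; case/circuitP: cC => _ /negP[]; apply: indepS iI.
by rewrite -(setU1K xNI) subsetD1 sC.
Qed.

(** Strong elimination through closure: [C2 :\ y] avoids [x], so the set [Z] of remaining elements
    spans [y], and therefore also [x] through [C1 :\ x]. A circuit witnessing this is the one
    wanted. *)
Lemma circuit_elimination C1 C2 x y : C1 \in circuits M -> C2 \in circuits M ->
  y \in C1 -> y \in C2 -> x \in C1 -> x \notin C2 ->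
  exists C, [/\ C \in circuits M, x \in C & C \subset (C1 :|: C2) :\ y].
Proof.
move=> c1 c2 y1 y2 x1 x2; set Z := (C1 :|: C2) :\ x :\ y.
have xy : x != y by apply: contraNneq x2 => ->.
have [s1 _ _] := circuitP _ c1; have [s2 _ _] := circuitP _ c2.
have hy : spans Z y.
  apply: spansS (circuit_spans c2 y2); apply/subsetP => z; rewrite !inE.
  by case/andP=> -> z2; rewrite z2 orbT andbT; apply: contraNneq x2 => <-.
have hx : spans Z x.
  apply: spans_trans (circuit_spans c1 x1) => z /setD1P[zx z1].
  have [->//|zy] := eqVneq z y; apply: spans_in.
  by rewrite !inE zy zx z1.
have [|||C [cC xC sC]] := @spans_circuit x Z _ _ _ hx.
- exact: (subsetP s1).
- apply/subsetP => z; rewrite !inE => /and3P[_ _ /orP[]].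
    exact: (subsetP s1).
  exact: (subsetP s2).
- by rewrite !inE eqxx andbF.
exists C; split=> //; apply: subset_trans sC _; apply/subsetP => z; rewrite !inE.
by case/orP => [/eqP->|/and3P[-> _ ->]//]; rewrite xy x1.
Qed.

Lemma circuit_sub C C' : C \in circuits M -> C' \in circuits M -> C \subset C' -> C = C'.
Proof.
move=> /circuitP[_ dC _] /circuitP[_ _ iC] sCC; apply/eqP; rewrite eqEsubset sCC /=.
apply/subsetP => x xC; apply/negPn/negP => xNC; case/negP: dC.
by apply: indepS (iC x xC); rewrite subsetD1 sCC.
Qed.

(** Induction on the size of the union. Eliminating [y] while keeping [x] gives [C3], which contains
    some [y'] of [C2] outside [C1]. Eliminating [y'] from [C2] and [C3] while keeping [z] gives
    [C4], which still meets [C1], and [C1 :|: C4] has lost [y']. *)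
Lemma circuits_meet_joined C1 C2 x z : C1 \in circuits M -> C2 \in circuits M ->
  C1 :&: C2 != set0 -> x \in C1 -> z \in C2 ->
  exists C, [/\ C \in circuits M, x \in C & z \in C].
Proof.
have [n] := ubnP #|C1 :|: C2|; elim: n C1 C2 => // n IHn C1 C2 ltn c1 c2.
case/set0Pn=> y /setIP[y1 y2] x1 z2.
have [x2|x2] := boolP (x \in C2); first by exists C2.
have [z1|z1] := boolP (z \in C1); first by exists C1.
have [C3 [c3 x3 s3]] := circuit_elimination c1 c2 y1 y2 x1 x2.
have [z3|z3] := boolP (z \in C3); first by exists C3.
have /subsetPn[y' y'3 y'1] : ~~ (C3 \subset C1).
  apply/negP => /(circuit_sub c3 c1) e; have := subsetP s3 y.
  by rewrite e y1 !inE eqxx => /(_ isT).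
have y'2 : y' \in C2 by have := subsetP s3 _ y'3; rewrite !inE (negPf y'1) => /andP[].
have [C4 [c4 z4 s4]] := circuit_elimination c2 c3 y'2 y'3 z2 z3.
have /subsetPn[w w4 w2] : ~~ (C4 \subset C2).
  apply/negP => /(circuit_sub c4 c2) e; have := subsetP s4 y'.
  by rewrite e y'2 !inE eqxx => /(_ isT).
have w1 : w \in C1.
  have := subsetP s4 _ w4; rewrite !inE (negPf w2) /= => /andP[_ w3].
  by have := subsetP s3 _ w3; rewrite !inE (negPf w2) orbF => /andP[].
apply: (IHn C1 C4) => //; last by apply/set0Pn; exists w; rewrite inE w1.
rewrite -ltnS; apply: leq_trans ltn; rewrite ltnS; apply: proper_card.
apply/properP; split; last first.
  exists y'; first by rewrite inE y'2 orbT.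
  by rewrite inE (negPf y'1) /=; apply/negP => /(subsetP s4); rewrite !inE eqxx.
rewrite subUset subsetUl; apply: subset_trans s4 _; apply/subsetP => u; rewrite !inE.
case/andP=> _ /orP[->|u3]; first by rewrite orbT.
by have := subsetP s3 _ u3; rewrite !inE => /andP[].
Qed.

Lemma joinedP x y : reflect (x = y \/ exists C, [/\ C \in circuits M, x \in C & y \in C])
  (joined M x y).
Proof.
apply: (iffP orP) => [[/eqP->|/exists_inP[C cC /andP[xC yC]]]|[->|[C [cC xC yC]]]].
- by left.
- by right; exists C.
- by left.
- by right; apply/exists_inP; exists C; rewrite ?xC.
Qed.

Lemma joined_trans : transitive (joined M).
Proof.
move=> y x z /joinedP[->//|[C [cC xC yC]]] /joinedP[<-|[C' [cC' yC' zC']]].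
  by apply/joinedP; right; exists C.
apply/joinedP; right; apply: (circuits_meet_joined cC cC') => //.
by apply/set0Pn; exists y; rewrite inE yC.
Qed.

End Rank.

(** * Matroids from bases; cyclic convexity *)

Section MatroidOfBases.
Variables (T : finType) (E : {set T}) (Bs : {set {set T}}).
Implicit Types (x y : T) (I J B : {set T}).
Hypothesis Bs_ground : forall B, B \in Bs -> B \subset E.
Hypothesis Bs_card : {in Bs &, forall B B', #|B| = #|B'|}.
Hypothesis Bs_exchange : forall B1 B2 x, B1 \in Bs -> B2 \in Bs -> x \in B1 :\: B2 ->
  exists2 y, y \in B2 :\: B1 & y |: (B1 :\ x) \in Bs.

Let indep_of : {set {set T}} := [set I : {set T} | [exists B in Bs, I \subset B]].

(** Choose [B2] around [J] with as little as possible outside [J :|: B1]. If no augmentation exists,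
    exchanging in [B2] shows that [B2 :\: B1] lies in [J :\: I], and exchanging in [B1] that
    [B1 :\: B2] lies in [I :\: J]. As [J :\: I] avoids [B1], counting gives #|J| <= #|I|. *)
Let indep_of_aug I J : I \in indep_of -> J \in indep_of -> #|I| < #|J| ->
  exists2 x, x \in J :\: I & x |: I \in indep_of.
Proof.
rewrite !inE => /exists_inP[B1 b1 s1] /exists_inP[B20 b20 s20] ltIJ.
have h : exists B, (B \in Bs) && (J \subset B) by exists B20; rewrite b20.
have [B2 /andP[b2 s2] min2] := arg_minnP
  (P := fun B : {set T} => (B \in Bs) && (J \subset B))
  (fun B : {set T} => #|B :\: (J :|: B1)|) (introT andP (conj b20 s20)).
have [/exists_inP[x xJI xI]|/exists_inPn nx] :=
  boolP [exists x in J :\: I, x |: I \in indep_of]; first by exists x.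
have notB1 x : x \in J -> x \notin I -> x \notin B1.
  move=> xJ xI; apply/negP => x1; have := nx x; rewrite !inE xI xJ => /(_ isT) /negP[].
  by apply/exists_inP; exists B1; rewrite // subUset sub1set x1.
have sub2 : B2 :\: B1 \subset J :\: I.
  apply/subsetP => x /setDP[x2 x1].
  have xI : x \notin I by apply: contra x1; apply: (subsetP s1).
  rewrite inE xI /=; apply/negPn/negP => xJ.
  have [y /setDP[y1 y2] b] : exists2 y, y \in B1 :\: B2 & y |: (B2 :\ x) \in Bs.
    by apply: Bs_exchange; rewrite // inE x1.
  have := min2 (y |: (B2 :\ x)); rewrite b /=.
  have -> : J \subset y |: B2 :\ x.
    apply/subsetP => z zJ; rewrite !inE (subsetP s2) // andbT.
    by rewrite [z == x](contraNF _ xJ) ?orbT // => /eqP<-.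
  move=> /(_ isT); rewrite leqNgt => /negP[]; apply: proper_card; apply/properP; split.
    apply/subsetP => z; rewrite !inE negb_or => /andP[/andP[zJ z1]].
    case/orP => [/eqP e|/andP[_ ->]]; last by rewrite zJ z1.
    by rewrite e y1 in z1.
  exists x; first by rewrite !inE x2 negb_or xJ x1.
  by rewrite !inE eqxx /= orbF !negb_or; apply/negP => /andP[_ /eqP e]; rewrite e y1 in x1.
have sub1 : B1 :\: B2 \subset I :\: J.
  apply/subsetP => x /setDP[x1 x2].
  have xJ : x \notin J by apply: contra x2; apply: (subsetP s2).
  rewrite inE xJ /=; apply/negPn/negP => xI.
  have [y y21 b] : exists2 y, y \in B2 :\: B1 & y |: (B1 :\ x) \in Bs.
    by apply: Bs_exchange; rewrite // inE x2.
  have := nx y (subsetP sub2 _ y21) => /negP[]; rewrite inE.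
  apply/exists_inP; exists (y |: (B1 :\ x)) => //; apply: setUS.
  by rewrite subsetD1 s1.
have := subset_leq_card sub1; have := subset_leq_card sub2.
have := cardsID B2 B1; have := cardsID B1 B2; rewrite setIC (Bs_card b1 b2).
have [e1 e2 e3 e4] : [/\ #|J :&: I| + #|J :\: I| = #|J|, #|I :&: J| + #|I :\: J| = #|I|,
  J :&: I = I :&: J & J :\: I \subset B2 :\: B1].
  rewrite -(cardsID I J) -(cardsID J I) [J :&: I]setIC; split=> //.
  apply/subsetP => x /setDP[xJ xI]; rewrite inE (subsetP s2) // notB1 //.
have := subset_leq_card e4; rewrite e3 in e1; lia.
Qed.

Lemma matroid_of_bases : Bs != set0 -> exists M : matroid T, ground M = E /\ bases M = Bs.
Proof.
case/set0Pn => B0 b0.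
have h1 I : I \in indep_of -> I \subset E.
  by rewrite inE => /exists_inP[B /Bs_ground + s]; apply: subset_trans.
have h2 : set0 \in indep_of by rewrite inE; apply/exists_inP; exists B0; rewrite ?sub0set.
have h3 I J : J \subset I -> I \in indep_of -> J \in indep_of.
  rewrite !inE => sJI /exists_inP[B b s]; apply/exists_inP; exists B => //.
  exact: subset_trans s.
exists (Matroid h1 h2 h3 indep_of_aug); split=> //; apply/setP => B.
rewrite inE; apply/maxsetP/idP => /= [[]|b].
  rewrite inE => /exists_inP[B' b' sB] /(_ B'); rewrite inE => e; rewrite -e //.
  by apply/exists_inP; exists B'.
split=> [|X]; rewrite inE; first by apply/exists_inP; exists B.
case/exists_inP => B' b' sX sB; apply/esym/eqP; rewrite eqEcard sB.
by rewrite (Bs_card b b') subset_leq_card.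
Qed.

End MatroidOfBases.

(** * Four points on a circle and convex sets *)

Section FourPoints.
Variables (T : Type) (pos : T -> nat).
Implicit Types p q s t x y z i j : T.

Definition cyc4 p q s t :=
  [|| [&& pos p < pos q, pos q < pos s & pos s < pos t],
      [&& pos q < pos s, pos s < pos t & pos t < pos p],
      [&& pos s < pos t, pos t < pos p & pos p < pos q] |
      [&& pos t < pos p, pos p < pos q & pos q < pos s]].

Lemma cyc4_rot p q s t : cyc4 p q s t = cyc4 q s t p.
Proof. by rewrite /cyc4; lia. Qed.

Lemma cyc4_neq p q s t : cyc4 p q s t -> pos p != pos s.
Proof. by case/or4P => /and3P[? ? ?]; lia. Qed.

(** One case for each arc that may contain [x]. The dropped point is always [p] or [s], so [q] and
    [t] stay available in every case. *)
Lemma cyc4_refine p q s t x : cyc4 p q s t ->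
  pos x != pos p -> pos x != pos q -> pos x != pos s -> pos x != pos t ->
  [|| cyc4 p x q t, cyc4 q x s t, cyc4 s x t q | cyc4 t x p q].
Proof.
rewrite /cyc4 => c; rewrite !neq_ltn => n1 n2 n3 n4.
case/or4P: c => /and3P[h1 h2 h3];
case/orP: n1 => n1; case/orP: n2 => n2; case/orP: n3 => n3; case/orP: n4 => n4;
first [ exfalso; lia
      | let c := (apply/or4P; first [ by apply: Or41; apply/and3P; split; lia
               | by apply: Or42; apply/and3P; split; lia
               | by apply: Or43; apply/and3P; split; lia
               | by apply: Or44; apply/and3P; split; lia ]) in
        apply/or4P; first [ apply: Or41; c | apply: Or42; c | apply: Or43; c | apply: Or44; c ] ].
Qed.

Lemma cyc4_outside i j y z : pos i < pos j -> ~~ (pos i <= pos y <= pos j) ->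
  ~~ (pos i <= pos z <= pos j) -> pos y != pos z -> cyc4 j z y i || cyc4 j y z i.
Proof.
rewrite /cyc4 !negb_and -!ltnNge neq_ltn => h.
case/orP=> hy; case/orP=> hz; case/orP=> hyz; apply/orP;
first [ exfalso; lia
      | let c := (apply/or4P; first [ by apply: Or41; apply/and3P; split; lia
               | by apply: Or42; apply/and3P; split; lia
               | by apply: Or43; apply/and3P; split; lia
               | by apply: Or44; apply/and3P; split; lia ]) in
        first [ left; c | right; c ] ].
Qed.

End FourPoints.

Section CyclicOrder.
Variables (T : finType) (pos : T -> nat).
Implicit Types (p q s t x y z : T) (N A B : {set T}).
Local Notation cyc4 := (cyc4 pos).

(** No four points of [N] alternate between [A] and its complement, that is, the trace of [A] on [N]
    is an arc. This form needs no starting point, is symmetric under complement and passes to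
    smaller [N]. *)
Definition cyc_convex N A := forall p q s t, p \in N -> q \in N -> s \in N -> t \in N ->
  cyc4 p q s t -> p \in A -> s \in A -> (q \in A) || (t \in A).

Definition cyc_convexb N A := [forall p in N, forall q in N, forall s in N, forall t in N,
  [&& cyc4 p q s t, p \in A & s \in A] ==> (q \in A) || (t \in A)].

Lemma cyc_convexP N A : reflect (cyc_convex N A) (cyc_convexb N A).
Proof.
apply: (iffP idP) => [h p q s t pN qN sN tN c pA sA|h].
  move/forall_inP/(_ p pN)/forall_inP/(_ q qN): h.
  by move=> /forall_inP/(_ s sN)/forall_inP/(_ t tN); rewrite c pA sA.
apply/forall_inP => p pN; apply/forall_inP => q qN; apply/forall_inP => s sN.
by apply/forall_inP => t tN; apply/implyP => /and3P[c pA sA]; apply: (h p q s t).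
Qed.

Lemma cyc_convexS N N' A : N' \subset N -> cyc_convex N A -> cyc_convex N' A.
Proof.
by move=> /subsetP sN cA p q s t /sN pN /sN qN /sN sN' /sN tN; apply: cA.
Qed.

Lemma cyc_convexC N A : cyc_convex N A -> cyc_convex N (~: A).
Proof.
move=> cA p q s t pN qN sN tN c; rewrite !inE => pA sA.
rewrite -negb_and; apply/negP => /andP[qA tA].
by have := cA _ _ _ _ qN sN tN pN; rewrite -cyc4_rot c qA tA (negPf pA) (negPf sA) => /(_ isT isT isT).
Qed.

Lemma cyc_convex_setI N A : cyc_convex N A -> cyc_convex N (A :&: N).
Proof.
move=> cA p q s t pN qN sN tN c; rewrite !inE pN qN sN tN !andbT; exact: cA c.
Qed.

Hypothesis pos_inj : injective pos.

(** Two arcs that cover the circle may intersect in two separate arcs. A point [x] outside both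
    excludes this: in whichever arc between the four points it lies, it breaks the convexity of [A]
    or of [B]. *)
Lemma cyc_convexI N A B : cyc_convex N A -> cyc_convex N B -> ~~ (N \subset A :|: B) ->
  cyc_convex N (A :&: B).
Proof.
move=> cA cB /subsetPn[x xN]; rewrite inE negb_or => /andP[xA xB] p q s t pN qN sN tN c.
case/setIP=> pA pB /setIP[sA sB]; apply/negPn/negP.
rewrite negb_or !inE !negb_and => /andP[qAB tAB].
have hA := cA p q s t pN qN sN tN c pA sA; have hB := cB p q s t pN qN sN tN c pB sB.
wlog [qA tB] : A B cA cB xA xB pA pB sA sB qAB tAB hA hB / q \in A /\ t \in B.
  move=> W; case/orP: (hA) => [qA|tA]; case/orP: (hB) => [qB|tB].
  - by rewrite qA qB in qAB.
  - exact: (W A B).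
  - by apply: (W B A) => //; rewrite orbC.
  - by rewrite tA tB in tAB.
rewrite qA /= in qAB; rewrite tB orbF in tAB.
have d y : ((x \in A) != (y \in A)) || ((x \in B) != (y \in B)) -> pos x != pos y.
  by apply: contraTneq => /pos_inj ->; rewrite !eqxx.
have /or4P[c'|c'|c'|c'] : [|| cyc4 p x q t, cyc4 q x s t, cyc4 s x t q | cyc4 t x p q].
- apply: cyc4_refine c _ _ _ _; apply: d.
  + by rewrite (negPf xA) pA.
  + by rewrite (negPf xA) qA.
  + by rewrite (negPf xA) sA.
  + by rewrite (negPf xB) tB orbT.
- by have := cA _ _ _ _ pN xN qN tN c' pA qA; rewrite (negPf xA) (negPf tAB).
- by have := cA _ _ _ _ qN xN sN tN c' qA sA; rewrite (negPf xA) (negPf tAB).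
- by have := cB _ _ _ _ sN xN tN qN c' sB tB; rewrite (negPf xB) (negPf qAB).
- by have := cB _ _ _ _ tN xN pN qN c' tB pB; rewrite (negPf xB) (negPf qAB).
Qed.

Lemma cyc_convexU N A B : cyc_convex N A -> cyc_convex N B ->
  ~~ [disjoint N :&: A & B] -> cyc_convex N (A :|: B).
Proof.
move=> cA cB; rewrite -setI_eq0 => /set0Pn[x]; rewrite !inE => /andP[/andP[xN xA] xB].
have := @cyc_convexI N _ _ (cyc_convexC cA) (cyc_convexC cB).
have -> : ~~ (N \subset ~: A :|: ~: B).
  by apply/subsetPn; exists x; rewrite ?inE // xA xB.
by rewrite -setCU => /(_ isT)/cyc_convexC; rewrite setCK.
Qed.

(* Two convex sets that contain [j] but not its predecessor [i] are initial
   segments of the cyclic order started at [j]. *)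
Lemma cyc_convex_nested N A B i j : cyc_convex N A -> cyc_convex N B ->
  A \subset N -> B \subset N -> i \in N -> j \in N -> pos i < pos j ->
  (forall x, x \in N -> ~~ (pos i < pos x < pos j)) ->
  i \notin A -> i \notin B -> j \in A -> j \in B -> (A \subset B) || (B \subset A).
Proof.
move=> cA cB sA sB iN jN ltij adj iA iB jA jB.
rewrite -[_ || _]negbK negb_or; apply/negP => /andP[/subsetPn[y yA yB] /subsetPn[z zB zA]].
have [yN zN] := (subsetP sA _ yA, subsetP sB _ zB).
have ny : ~~ (pos i <= pos y <= pos j).
  apply: contra (adj y yN); rewrite !ltn_neqAle => /andP[-> ->]; rewrite !andbT.
  by apply/andP; split; apply/eqP => /pos_inj e; [rewrite -e (negPf iA) in yA|rewrite e jB in yB].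
have nz : ~~ (pos i <= pos z <= pos j).
  apply: contra (adj z zN); rewrite !ltn_neqAle => /andP[-> ->]; rewrite !andbT.
  by apply/andP; split; apply/eqP => /pos_inj e; [rewrite -e (negPf iB) in zB|rewrite e jA in zA].
have nyz : pos y != pos z by apply/eqP => /pos_inj e; rewrite e (negPf zA) in yA.
have [c|c] := orP (cyc4_outside ltij ny nz nyz).
- by have := cA _ _ _ _ jN zN yN iN c jA yA; rewrite (negPf zA) (negPf iA).
- by have := cB _ _ _ _ jN yN zN iN c jB zB; rewrite (negPf yB) (negPf iB).
Qed.

(** [A] and [N :\: B] both contain [j] and not [i], hence are nested; as [A] meets [B], it is
    [N :\: B] that lies in [A]. This excludes the pairs on which the lowered ranks could fail to be
    submodular. *)
Lemma cyc_convex_adjacent N A B i j : cyc_convex N A -> cyc_convex N B ->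
  A \subset N -> B \subset N -> i \in N -> j \in N -> pos i < pos j ->
  (forall x, x \in N -> ~~ (pos i < pos x < pos j)) ->
  j \in A -> i \notin A -> i \in B -> j \notin B ->
  ~~ [disjoint A & B] -> N \subset A :|: B.
Proof.
move=> cA cB sA sB iN jN ltij adj jA iA iB jB /pred0Pn[z /andP[/= zA zB]].
apply/subsetP => w wN; rewrite inE -[_ || _]negbK negb_or; apply/negP => /andP[wA wB].
have zN := subsetP sA _ zA.
have c : cyc_convex N (N :\: B).
  have := cyc_convex_setI (cyc_convexC cB); rewrite setIC -setDE //.
have := @cyc_convex_nested N A (N :\: B) i j cA c sA (subsetDl _ _) iN jN ltij adj iA.
rewrite !inE iB jB jN /= => /(_ isT jA isT) /orP[/subsetP/(_ _ zA)|/subsetP/(_ w)].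
  by rewrite inE zB.
by rewrite inE wB wN (negPf wA) => /(_ isT).
Qed.

End CyclicOrder.

(** * Removing a bridge *)

Section Nontrivial.
Variables (T : finType) (pos : T -> nat).
Implicit Types (M : matroid T) (x y : T) (A B X Y : {set T}).

(** The elements that are neither loops nor coloops. The lock keeps rewriting with [inE] from
    unfolding the set. *)
Definition nontrivial M : {set T} :=
  locked [set x | [exists B in bases M, x \in B] && [exists B in bases M, x \notin B]].

Lemma nontrivialP M x : reflect
  ((exists2 B, B \in bases M & x \in B) /\ (exists2 B, B \in bases M & x \notin B))
  (x \in nontrivial M).
Proof.
rewrite /nontrivial -lock [x \in _]inE.
by apply: (iffP andP) => -[/exists_inP h1 /exists_inP h2].
Qed.

Lemma nontrivial_ground M : nontrivial M \subset ground M.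
Proof. by apply/subsetP => x /nontrivialP[[B /base_ground/subsetP sB /sB]]. Qed.

Lemma base_symdiff_nontrivial M B1 B2 x : B1 \in bases M -> B2 \in bases M ->
  x \in B1 -> x \notin B2 -> x \in nontrivial M.
Proof. by move=> b1 b2 x1 x2; apply/nontrivialP; split; [exists B1|exists B2]. Qed.

Lemma base_trivial M B1 B2 : B1 \in bases M -> B2 \in bases M ->
  B1 :\: nontrivial M = B2 :\: nontrivial M.
Proof.
move=> b1 b2; apply/setP => x; rewrite !in_setD.
case xN: (x \in nontrivial M) => //=; apply/idP/idP => x1; apply/negPn/negP => x2.
  by rewrite (base_symdiff_nontrivial b1 b2) in xN.
by rewrite (base_symdiff_nontrivial b2 b1) in xN.
Qed.

(** [B :\: nontrivial M] is the set of coloops, the same for every base, so the coloops in [X]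
    contribute exactly their number. *)
Lemma rank_nontrivial M B X : B \in bases M ->
  rank_of M X = rank_of M (X :&: nontrivial M) + #|X :&: (B :\: nontrivial M)|.
Proof.
move=> b; set N := nontrivial M.
have split B' : B' \in bases M ->
    #|B' :&: X| = #|B' :&: (X :&: N)| + #|X :&: (B :\: N)|.
  move=> b'; rewrite -(cardsID N) -setIA (base_trivial b b') -/N; congr (_ + #|pred_of_set _|).
  by apply/setP => x; rewrite !inE; case: (x \in X); rewrite ?andbF ?andbT.
apply/anti_leq/andP; split.
  by have [B' b' <-] := rank_base M X; rewrite (split _ b') leq_add2r base_leq_rank.
by have [B' b' <-] := rank_base M (X :&: N); rewrite -split ?base_leq_rank.
Qed.

(* Loops and coloops are ignored in the convexity condition: the bridge step below
   picks [i] and [j] that are adjacent only up to loops and coloops. *)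
Definition cyclically_determined M := forall B, B \subset ground M -> #|B| = rank M ->
  (forall A, A \subset ground M -> cyc_convex pos (nontrivial M) A ->
     #|B :&: A| <= rank_of M A) ->
  B \in bases M.

(** Once [B] has the same coloops as a base, these add the same amount to both sides of each
    inequality, so only subsets of [nontrivial M] need testing. *)
Lemma cyclically_determinedP M B0 B : cyclically_determined M -> B0 \in bases M ->
  #|B| = rank M -> B :\: nontrivial M = B0 :\: nontrivial M ->
  (forall A, A \subset nontrivial M -> cyc_convex pos (nontrivial M) A ->
     #|B :&: A| <= rank_of M A) ->
  B \in bases M.
Proof.
move=> cM b0 cB eB h; apply: cM => //.
  apply/subsetP => x xB; have [|xN] := boolP (x \in nontrivial M).
    exact: (subsetP (nontrivial_ground M)).
  have : x \in B0 :\: nontrivial M by rewrite -eB inE xN.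
  by case/setDP=> /(subsetP (base_ground b0)).
move=> A sA cA; rewrite (rank_nontrivial A b0) -(cardsID (nontrivial M)) -eB.
apply: leq_add.
  rewrite -setIA; apply: h; first exact: subsetIr.
  exact: cyc_convex_setI.
by rewrite subset_leq_card //; apply/subsetP => x; rewrite !inE => /andP[-> /andP[-> ->]].
Qed.

Lemma swap_card B x y : x \in B -> y \notin B -> #|y |: (B :\ x)| = #|B|.
Proof.
by move=> xB yB; rewrite cardsU1 !inE (negPf yB) andbF /= [RHS](cardsD1 x) xB.
Qed.

Lemma swap_trivial (N : {set T}) B x y : x \in N -> y \in N -> (y |: (B :\ x)) :\: N = B :\: N.
Proof.
move=> xN yN; apply/setP => z; rewrite !inE; case: eqP => [->|_]; first by rewrite yN.
by case: eqP => [->|_] //=; rewrite xN.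
Qed.

End Nontrivial.

Section Bridge.
Variables (T : finType) (pos : T -> nat) (M : matroid T) (i j : T) (A0 : {set T}).
Implicit Types (x y : T) (A B X Y : {set T}).
Local Notation r := (rank_of M).
Local Notation N := (nontrivial M).
Local Notation convex := (cyc_convex pos N).
Hypothesis pos_inj : injective pos.
Hypothesis detM : cyclically_determined pos M.
Hypotheses (iN : i \in N) (jN : j \in N) (ltij : pos i < pos j).
Hypothesis adj : forall x, x \in N -> ~~ (pos i < pos x < pos j).
Hypotheses (sA0 : A0 \subset N) (cA0 : convex A0) (jA0 : j \in A0) (iA0 : i \notin A0).
Hypotheses (spA0 : spans M A0 i) (nspA0 : ~~ spans M (A0 :\ j) j).

(** The only sets that can lose rank when a multiple of [i] is subtracted from [j]: a set that
    misses [j] or contains [i] keeps its rank, and one that contains [j] without spanning [i] cannot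
    become smaller in rank. *)
Let good X := [&& j \in X, i \notin X & spans M X i].

(* the ranks after subtracting from the vector of [j] the multiple of the vector of
   [i] that brings it into the span of [A0 :\ j] *)
Let r' X := if good X then r (X :\ j) else r X.

Let r'_le X : r' X <= r X.
Proof. by rewrite /r'; case: ifP => // _; rewrite rankS ?subsetDl. Qed.

(** If [B] contains [i] and [j], the union is not lowered; should the intersection not be lowered
    either, it does not span [i], and submodularity for [i |: A] and [B] gains the missing unit. If
    [B] contains only [i], the pair covers [N], which is excluded; if only [j], the sets are nested;
    if neither, [j] can be deleted from [A] and from the union. *)
Let r'_submod_good A B : A \subset N -> B \subset N -> convex A -> convex B ->
  ~~ [disjoint A & B] -> ~~ (N \subset A :|: B) -> good A ->
  r' (A :|: B) + r' (A :&: B) <= r' A + r' B.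
Proof.
move=> sA sB cA cB dAB uAB gA; have /and3P[jA iA spA] := gA.
have rA : r A <= (r (A :\ j)).+1 by apply: rankD1_ge.
have [iB|iB] := boolP (i \in B); have [jB|jB] := boolP (j \in B).
- have nU : ~~ good (A :|: B) by rewrite /good !inE iB orbT andbF.
  have nB : ~~ good B by rewrite /good iB andbF.
  rewrite /r' gA (negPf nU) (negPf nB).
  have eU : (A :\ j) :|: B = A :|: B.
    apply/setP => x; rewrite !inE; case: (eqVneq x j) => [->|_] //=.
    by rewrite jA jB.
  case: ifP => gI.
    have := rank_submod M (A :\ j) B; rewrite eU.
    by have -> : (A :\ j) :&: B = (A :&: B) :\ j by rewrite setIDAC.
  have nsp : r (i |: (A :&: B)) > r (A :&: B).
    rewrite ltn_neqAle rankS ?subsetUr // andbT eq_sym.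
    by move: gI; rewrite /good !inE jA jB (negPf iA) /= /spans => ->.
  have := rank_submod M (i |: A) B; rewrite -setUA (setUidPr (_ : [set i] \subset A :|: B)).
    rewrite setIUl (setIidPl (_ : [set i] \subset B)) ?sub1set //.
    by move/eqP: spA => ->; move: rA nsp; clear; lia.
  by rewrite sub1set inE iB orbT.
- by rewrite (cyc_convex_adjacent pos_inj cA cB sA sB iN jN ltij adj) in uAB.
- have /orP[sAB|sBA] := cyc_convex_nested pos_inj cA cB sA sB iN jN ltij adj iA iB jA jB.
    by rewrite (setUidPr sAB) (setIidPl sAB) addnC.
  by rewrite (setUidPl sBA) (setIidPr sBA).
- have gU : good (A :|: B).
    by rewrite /good !inE jA (negPf iA) (negPf iB) (spansS (subsetUl A B)).
  have nB : ~~ good B by rewrite /good (negPf jB).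
  have nI : ~~ good (A :&: B) by rewrite /good inE (negPf jB) andbF.
  rewrite /r' gA gU (negPf nB) (negPf nI).
  have := rank_submod M (A :\ j) B.
  have -> : (A :\ j) :|: B = (A :|: B) :\ j.
    by rewrite setDUl [B :\ j](setDidPl _) // disjoint_sym disjoints1.
  by have -> : (A :\ j) :&: B = A :&: B
    by rewrite setIDAC; apply/setDidPl; rewrite disjoint_sym disjoints1 inE (negPf jB) andbF.
Qed.

Let r'_submod A B : A \subset N -> B \subset N -> convex A -> convex B ->
  ~~ [disjoint A & B] -> ~~ (N \subset A :|: B) ->
  r' (A :|: B) + r' (A :&: B) <= r' A + r' B.
Proof.
move=> sA sB cA cB dAB uAB.
have [gA|nA] := boolP (good A); first exact: r'_submod_good.
have [gB|nB] := boolP (good B).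
  rewrite setUC setIC [leqRHS]addnC; apply: r'_submod_good => //.
    by rewrite disjoint_sym.
  by rewrite setUC.
apply: leq_trans (leq_add (r'_le _) (r'_le _)) _.
by rewrite /r' (negPf nA) (negPf nB) rank_submod.
Qed.

Let Bs := [set B in bases M | [forall A : {set T}, (A \subset N) ==>
  cyc_convexb pos N A ==>
  (#|B :&: A| <= r' A)]].

Let BsP B : reflect (B \in bases M /\
    forall A, A \subset N -> convex A -> #|B :&: A| <= r' A) (B \in Bs).
Proof.
rewrite [B \in Bs]in_set; apply: (iffP andP) => -[bB h]; split=> //.
  move=> A sA /cyc_convexP cA.
  by have := forallP h A; rewrite sA cA.
by apply/forallP => A; apply/implyP => sA; apply/implyP => /cyc_convexP; apply: h.
Qed.

Let Bs_cut B0 B : B0 \in bases M -> #|B| = rank M -> B :\: N = B0 :\: N ->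
  (forall A, A \subset N -> convex A -> #|B :&: A| <= r' A) -> B \in Bs.
Proof.
move=> b0 cB eB h; apply/BsP; split=> //.
apply: (cyclically_determinedP detM b0) => // A sA cA.
exact: leq_trans (h A sA cA) (r'_le A).
Qed.

(** Uncrossing. If no exchange works, every [y] in [B2 :\: B1] lies in a convex set that avoids [x]
    and is tight for [B1]. Two tight sets that meet have a tight union, so the maximal ones are
    disjoint. On their cover [B2] has at most as many elements as [B1]; off the cover it is a proper
    subset of [B1], since [x] is missing. This contradicts equal cardinality. *)
Let Bs_exchange B1 B2 x : B1 \in Bs -> B2 \in Bs -> x \in B1 :\: B2 ->
  exists2 y, y \in B2 :\: B1 & y |: (B1 :\ x) \in Bs.
Proof.
move=> /BsP[b1 h1] /BsP[b2 h2] /setDP[x1 x2].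
have xN : x \in N by apply: base_symdiff_nontrivial b1 b2 _ _.
have [/exists_inP//|/exists_inPn nex] :=
  boolP [exists y in B2 :\: B1, y |: (B1 :\ x) \in Bs].
pose tight (A : {set T}) := [&& A \subset N, x \notin A, #|B1 :&: A| == r' A &
  cyc_convexb pos N A].
pose P := [set A : {set T} | maxset tight A].
have tightP A : A \in P -> [/\ A \subset N, x \notin A, #|B1 :&: A| = r' A & convex A].
  by rewrite inE => /maxsetp/and4P[? ? /eqP ? /cyc_convexP].
have cov : B2 :\: B1 \subset cover P.
  apply/subsetP => y y21; have /setDP[y2 y1] := y21.
  have yN : y \in N by apply: base_symdiff_nontrivial b2 b1 _ _.
  have [A /and3P[sA cA vA]] : exists A : {set T}, [&& A \subset N,
     cyc_convexb pos N A &
     r' A < #|(y |: (B1 :\ x)) :&: A|].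
    apply/existsP; apply: contraT => /existsPn h.
    case/negP: (nex y y21); apply: (Bs_cut b1).
    - by rewrite swap_card // (base_card b1).
    - exact: swap_trivial.
    - move=> A sA /cyc_convexP cA; have := h A; rewrite sA cA /=; clear; lia.
  have hA := h1 A sA (elimT (cyc_convexP _ _ _) cA).
  have yA : y \in A.
    apply/negPn/negP => yA; suff : #|(y |: (B1 :\ x)) :&: A| <= #|B1 :&: A| by move: hA vA; clear; lia.
    apply: subset_leq_card; apply/subsetP => z; rewrite !inE.
    by case: eqP => [->|_]; rewrite ?(negPf yA) ?andbF //= => /andP[/andP[_ ->] ->].
  have xA : x \notin A.
    apply/negP => xA; suff : #|(y |: (B1 :\ x)) :&: A| = #|B1 :&: A| by move: hA vA; clear; lia.
    have -> : (y |: (B1 :\ x)) :&: A = y |: ((B1 :&: A) :\ x).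
      apply/setP => z; rewrite !inE; case: (eqVneq z y) => [->|_]; rewrite ?yA //=.
      by rewrite andbA.
    by rewrite cardsU1 !inE (negPf y1) andbF [RHS](cardsD1 x) !inE x1 xA.
  have eA : #|B1 :&: A| == r' A.
    rewrite eqn_leq hA -ltnS; apply: leq_trans vA _.
    have -> : (y |: (B1 :\ x)) :&: A = y |: (B1 :&: A).
      apply/setP => z; rewrite !inE; case: (eqVneq z y) => [->|_]; rewrite ?yA //=.
      by case: (eqVneq z x) => [->|]; rewrite ?(negPf xA) ?andbF.
    by rewrite cardsU1; clear; lia.
  have tA : tight A by rewrite /tight sA xA eA cA.
  have [A' mA' sAA'] := maxset_exists tA.
  by apply/bigcupP; exists A'; rewrite ?inE // (subsetP sAA').
have triv : trivIset P.
  apply/trivIsetP => A A' PA PA' neq; apply/negPn/negP => dis.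
  have [[sA xA eA cA] [sA' xA' eA' cA']] := (tightP A PA, tightP A' PA').
  have cU : convex (A :|: A').
    by apply: cyc_convexU => //; rewrite (setIidPr sA).
  have nU : ~~ (N \subset A :|: A').
    by apply/subsetPn; exists x; rewrite // inE negb_or xA xA'.
  have cI : convex (A :&: A') by apply: cyc_convexI.
  have tU : tight (A :|: A').
    rewrite /tight subUset sA sA' inE negb_or xA xA' (introT (cyc_convexP _ _ _) cU) andbT /=.
    have := r'_submod sA sA' cA cA' dis nU; rewrite -eA -eA'.
    have := h1 (A :|: A'); rewrite subUset sA sA' => /(_ isT cU).
    have := h1 (A :&: A') (subset_trans (subsetIl _ _) sA) cI.
    have := cardsUI (B1 :&: A) (B1 :&: A'); rewrite -setIUr -setIIr; clear; lia.
  move: PA PA' neq; rewrite !inE => /maxsetP[_ mA] /maxsetP[_ mA'].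
  by rewrite -(mA _ tU) ?subsetUl // -{2}(mA' _ tU) ?subsetUr // eqxx.
have sum_cover B : #|B :&: cover P| = \sum_(A in P) #|B :&: A|.
  rewrite -sum1_card (eq_bigl (fun x => (x \in cover P) && (x \in B))); last first.
    by move=> z; rewrite inE andbC.
  rewrite big_mkcondr /= big_trivIset //; apply: eq_bigr => A _.
  rewrite -big_mkcondr -sum1_card; apply: eq_bigl => z; by rewrite inE andbC.
have leU : #|B2 :&: cover P| <= #|B1 :&: cover P|.
  rewrite !sum_cover; apply: leq_sum => A /tightP[sA _ -> cA]; exact: h2.
have ltD : #|B2 :\: cover P| < #|B1 :\: cover P|.
  apply: proper_card; apply/properP; split.
    apply/subsetP => z /setDP[z2 zc]; rewrite inE zc /=; apply/negPn/negP => z1.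
    by case/negP: zc; apply: (subsetP cov); rewrite inE z1.
  exists x; last by rewrite inE (negPf x2) andbF.
  rewrite inE x1 andbT; apply/bigcupP => -[A /tightP[_ xA _ _]]; exact/negP.
have := cardsID (cover P) B1; have := cardsID (cover P) B2.
by rewrite (base_card b1) (base_card b2); move: leU ltD; clear; lia.
Qed.

(* Otherwise let [Bd] be a base avoiding [j] and spanning [A :\ j], exchange [d] for
   [j] to get a base [Bb], and exchange [c] in [A :\ j] for [i] in [Bb]; as [i, j, c, d]
   are cyclically ordered, sorting [Bd] and the last base gives a base that contains [i]
   and spans [A :\ j] without it. *)
Let good_nspans A : A \subset N -> convex A -> good A -> ~~ spans M (A :\ j) j ->
  ~~ spans M (A :\ j) i.
Proof.
move=> sA cA /and3P[jA iA spA] nj; apply/negP => spi.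
have [I [iI sI cI]] := rank_witness M (A :\ j).
have spI x : x \in A :\ j -> spans M I x.
  move=> xA; apply/eqP/anti_leq/andP; split; last by rewrite rankS ?subsetUr.
  by rewrite (rank_indep iI) cI rankS // subUset sub1set xA.
have spIi : spans M I i by apply: spans_trans spI spi.
have spIx x : spans M I x -> spans M (A :\ j) x.
  by move=> h; apply: spans_trans h => y /(subsetP sI); apply: spans_in.
have jI : j \notin I by apply/negP => /(subsetP sI); rewrite !inE eqxx.
have iI' : i \notin I by apply/negP => /(subsetP sI); rewrite !inE (negPf iA) andbF.
have iIj : j |: I \in indep M.
  have : r I < r (j |: I).
    rewrite ltn_neqAle rankS ?subsetUr // andbT eq_sym.
    by apply: contra nj => h; apply: spIx.
  rewrite rank_indepE (rank_indep iI) cardsU1 jI => h.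
  by rewrite eqn_leq (leq_trans (rank_le_card M _)) // cardsU1 jI.
have [/nontrivialP[[Bi bi iBi] _] /nontrivialP[_ [Bj bj jBj]]] := (iN, jN).
have [Bd [iBd sIBd sBdE cBd]] : exists J, [/\ J \in indep M, I \subset J,
    J \subset ground M :\ j & #|J| = r (ground M :\ j)].
  by apply: rank_extend => //; rewrite subsetD1 indep_ground.
have bd : Bd \in bases M.
  apply/basesP; split=> //; apply/anti_leq; rewrite -{1}(rank_indep iBd) rank_le /= cBd.
  rewrite -(base_card bj) -(rank_indep (base_indep bj)) rankS // subsetD1 jBj.
  by rewrite base_ground.
have jBd : j \notin Bd by move: sBdE; rewrite subsetD1 => /andP[].
have iBd' : i \notin Bd.
  apply/negP => iB; have sI' : i |: I \subset Bd by rewrite subUset sub1set iB.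
  have := rank_indep (indepS sI' iBd); move/eqP: spIi => ->.
  by rewrite (rank_indep iI) cardsU1 iI'; clear; lia.
have [|Y [sY iY cY]] := indep_extend iIj iBd.
  by rewrite (base_card bd) -(rank_indep iIj) rank_le.
set Bb := j |: I :|: Y in iY cY.
have bb : Bb \in bases M by apply/basesP; rewrite cY (base_card bd).
have jBb : j \in Bb by rewrite !inE eqxx.
have sBb : Bb :\ j \subset Bd.
  apply/subsetP => x; rewrite !inE => /andP[/negPf-> /= /orP[/(subsetP sIBd)//|/(subsetP sY)]].
  by case/setDP.
have IBb : I \subset Bb by rewrite /Bb -setUA setUCA subsetUl.
clearbody Bb.
have [d dBd dBb] : exists2 d, d \in Bd & d \notin Bb.
  apply/subsetPn/negP => sBd; have := subset_leq_card (_ : Bd \subset Bb :\ j).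
  rewrite subsetD1 sBd jBd => /(_ isT).
  by move: (cardsD1 j Bb); rewrite jBb cY; clear; lia.
have eBd : Bd = d |: (Bb :\ j).
  apply/esym/eqP; rewrite eqEcard subUset sub1set dBd sBb.
  by rewrite swap_card // cY leqnn.
have dN : d \in N by apply: base_symdiff_nontrivial bd bb _ _.
have dI : d \notin I by apply: contra dBb; apply: (subsetP IBb).
have dA : d \notin A.
  apply/negP => dA; have dj : d \in A :\ j.
    by rewrite !inE dA andbT; apply: contraNneq dBb => ->.
  have sI' : d |: I \subset Bd by rewrite subUset sub1set dBd.
  have := rank_indep (indepS sI' iBd); move/eqP: (spI _ dj) => ->.
  by rewrite (rank_indep iI) cardsU1 dI; clear; lia.
have ii : [set i] \in indep M by apply: indepS (base_indep bi); rewrite sub1set.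
have spi0 : 0 < #|I|.
  have := rankS M (_ : [set i] \subset i |: I); rewrite sub1set setU11 => /(_ isT).
  by move/eqP: spIi => ->; rewrite (rank_indep ii) (rank_indep iI) cards1.
(* Growing [[set i]] inside [I] up to the size of [I] leaves out exactly one element [c], the one
   that [i] can replace. *)
have [Z [sZ iZ cZ]] := indep_extend ii iI (leq_trans (eq_leq (cards1 i)) spi0).
have [c cI' cZ'] : exists2 c, c \in I & c \notin Z.
  apply/subsetPn/negP => sIZ; move: cZ.
  have -> : [set i] :|: Z = i |: I.
    by congr (_ |: _); apply/eqP; rewrite eqEsubset sIZ (subset_trans sZ) ?subsetDl.
  by rewrite cardsU1 iI'; clear; lia.
have eZ : i |: Z = i |: (I :\ c).
  apply/eqP; rewrite eqEcard; apply/andP; split; last by rewrite cZ swap_card.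
  apply: setUS; rewrite subsetD1 cZ' andbT.
  by apply: subset_trans sZ (subsetDl _ _).
have cA' : c \in A :\ j by apply: (subsetP sI).
have cBb : c \in Bb by apply: (subsetP IBb).
have iBb : i \notin Bb.
  have nij : i != j by apply: contraTneq ltij => ->; rewrite ltnn.
  apply/negP => iB; have := subsetP sBb i; rewrite !inE nij => /(_ iB).
  by rewrite (negPf iBd').
have cN : c \in N by apply: (subsetP sA); case/setD1P: cA'.
have bc : i |: (Bb :\ c) \in bases M.
  rewrite rank_baseE; last by rewrite swap_card // cY (base_card bd).
  have spc : spans M (i |: (Bb :\ c)) c.
    apply: (@spansS _ _ (i |: (I :\ c))); first by rewrite setUS // setSD.
    rewrite /spans -eZ rank_indepE in iZ *; move/eqP: iZ => ->; rewrite cZ eqn_leq.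
    rewrite -(rank_indep iI); apply/andP; split.
      move/eqP: spIi => <-; apply: rankS; rewrite eZ !subUset !sub1set !inE eqxx cI' orbT /=.
      by rewrite (subset_trans (subsetDl _ _)) ?subsetUr.
    by apply: rankS; apply/subsetP => x xI; rewrite eZ !inE xI; case: eqP => _; rewrite ?orbT.
  apply/eqP/anti_leq; rewrite rank_le -(base_card bb) -(rank_indep (base_indep bb)) /=.
  move/eqP: spc => <-; apply: rankS; apply/subsetP => x xB.
  by rewrite !inE xB; case: eqP => // _; rewrite orbT.
(* The other order of [c] and [d] would make [A], which contains [j] and [c] but neither [i] nor
   [d], fail to be convex. *)
have cyc : cyc4 pos i j c d.
  have out x : x \in N -> x != i -> x != j -> ~~ (pos i <= pos x <= pos j).
    move=> xN xi xj; apply: contra (adj xN); rewrite !ltn_neqAle => /andP[-> ->].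
    by rewrite !andbT; apply/andP; split; apply/eqP => /pos_inj e;
       rewrite e eqxx in xi xj.
  have ci : c != i by apply: contraNneq iBb => <-.
  have cj : c != j by case/setD1P: cA'.
  have di : d != i by apply: contraNneq iBd' => <-.
  have dj : d != j by apply: contraNneq dBb => ->.
  have cd : pos d != pos c by apply/eqP => /pos_inj e; rewrite e cBb in dBb.
  have /orP[h|h] := cyc4_outside ltij (out d dN di dj) (out c cN ci cj) cd.
    by rewrite cyc4_rot.
  have cA1 : c \in A by case/setD1P: cA'.
  by have := cA _ _ _ _ jN dN cN iN h jA cA1; rewrite (negPf dA) (negPf iA).
have : i |: (Bb :\ j) \in bases M.
  apply: (cyclically_determinedP detM bb).
  - by rewrite swap_card // cY (base_card bd).
  - exact: swap_trivial.
  (* Each convex [A2] gets its bound from one of three known bases: [Bb] if it contains [j] or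
     avoids [i], the base with [i] for [c] if it avoids [j] and [c]. In the remaining case [i] and
     [c] are in [A2] and [j] is not, so convexity puts [d] in [A2] and [Bd] gives the bound. *)
  move=> A2 sA2 cA2; have [jA2|jA2] := boolP (j \in A2).
    apply: leq_trans (base_leq_rank A2 bb).
    rewrite (cardsD1 j (Bb :&: A2)) inE jBb jA2 setIUl setIDAC.
    by rewrite (leq_trans (leq_card_setU _ _)) // leq_add2r
      (leq_trans (subset_leq_card (subsetIl _ _))) ?cards1.
  have [cA2'|cA2'] := boolP (c \in A2); last first.
    apply: leq_trans (base_leq_rank A2 bc); apply: subset_leq_card.
    apply/subsetP => x; rewrite !inE => /andP[+ xA2]; rewrite xA2 andbT.
    case: eqP => //= _ /andP[_ ->]; rewrite andbT; by apply: contraTneq xA2 => ->.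
  have [iA2|iA2] := boolP (i \in A2); last first.
    apply: leq_trans (base_leq_rank A2 bb); apply: subset_leq_card.
    apply/subsetP => x; rewrite !inE => /andP[+ xA2]; rewrite xA2 andbT.
    by case: eqP xA2 => [->|_ _ /= /andP[]//]; rewrite (negPf iA2).
  have dA2 : d \in A2 by have := cA2 _ _ _ _ iN jN cN dN cyc iA2 cA2'; rewrite (negPf jA2).
  apply: leq_trans (base_leq_rank A2 bd); rewrite eBd.
  rewrite !setIUl (setIidPl (_ : [set i] \subset A2)) ?sub1set //.
  rewrite (setIidPl (_ : [set d] \subset A2)) ?sub1set //.
  by rewrite !cardsU1 !inE (negPf iBb) (negPf dBb) !andbF.
move/base_indep => h; have sI' : i |: I \subset i |: (Bb :\ j).
  by rewrite setUS // subsetD1 IBb.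
have := rank_indep (indepS sI' h); move/eqP: spIi => ->.
by rewrite (rank_indep iI) cardsU1 iI'; clear; lia.
Qed.

Let goodA0 : good A0. Proof. by rewrite /good jA0 iA0. Qed.

Let nij : i != j. Proof. by apply: contraTneq ltij => ->; rewrite ltnn. Qed.

(** A lowered set [A] that excludes [B] is tight for [B] in [M], which forces [j] in and [i] out.
    After the swap the only dangerous [A2] contains [i], not [j], and is tight for [B]; then
    submodularity makes [A :&: A2] span [i], against [good_nspans]. *)
Lemma bridge_removed B : B \in bases M -> B \notin Bs ->
  [/\ j \in B, i \notin B & i |: (B :\ j) \in Bs].
Proof.
move=> b nB.
have [A /and3P[sA cA vA]] : exists A : {set T},
    [&& A \subset N, cyc_convexb pos N A & r' A < #|B :&: A|].
  apply/existsP; apply: contraT => /existsPn h; case/negP: nB; apply/BsP; split=> //.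
  by move=> A sA /cyc_convexP cA; have := h A; rewrite sA cA /=; clear; lia.
have gA : good A.
  by apply: contraLR vA => /negPf gA; rewrite /r' gA -leqNgt base_leq_rank.
have /and3P[jA iA spA] := gA.
rewrite /r' gA in vA; have leA := base_leq_rank A b.
have nj : ~~ spans M (A :\ j) j.
  by apply/negP; rewrite /spans setD1K // => /eqP e; move: vA leA; rewrite e; clear; lia.
have jB : j \in B.
  apply: contraLR vA => jB; rewrite -leqNgt.
  suff -> : B :&: A = B :&: (A :\ j) by apply: base_leq_rank.
  by rewrite setIDA; apply/esym/setDidPl; rewrite disjoint_sym disjoints1 inE (negPf jB).
have eA : #|B :&: A| = r A.
  by apply/anti_leq; rewrite leA /= (leq_trans (rankD1_ge M j A)).
have iB : i \notin B.
  apply/negP => iB; have := base_leq_rank (i |: A) b; move/eqP: spA => ->; rewrite -eA.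
  rewrite setIUr (setIidPr _) ?sub1set // cardsU1 inE (negPf iA) andbF; clear; lia.
split=> //; apply: (Bs_cut b).
- by rewrite swap_card // (base_card b).
- exact: swap_trivial.
move=> A2 sA2 cA2.
have leA2 := base_leq_rank A2 b.
have [jA2|jA2] := boolP (j \in A2); have [iA2|iA2] := boolP (i \in A2).
- rewrite /r' /good iA2 andbF; apply: leq_trans leA2.
  rewrite setIUl setIDAC (cardsD1 j (B :&: A2)) inE jB jA2.
  rewrite (leq_trans (leq_card_setU _ _)) // leq_add2r.
  by rewrite (leq_trans (subset_leq_card (subsetIl _ _))) ?cards1.
- have -> : (i |: B :\ j) :&: A2 = (B :&: A2) :\ j.
    rewrite setIUl setIDAC; have -> : [set i] :&: A2 = set0.
      by apply/disjoint_setI0; rewrite disjoints1.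
    by rewrite set0U.
  have := cardsD1 j (B :&: A2); rewrite inE jB jA2 /r'; have := rankD1_ge M j A2.
  by case: ifP => _; move: leA2; clear; lia.
- have nA2 : ~~ good A2 by rewrite /good (negPf jA2).
  rewrite /r' (negPf nA2) leqNgt; apply/negP => v.
  have eA2 : #|B :&: A2| = r A2.
    apply/anti_leq; rewrite leA2 -ltnS (leq_trans v) //.
    rewrite setIUl (leq_trans (leq_card_setU _ _)) // -add1n leq_add //.
      by rewrite (leq_trans (subset_leq_card (subsetIl _ _))) ?cards1.
    by rewrite subset_leq_card // setSI // subsetDl.
  have /negP[] := good_nspans sA (elimT (cyc_convexP _ _ _) cA) gA nj.
  apply: (@spansS _ _ (A :&: A2)).
    by rewrite subsetD1 subsetIl inE (negPf jA2) andbF.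
  rewrite /spans eqn_leq [X in _ && X]rankS ?subsetUr // andbT.
  have := rank_submod M (i |: A) A2.
  rewrite setIUl (setIidPl _) ?sub1set // -setUA (setUidPr _) ?sub1set ?inE ?iA2 ?orbT //.
  move/eqP: spA => ->; rewrite -eA -eA2.
  have := base_leq_rank (A :|: A2) b; have := base_leq_rank (A :&: A2) b.
  by have := cardsUI (B :&: A) (B :&: A2); rewrite -setIUr -setIIr; clear; lia.
- rewrite /r' /good (negPf jA2); apply: leq_trans leA2.
  apply: subset_leq_card; apply/subsetP => x; rewrite !inE => /andP[+ xA2].
  by rewrite xA2 andbT; case: eqP xA2 => [->|_ _ /= /andP[]//]; rewrite (negPf iA2).
Qed.

(** A violated [A] contains [j], not [i], and is tight for [B], and it is nested with [A0]. If it
    contains [A0], it spans [i], and [B] is too large on [i |: A]. If it lies in [A0], then [A :\ j]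
    spans [j], against the choice of [A0]. *)
Lemma bridge_restored B : B \in Bs -> i \in B -> j \notin B -> j |: (B :\ i) \in bases M.
Proof.
move=> /BsP[b hB] iB jB; apply: (cyclically_determinedP detM b).
- by rewrite swap_card // (base_card b).
- exact: swap_trivial.
move=> A sA cA; have leA := base_leq_rank A b; rewrite leqNgt; apply/negP => v.
have jA : j \in A.
  apply: contraLR v => jA; rewrite -leqNgt; apply: leq_trans leA; apply: subset_leq_card.
  apply/subsetP => x; rewrite !inE => /andP[+ xA]; rewrite xA andbT.
  by case: eqP xA => [->|_ _ /= /andP[]//]; rewrite (negPf jA).
have iA : i \notin A.
  apply/negP => iA; suff h : #|(j |: (B :\ i)) :&: A| <= #|B :&: A|.
    by move: v leA h; clear; lia.
  rewrite setIUl setIDAC (cardsD1 i (B :&: A)) inE iB iA.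
  rewrite (leq_trans (leq_card_setU _ _)) // leq_add2r.
  by rewrite (leq_trans (subset_leq_card (subsetIl _ _))) ?cards1.
have eA : #|B :&: A| = r A.
  apply/anti_leq; rewrite leA -ltnS (leq_trans v) //.
  rewrite setIUl (leq_trans (leq_card_setU _ _)) // -add1n leq_add //.
    by rewrite (leq_trans (subset_leq_card (subsetIl _ _))) ?cards1.
  by rewrite subset_leq_card // setSI // subsetDl.
have /orP[sAA|sAA] := cyc_convex_nested pos_inj cA0 cA sA0 sA iN jN ltij adj iA0 iA jA0 jA.
  have := base_leq_rank (i |: A) b; move/eqP: (spansS sAA spA0) => ->; rewrite -eA.
  rewrite setIUr (setIidPr _) ?sub1set // cardsU1 inE (negPf iA) andbF; clear; lia.
case/negP: nspA0; apply: (spansS (setSD _ sAA)).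
rewrite /spans setD1K // eqn_leq [X in _ && X]rankS ?subsetDl // andbT -eA.
suff -> : B :&: A = B :&: (A :\ j) by apply: base_leq_rank.
by rewrite setIDA; apply/esym/setDidPl; rewrite disjoint_sym disjoints1 inE (negPf jB).
Qed.

Lemma bridge_exists : exists M' : matroid T,
  [/\ ground M' = ground M, cyclically_determined pos M', bases M' \proper bases M,
      forall B, B \in bases M' -> i \in B -> j \notin B -> j |: (B :\ i) \in bases M
    & forall B, B \in bases M -> B \notin bases M' ->
        [/\ j \in B, i \notin B & i |: (B :\ j) \in bases M']].
Proof.
have sBs : Bs \subset bases M by apply/subsetP => B /BsP[].
(* A base attaining the old rank of [A0] violates the lowered bound: it makes the inclusion of bases
   strict, and its swap shows that some base survives. *)
have [B0 b0 cB0] := rank_base M A0.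
have nB0 : B0 \notin Bs.
  apply/negP => /BsP[_ /(_ A0 sA0 cA0)]; rewrite cB0 /r' goodA0.
  rewrite leqNgt ltn_neqAle rankS ?subsetDl // andbT.
  by move: nspA0; rewrite /spans setD1K // eq_sym => ->.
have [_ _ b1] := bridge_removed b0 nB0.
have [||||M' [gM' bM']] := @matroid_of_bases T (ground M) Bs.
- by move=> B /(subsetP sBs)/base_ground.
- by move=> B B' /(subsetP sBs)/base_card-> /(subsetP sBs)/base_card->.
- exact: Bs_exchange.
- by apply/set0Pn; exists (i |: (B0 :\ j)).
have rM' : rank M' = rank M.
  have /base_card <- : i |: (B0 :\ j) \in bases M' by rewrite bM'.
  exact: base_card (subsetP sBs _ b1).
have sN : nontrivial M' \subset N.
  apply/subsetP => x /nontrivialP[[B] + xB [B']]; rewrite bM' => bB bB' xB'.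
  by apply: (base_symdiff_nontrivial (subsetP sBs _ bB) (subsetP sBs _ bB')).
have leM' A : rank_of M' A <= rank_of M A.
  have [B] := rank_base M' A; rewrite bM' => /(subsetP sBs) b <-.
  exact: base_leq_rank.
exists M'; split=> //; last first.
- by move=> B b; rewrite bM'; apply: bridge_removed.
- by move=> B; rewrite bM'; apply: bridge_restored.
- rewrite bM'; apply/properP; split=> //; by exists B0.
(* [M'] has fewer nontrivial elements, so a set convex over [N] is also convex over those of [M'],
   and the assumed bounds yield both the old and the lowered ones. *)
move=> B sB cB h; rewrite bM'; rewrite gM' rM' in sB cB; apply/BsP; split.
  apply: detM => // A sA cA; apply: leq_trans (leM' A); apply: h; rewrite ?gM' //.
  exact: cyc_convexS cA.
move=> A sA cA; have sAM : A \subset ground M by apply: subset_trans sA (nontrivial_ground M).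
apply: (@leq_trans (rank_of M' A)).
  by apply: h; rewrite ?gM' //; apply: cyc_convexS cA.
have [B' + <-] := rank_base M' A; rewrite bM' => /BsP[_]; exact.
Qed.

End Bridge.

(** * Determinants of lists of rows *)

Section ListDeterminant.
Import GRing.Theory Num.Theory.
Local Open Scope ring_scope.
Variables (R : realFieldType) (n : nat).
Implicit Types (w : seq 'rV[R]_n) (x y z : 'rV[R]_n).

(** Keeping the rows in a list turns inserting and moving a row into list operations. A list that is
    too short is padded by zero rows. *)
Definition row_det w := \det (\matrix_(i < n) nth 0 w i).

Lemma nth_cat_cons (V : Type) (v0 x y : V) (w1 w2 : seq V) k : k != size w1 ->
  nth v0 (w1 ++ x :: w2) k = nth v0 (w1 ++ y :: w2) k.
Proof.
rewrite !nth_cat; case: ltngtP => // lt1 _.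
have -> : (k - size w1 = (k - (size w1).+1).+1)%N by move: lt1; clear; lia.
by [].
Qed.

Lemma row_det_linear w1 w2 (a b : R) x y : (size w1 < n)%N ->
  row_det (w1 ++ (a *: x + b *: y) :: w2) =
    a * row_det (w1 ++ x :: w2) + b * row_det (w1 ++ y :: w2).
Proof.
move=> lt1; apply: (determinant_multilinear (i0 := Ordinal lt1)).
- by rewrite !rowK /= !nth_cat ltnn subnn.
- apply/matrixP => k l; rewrite !mxE; congr (fun_of_matrix _ _ _).
  by apply: nth_cat_cons; rewrite eq_sym neq_bump.
- apply/matrixP => k l; rewrite !mxE; congr (fun_of_matrix _ _ _).
  by apply: nth_cat_cons; rewrite eq_sym neq_bump.
Qed.

Lemma row_detD w1 w2 x y : (size w1 < n)%N ->
  row_det (w1 ++ (x + y) :: w2) = row_det (w1 ++ x :: w2) + row_det (w1 ++ y :: w2).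
Proof. by move=> lt1; have := row_det_linear w2 1 1 x y lt1; rewrite !scale1r !mul1r. Qed.

Lemma row_detZ w1 w2 a x : (size w1 < n)%N ->
  row_det (w1 ++ (a *: x) :: w2) = a * row_det (w1 ++ x :: w2).
Proof.
by move=> lt1; have := row_det_linear w2 a 0 x x lt1; rewrite scale0r addr0 mul0r addr0.
Qed.

Lemma row_det_eq0 w k1 k2 : (k1 < k2 < n)%N -> nth 0 w k1 = nth 0 w k2 -> row_det w = 0.
Proof.
case/andP=> lt12 lt2 e.
apply: (@determinant_alternate _ _ _ (Ordinal (ltn_trans lt12 lt2)) (Ordinal lt2)).
  by rewrite -val_eqE /= ltn_eqF.
by move=> l; rewrite !mxE /= e.
Qed.

Lemma row_det_dup w1 w2 w3 x : (size w1 + size w2 + 1 < n)%N ->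
  row_det (w1 ++ x :: w2 ++ x :: w3) = 0.
Proof.
move=> lt12; apply: (@row_det_eq0 _ (size w1) (size w1 + size w2 + 1)).
  by rewrite lt12 andbT; lia.
rewrite !nth_cat ltnn subnn /=.
have -> : (size w1 + size w2 + 1 < size w1)%N = false by lia.
have -> : (size w1 + size w2 + 1 - size w1 = (size w2).+1)%N by lia.
by rewrite /= nth_cat ltnn subnn.
Qed.

Lemma row_det_swap w1 w2 x y : (size w1 + 1 < n)%N ->
  row_det (w1 ++ x :: y :: w2) = - row_det (w1 ++ y :: x :: w2).
Proof.
move=> lt1; apply/eqP; rewrite -addr_eq0; apply/eqP.
have lt1' : (size w1 < n)%N by lia.
have ltr z : (size (rcons w1 z) < n)%N by rewrite size_rcons; lia.
have := @row_det_dup w1 [::] w2 (x + y); rewrite addn0 /= => /(_ lt1).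
rewrite row_detD // -(cat_rcons x) -(cat_rcons y) !row_detD // !cat_rcons.
have d z : row_det (w1 ++ z :: z :: w2) = 0.
  by apply: (@row_det_dup w1 [::] w2 z); rewrite addn0.
by rewrite !d add0r addr0.
Qed.

Lemma row_det_move w1 w2 w3 x : (size w1 + size w2 < n)%N ->
  row_det (w1 ++ x :: w2 ++ w3) = (-1) ^+ size w2 * row_det (w1 ++ w2 ++ x :: w3).
Proof.
elim: w2 w1 => [|y w2 IHw] w1 /= lt12; first by rewrite mul1r.
rewrite row_det_swap; last by lia.
rewrite -cat_rcons IHw ?size_rcons; last by lia.
by rewrite cat_rcons exprS mulN1r mulNr.
Qed.

Lemma row_det_sum w1 w2 (I : Type) (s : seq I) (F : I -> 'rV[R]_n) : (size w1 < n)%N ->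
  row_det (w1 ++ (\sum_(k <- s) F k) :: w2) = \sum_(k <- s) row_det (w1 ++ F k :: w2).
Proof.
move=> lt1; elim: s => [|k s IHs]; last by rewrite !big_cons row_detD // IHs.
by rewrite !big_nil -(scale0r 0) row_detZ // mul0r.
Qed.

End ListDeterminant.

Section SortedList.
Variables (T : finType) (L : seq T).
Hypotheses (L_uniq : uniq L) (L_full : forall x, x \in L).
Implicit Types (x y : T) (A B X Y : {set T}).

Definition listed B := [seq x <- L | x \in B].
Local Notation pos := (index^~ L).

Lemma index_listing_inj : injective pos.
Proof.
by move=> x y e; rewrite -[x](nth_index x (L_full x)) e nth_index.
Qed.

Lemma size_listed B : size (listed B) = #|B|.
Proof.
have /card_uniqP <- : uniq (listed B) by apply: filter_uniq.
by apply: eq_card => x; rewrite mem_filter L_full andbT.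
Qed.

Lemma index_split x y : pos x < pos y -> exists l1 l2 l3, L = l1 ++ x :: l2 ++ y :: l3.
Proof.
move=> lt; have ltx : pos x < size L by rewrite index_mem.
have lty : pos y < size L by rewrite index_mem.
exists (take (pos x) L), (take (pos y - (pos x).+1) (drop (pos x).+1 L)), (drop (pos y).+1 L).
rewrite -[LHS](cat_take_drop (pos x)) (drop_nth x ltx) nth_index //; congr (_ ++ _ :: _).
rewrite -[LHS](cat_take_drop (pos y - (pos x).+1)) drop_drop; congr (_ ++ _).
by rewrite subnK // (drop_nth y lty) nth_index.
Qed.

Lemma index_between l1 l2 l3 x y z : L = l1 ++ x :: l2 ++ y :: l3 -> z \in l2 ->
  pos x < pos z < pos y.
Proof.
move=> e z2; have u := L_uniq; rewrite e in u.
have e' : L = (l1 ++ x :: l2) ++ y :: l3 by rewrite e -catA.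
have ix : pos x = size l1.
  rewrite e index_cat /= eqxx addn0.
  by move: u; rewrite cat_uniq /= => /and3P[_ /norP[/negPf->]].
have iy : pos y = size l1 + (size l2).+1.
  rewrite e' index_cat /= eqxx addn0 size_cat /=.
  by move: u; rewrite -cat_cons catA cat_uniq /= => /and3P[_ /norP[/negPf->]].
have iz : pos z = size l1 + (index z l2).+1.
  rewrite e index_cat; case: ifP => z1.
    by move: u; rewrite cat_uniq /= => /and3P[_ /norP[_ /hasPn/(_ z)]]; rewrite mem_cat z2 z1 => /(_ isT).
  rewrite /= index_cat z2; case: eqP => // xz.
  by move: u; rewrite cat_uniq /= => /and4P[_ _ + _]; rewrite mem_cat xz z2.
rewrite ix iy iz -addn1 leq_add2l /= ltn_add2l ltnS index_mem //.
Qed.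

End SortedList.

(** * Nonnegative realizations built bridge by bridge *)

Section Realization.
Import Order.TTheory GRing.Theory Num.Theory.
Local Open Scope ring_scope.
Variables (R : realFieldType) (T : finType) (L : seq T).
Hypotheses (L_uniq : uniq L) (L_full : forall x, x \in L).
Implicit Types (M : matroid T) (x y : T) (B : {set T}).
Local Notation pos := (fun x => index x L).

Definition maximal_minor n (v : T -> 'rV[R]_n) B := row_det (map v (listed L B)).

(** The width [n] is a parameter instead of [rank M], so that vectors can be handed from one matroid
    to another. *)
Definition totally_nonneg_realization M n (v : T -> 'rV[R]_n) :=
  forall B, #|B| = n -> 0 <= maximal_minor v B /\ (maximal_minor v B != 0) = (B \in bases M).

(** [i] is the last nontrivial element spanned by the nontrivial elements after it. One exists: the
    first nontrivial element is not a coloop, so the others span it. Since [i] is not a loop it has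
    a successor [j], which by maximality of [i] is not spanned by its own successors. *)
Lemma bridge_pair M : nontrivial M != set0 -> exists i j,
  let A := [set y in nontrivial M | (pos i < pos y)%N] in
  [/\ i \in nontrivial M, j \in A,
      forall x, x \in nontrivial M -> ~~ (pos i < pos x < pos j)%N,
      spans M A i & ~~ spans M (A :\ j) j].
Proof.
set N := nontrivial M.
pose above x := [set y in N | (pos x < pos y)%N].
pose P := [pred x | (x \in N) && spans M (above x) x].
case/set0Pn => x1 x1N.
have [x0 x0N min0] := @arg_minnP T x1 (fun x => x \in N) (fun x => index x L) x1N.
have P0 : P x0.
  rewrite /= x0N /=; have [_ [B b x0B]] := elimT (nontrivialP _ _) x0N.
  have -> : above x0 = N :\ x0.
    apply/setP => x; rewrite in_setD1 in_set andbC; case xN: (x \in N); last by rewrite !andbF.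
    rewrite !andbT ltn_neqAle (min0 x xN) andbT; congr (~~ _).
    by apply/eqP/eqP => [/(index_listing_inj L_full)->|->].
  rewrite /spans setD1K // eqn_leq [X in _ && X]rankS ?subsetDl // andbT.
  have e := rank_nontrivial (ground M) b.
  rewrite (setIidPr (nontrivial_ground M)) -/(rank M) -(base_card b) in e.
  have := cardsID N B; have := base_leq_rank (N :\ x0) b.
  have -> : B :&: (N :\ x0) = B :&: N.
    by rewrite setIDA; apply/setDidPl; rewrite disjoint_sym disjoints1 inE (negPf x0B).
  rewrite (setIidPr _) in e; last by rewrite (subset_trans (subsetDl _ _)) ?base_ground.
  by move: e; rewrite -/N; clear; lia.
have [i /andP[iN spi] maxi] := arg_maxnP (fun x => index x L) P0.
have [j0 j0A] : exists j, j \in above i.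
  apply/set0Pn; apply: contraL spi => /eqP->.
  have [[B b iB] _] := elimT (nontrivialP _ _) iN.
  rewrite /spans setU0 rank0 rank_indep ?cards1 //.
  by apply: indepS (base_indep b); rewrite sub1set.
have [j jA minj] := @arg_minnP T j0 (fun x => x \in above i) (fun x => index x L) j0A.
have /andP[jN ltij] : (j \in N) && (pos i < pos j)%N by move: jA; rewrite in_set.
exists i, j; rewrite -/(above i); split=> //.
  move=> x xN; apply/negP => /andP[lt1 lt2].
  by have := minj x; rewrite in_set xN lt1 leqNgt lt2 => /(_ isT).
have -> : above i :\ j = above j.
  apply/setP => x; rewrite in_setD1 !in_set; case xN: (x \in N); rewrite ?andbF //=.
  apply/andP/idP => [[xj ltx]|ltx]; last first.
    by split; [apply: contraTneq ltx => ->; rewrite ltnn | apply: ltn_trans ltx].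
  rewrite ltn_neqAle minj ?in_set ?xN // andbT; apply: contra xj => /eqP.
  by move/(index_listing_inj L_full)->.
apply/negP => spj; have := maxi j; rewrite /= jN spj => /(_ isT).
by rewrite leqNgt ltij.
Qed.

Lemma cyc_convex_above N i : cyc_convex pos N [set y in N | (pos i < pos y)%N].
Proof.
move=> p q s t pN qN sN tN c; rewrite !in_set pN qN sN tN /=.
by move: c; rewrite /cyc4; case/or4P => /and3P[? ? ?] ? ?; apply/orP;
  first [left; lia | right; lia].
Qed.

Lemma realization_of_bridge M M' n (v : T -> 'rV[R]_n) i j :
  i \in nontrivial M -> j \in nontrivial M -> (pos i < pos j)%N ->
  (forall x, x \in nontrivial M -> ~~ (pos i < pos x < pos j)%N) ->
  bases M' \subset bases M ->
  (forall B, B \in bases M' -> i \in B -> j \notin B -> j |: (B :\ i) \in bases M) ->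
  (forall B, B \in bases M -> B \notin bases M' ->
    [/\ j \in B, i \notin B & i |: (B :\ j) \in bases M']) ->
  totally_nonneg_realization M' v ->
  exists v' : T -> 'rV[R]_n, totally_nonneg_realization M v'.
Proof.
move=> iN jN ltij adj sub restored removed vM'.
have [l1 [l2 [l3 eL]]] := index_split L_full ltij.
have [B0 b0] := base_ex M'.
have nij : i != j by apply: contraTneq ltij => ->; rewrite ltnn.
have uL : uniq (l1 ++ i :: l2 ++ j :: l3) by rewrite -eL.
have [[j1 j2 j3] [i1 i2 i3]] :
    [/\ j \notin l1, j \notin l2 & j \notin l3] /\ [/\ i \notin l1, i \notin l2 & i \notin l3].
  have : i \notin l1 ++ l2 ++ j :: l3.
    by move: uL; rewrite -[i :: _]cat1s uniq_catCA /= => /andP[].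
  have : j \notin (l1 ++ i :: l2) ++ l3.
    by move: uL; rewrite -cat_cons catA -[j :: _]cat1s uniq_catCA /= => /andP[].
  rewrite !mem_cat !in_cons !negb_or.
  by move=> /andP[/and3P[-> _ ->] ->] /and3P[-> -> /andP[_ ->]].
(* every base of [M'] meets the gap between [i] and [j] in the coloops of [M] *)
pose c := size [seq x <- l2 | x \in B0].
have gap B : B \in bases M' -> size [seq x <- l2 | x \in B] = c.
  move=> b; congr size; apply: eq_in_filter => x x2.
  have xN : x \notin nontrivial M.
    by apply: contraTN (index_between L_uniq eL x2) => /adj.
  have := base_trivial (subsetP sub _ b) (subsetP sub _ b0).
  by move/setP/(_ x); rewrite !in_setD xN.
(* In the minor of a set with [j] and without [i], the row of [i] now sits at the place of [j]; the
   sign undoes moving it back over the [c] rows of the gap. *)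
exists (fun x => if x == j then v j + (-1) ^+ c *: v i else v x) => B cB.
set v' := fun x => _; have [ge0 ne0] := vM' B cB.
have ev l : j \notin l -> map v' l = map v l.
  move=> jl; apply/eq_in_map => x xl; rewrite /v'; case: eqP => // e.
  by rewrite e (negPf jl) in xl.
have evF l A : j \notin l -> map v' [seq x <- l | x \in A] = map v [seq x <- l | x \in A].
  by move=> jl; apply: ev; rewrite mem_filter negb_and jl orbT.
have baseE : B \in bases M = (B \in bases M') ||
    [&& j \in B, i \notin B & i |: (B :\ j) \in bases M'].
  apply/idP/orP => [b|[/(subsetP sub)//|/and3P[jB iB b]]].
    have [b'|/(removed _ b)[-> -> ->]] := boolP (B \in bases M'); first by left.
    by right.
  have := restored _ b; rewrite setU11 !inE eq_sym (negPf nij) eqxx /=.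
  move=> /(_ isT isT); rewrite setU1K ?setD1K //.
  by rewrite !inE negb_and iB orbT.
have [jB|jB] := boolP (j \in B); last first.
  rewrite baseE (negPf jB) orbF /maximal_minor ev //.
  by rewrite mem_filter (negPf jB).
have eB : listed L B = [seq x <- l1 | x \in B] ++
    (if i \in B then [:: i] else [::]) ++ [seq x <- l2 | x \in B] ++ j :: [seq x <- l3 | x \in B].
  rewrite /listed eL filter_cat /= filter_cat /= jB; by case: ifP.
have sizeB : size (listed L B) = n by rewrite size_listed.
have vj : v' j = v j + (-1) ^+ c *: v i by rewrite /v' eqxx.
have vi : v' i = v i by rewrite /v' (negPf nij).
set f1 := map v [seq x <- l1 | x \in B]; set f2 := map v [seq x <- l2 | x \in B].
set f3 := map v [seq x <- l3 | x \in B].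
have sz : (size f1 + (i \in B) + size f2 + size f3).+1 = n.
  move: sizeB; rewrite eB /f1 /f2 /f3 !size_map size_cat.
  by case: (i \in B); rewrite /= size_cat /=; clear; lia.
have [iB|iB] := boolP (i \in B).
  rewrite baseE iB andbF orbF -ne0.
  suff -> : maximal_minor v' B = maximal_minor v B by [].
  rewrite /maximal_minor eB iB !map_cat /= !evF // vi vj -/f1 -/f2 -/f3.
  rewrite iB in sz.
  rewrite -cat_cons catA row_detD; last by rewrite size_cat /=; move: sz; clear; lia.
  rewrite row_detZ; last by rewrite size_cat /=; move: sz; clear; lia.
  rewrite -!catA /= row_det_dup ?mulr0 ?addr0 //; by move: sz; clear; lia.
rewrite (negPf iB) addn0 in sz.
pose B' := i |: (B :\ j); have cB' : #|B'| = n by rewrite swap_card.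
have [ge0' ne0'] := vM' B' cB'.
have eB' : maximal_minor v B' = (-1) ^+ size f2 * row_det (f1 ++ f2 ++ v i :: f3).
  rewrite -row_det_move; last by move: sz; clear; lia.
  have f l : j \notin l -> i \notin l -> [seq x <- l | x \in B'] = [seq x <- l | x \in B].
    move=> jl il; apply: eq_in_filter => x xl; rewrite !inE.
    have -> : x == i = false by apply: contraNF il => /eqP<-.
    by have -> : x == j = false by apply: contraNF jl => /eqP<-.
  rewrite /maximal_minor /listed eL filter_cat /= filter_cat /= !inE !eqxx /= eq_sym (negPf nij).
  by rewrite !f // !map_cat /= map_cat.
have eM : maximal_minor v' B = maximal_minor v B + (-1) ^+ c * ((-1) ^+ size f2 * maximal_minor v B').
  rewrite eB' [_ ^+ size f2 * (_ * _)]mulrA -expr2 sqrr_sign mul1r.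
  rewrite /maximal_minor eB (negPf iB) !map_cat /= !evF // vj -/f1 -/f2 -/f3.
  rewrite !catA row_detD; last by rewrite size_cat; move: sz; clear; lia.
  rewrite row_detZ //; by rewrite size_cat; move: sz; clear; lia.
(* The gap is known to have [c] rows only for bases of [M']; for other [B'] the minor vanishes and
   the sign is irrelevant. *)
have eS : (-1) ^+ c * ((-1) ^+ size f2 * maximal_minor v B') = maximal_minor v B'.
  have [b'|b'] := boolP (B' \in bases M'); last first.
    by move: ne0'; rewrite (negPf b') => /negbFE/eqP->; rewrite !mulr0.
  have -> : size f2 = c.
    rewrite size_map -(gap _ b'); congr size; apply: eq_in_filter => x x2; rewrite !inE.
    have -> : x == i = false by apply: contraNF i2 => /eqP<-.
    by have -> : x == j = false by apply: contraNF j2 => /eqP<-.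
  by rewrite mulrA -expr2 sqrr_sign mul1r.
rewrite eM eS; split; first exact: addr_ge0.
rewrite paddr_eq0 // negb_and ne0 ne0' baseE jB iB //.
Qed.

Theorem cyclically_determined_realization M : cyclically_determined pos M ->
  exists v : T -> 'rV[R]_(rank M), totally_nonneg_realization M v.
Proof.
have [n] := ubnP #|bases M|; elim: n M => // n IHn M ltn detM.
have [N0|/bridge_pair[i [j]]] := eqVneq (nontrivial M) set0; last first.
  set A := [set y in _ | _] => -[iN jA adj spA nspA].
  have /andP[jN ltij] : (j \in nontrivial M) && (pos i < pos j)%N by move: jA; rewrite in_set.
  have iA : i \notin A by rewrite in_set ltnn andbF.
  have sA : A \subset nontrivial M by apply/subsetP => x; rewrite in_set => /andP[].
  have [M' [gM' detM' prop restored removed]] := bridge_exists (index_listing_inj L_full)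
    detM iN jN ltij adj sA (@cyc_convex_above _ _) jA iA spA nspA.
  have [|v vM'] := IHn M' _ detM'.
    by rewrite -ltnS; apply: leq_trans ltn; rewrite ltnS; apply: proper_card.
  have eM : rank M' = rank M.
    have [B b] := base_ex M'; rewrite -(base_card b).
    by apply: base_card; apply: (subsetP (proper_sub prop)).
  rewrite -eM; exact: realization_of_bridge iN jN ltij adj (proper_sub prop) restored removed vM'.
have [B0 b0] := base_ex M; have c0 := base_card b0.
have bE B : (B \in bases M) = (B == B0).
  apply/idP/eqP => [b|->//]; have := base_trivial b b0.
  by rewrite N0 !setD0.
(* Unit vectors on the only base [B0]. An element outside it has index [rank M], which no column
   matches, so its vector is zero. *)
pose v x : 'rV[R]_(rank M) := \row_l (index x (listed L B0) == l)%:R.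
exists v => B cB; rewrite bE.
have [->|neq] := eqVneq B B0.
  suff -> : maximal_minor v B0 = 1 by rewrite ler01 oner_eq0.
  rewrite /maximal_minor /row_det -[RHS](det1 _ (rank M)); congr (\det _).
  apply/matrixP => k l; rewrite !mxE; have lt_k : (k < size (listed L B0))%N.
    by rewrite size_listed // c0.
  case e: (listed L B0) lt_k => [//|x0 s0]; rewrite -e => lt_k.
  by rewrite (nth_map x0) // mxE index_uniq // filter_uniq.
suff -> : maximal_minor v B = 0 by rewrite lexx eqxx.
have /subsetPn[x xB xB0] : ~~ (B \subset B0).
  by apply: contra neq => sB; rewrite eqEcard sB cB c0 leqnn.
rewrite /maximal_minor; have xl : x \in listed L B by rewrite mem_filter xB L_full.
have := size_listed L_uniq L_full B; case/splitPr: xl => s1 s2 sz.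
rewrite map_cat /= -[v x](_ : 0 *: 0 = _).
  by rewrite row_detZ ?mul0r // size_map -cB -sz size_cat /=; clear; lia.
rewrite scale0r; apply/rowP => l; rewrite !mxE.
have -> : index x (listed L B0) = rank M.
  by rewrite -c0 -(size_listed L_uniq L_full); apply/memNindex; rewrite mem_filter negb_and xB0.
by rewrite gtn_eqF.
Qed.

End Realization.

(** * Three-term Plucker relations *)

Section Plucker.
Import Order.TTheory GRing.Theory Num.Theory.
Local Open Scope ring_scope.
Variables (R : realFieldType) (n : nat).
Implicit Types (w : seq 'rV[R]_n) (x y a b c d : 'rV[R]_n).

(** Expand [c] in the basis formed by [w], [a] and [b]; the terms from [w] repeat a row and vanish.
    The coefficients do not depend on [y]. *)
Lemma row_det_expand w a b c : (size w + 2 = n)%N -> row_det (w ++ [:: a; b]) != 0 ->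
  exists p q, forall y, row_det (w ++ [:: c; y]) =
    p * row_det (w ++ [:: a; y]) + q * row_det (w ++ [:: b; y]).
Proof.
move=> sz nz; set W := \matrix_(i < n) nth 0 (w ++ [:: a; b]) i.
have uW : W \in unitmx by rewrite unitmxE unitfE.
have ec : c = \sum_(k < n) (c *m invmx W) 0 k *: nth 0 (w ++ [:: a; b]) k.
  rewrite -{1}(mulmxKV uW c) [LHS]mulmx_sum_row; apply: eq_bigr => k _.
  by rewrite rowK.
have [lt0 lt1] : (size w < n)%N /\ (size w + 1 < n)%N by split; lia.
pose q k := (c *m invmx W) 0 k.
exists (q (Ordinal lt0)), (q (Ordinal lt1)) => y.
rewrite {1}ec row_det_sum // (bigD1 (Ordinal lt0)) // (bigD1 (Ordinal lt1)) /=; last first.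
  by rewrite -val_eqE /=; lia.
rewrite big1 => [|k /andP[k0 k1]]; last first.
  have ltk : (k < size w)%N.
    by move: k0 k1; rewrite -!val_eqE /=; have := ltn_ord k; lia.
  rewrite row_detZ // (@row_det_eq0 _ _ _ k (size w)) ?mulr0 ?ltk //.
  by rewrite !nth_cat ltk ltnn subnn.
rewrite addr0 !row_detZ // !nth_cat ltnn subnn /=.
have -> : (size w + 1 < size w)%N = false by lia.
by have -> : (size w + 1 - size w = 1)%N by lia.
Qed.

Lemma plucker3 w a b c d : (size w + 2 = n)%N -> row_det (w ++ [:: a; b]) != 0 ->
  row_det (w ++ [:: a; c]) * row_det (w ++ [:: b; d]) =
    row_det (w ++ [:: a; b]) * row_det (w ++ [:: c; d]) +
    row_det (w ++ [:: a; d]) * row_det (w ++ [:: b; c]).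
Proof.
move=> sz nz; have [p [q e]] := row_det_expand c sz nz.
have swap x y : row_det (w ++ [:: x; y]) = - row_det (w ++ [:: y; x]).
  by apply: row_det_swap; lia.
have dup x : row_det (w ++ [:: x; x]) = 0.
  by apply: (@row_det_dup _ _ w [::] [::] x); rewrite /= addn0; lia.
by rewrite (swap a c) (swap b c) !e !dup (swap b a); ring.
Qed.

End Plucker.

(** * Nonnegative minors sort locally *)

Section LocalSorting.
Import Order.TTheory GRing.Theory Num.Theory.
Local Open Scope ring_scope.
Variables (R : realFieldType) (T : finType) (L : seq T).
Hypotheses (L_uniq : uniq L) (L_full : forall x, x \in L).
Implicit Types (M : matroid T) (x y : T) (B S : {set T}).
Local Notation pos := (fun x => index x L).

Definition locally_sorting M := forall S (a b c d : T),
  [/\ a \notin S, b \notin S, c \notin S & d \notin S] ->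
  (pos a < pos b)%N -> (pos b < pos c)%N -> (pos c < pos d)%N ->
  a |: (b |: S) \in bases M -> c |: (d |: S) \in bases M ->
  a |: (c |: S) \in bases M /\ b |: (d |: S) \in bases M.

(** Moving [v x] and [v y] to the end costs a sign that splits into one factor for each. The three
    products in the Plucker relation therefore carry the same total sign, and the relation passes to
    the minors unchanged. *)
Lemma minor_pair n (v : T -> 'rV[R]_n) S x y : x \notin S -> y \notin S ->
  (#|S| + 2 = n)%N -> (pos x < pos y)%N ->
  let sgn z := (-1) ^+ size [seq s <- drop (index z L).+1 L | s \in S] in
  maximal_minor L v (x |: (y |: S)) =
    sgn x * sgn y * row_det (map v (listed L S) ++ [:: v x; v y]).
Proof.
move=> xS yS cS ltxy sgn; have [l1 [l2 [l3 eL]]] := index_split L_full ltxy.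
have uL : uniq (l1 ++ x :: l2 ++ y :: l3) by rewrite -eL.
have hx : x \notin l1 ++ l2 ++ y :: l3.
  by move: uL; rewrite -[x :: _]cat1s uniq_catCA /= => /andP[].
have hy : y \notin (l1 ++ x :: l2) ++ l3.
  by move: uL; rewrite -cat_cons catA -[y :: _]cat1s uniq_catCA /= => /andP[].
move: hx hy; rewrite !mem_cat !in_cons !negb_or.
move=> /and3P[x1 x2 /andP[xy x3]] /andP[/and3P[y1 _ y2] y3].
have dropx : drop (index x L).+1 L = l2 ++ y :: l3.
  by rewrite eL index_cat (negPf x1) /= eqxx addn0 -add1n -drop_drop drop_size_cat // drop1.
have dropy : drop (index y L).+1 L = l3.
  rewrite eL -cat_cons catA index_cat mem_cat in_cons (negPf y1) eq_sym (negPf xy) (negPf y2) /=.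
  by rewrite eqxx addn0 -add1n -drop_drop drop_size_cat // drop1.
set f1 := map v [seq s <- l1 | s \in S]; set f2 := map v [seq s <- l2 | s \in S].
set f3 := map v [seq s <- l3 | s \in S].
have eS : map v (listed L S) = f1 ++ f2 ++ f3.
  by rewrite /listed eL !(filter_cat, map_cat) /= (negPf xS) filter_cat /= (negPf yS) map_cat.
have f l : x \notin l -> y \notin l -> [seq s <- l | s \in x |: (y |: S)] = [seq s <- l | s \in S].
  move=> xl yl; apply: eq_in_filter => s sl; rewrite !inE.
  have -> : s == x = false by apply: contraNF xl => /eqP<-.
  by have -> : s == y = false by apply: contraNF yl => /eqP<-.
have eB : map v (listed L (x |: (y |: S))) = f1 ++ v x :: f2 ++ v y :: f3.
  rewrite /listed eL filter_cat /= filter_cat /= !inE !eqxx orbT /=.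
  by rewrite !f // !map_cat /= map_cat.
have sz : (size f1 + size f2 + size f3 + 2 = n)%N.
  apply: etrans cS; congr (_ + _)%N.
  by rewrite -(size_listed L_uniq L_full) -(size_map v) eS !size_cat addnA.
rewrite /maximal_minor eB eS /sgn dropx dropy filter_cat /= (negPf yS) size_cat.
have e1 : row_det (f1 ++ v x :: f2 ++ v y :: f3) =
    (-1) ^+ size f3 * row_det (f1 ++ v x :: f2 ++ f3 ++ [:: v y]).
  have := @row_det_move _ _ (f1 ++ v x :: f2) f3 [::] (v y).
  by rewrite cats0 -!catA /= => -> //; rewrite size_cat /=; move: sz; clear; lia.
have e2 : row_det (f1 ++ v x :: f2 ++ f3 ++ [:: v y]) =
    (-1) ^+ (size f2 + size f3) * row_det (f1 ++ f2 ++ f3 ++ [:: v x; v y]).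
  have := @row_det_move _ _ f1 (f2 ++ f3) [:: v y] (v x).
  by rewrite -!catA size_cat => -> //; move: sz; clear; lia.
by rewrite e1 e2 !size_map -!catA mulrCA mulrA.
Qed.

Lemma realization_locally_sorting M (v : T -> 'rV[R]_(rank M)) :
  (forall B, B \subset ground M -> #|B| = rank M ->
     0 <= maximal_minor L v B /\ (maximal_minor L v B != 0) = (B \in bases M)) ->
  locally_sorting M.
Proof.
move=> vM S a b c d [aS bS cS dS] ltab ltbc ltcd bab bcd.
have ltac := ltn_trans ltab ltbc; have ltbd := ltn_trans ltbc ltcd.
have ltad := ltn_trans ltab ltbd.
have neq x y : (pos x < pos y)%N -> x != y.
  by apply: contraTneq => ->; rewrite ltnn.
have card2 x y : x \notin S -> y \notin S -> x != y -> #|x |: (y |: S)| = (#|S| + 2)%N.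
  by move=> xS yS xy; rewrite !cardsU1 !inE (negPf xS) (negPf yS) (negPf xy) addn2.
have cS2 : (#|S| + 2 = rank M)%N.
  by rewrite -(base_card bab) card2 // neq.
have sw : (size (map v (listed L S)) + 2 = rank M)%N by rewrite size_map size_listed.
have sE x : x \in [:: a; b; c; d] -> x \in ground M.
  rewrite !inE => /or4P[] /eqP->; [apply: (subsetP (base_ground bab))|
    apply: (subsetP (base_ground bab))|apply: (subsetP (base_ground bcd))|
    apply: (subsetP (base_ground bcd))]; by rewrite !inE eqxx ?orbT.
have sSE : S \subset ground M.
  by apply: subset_trans (base_ground bab); rewrite setUA subsetUr.
have h x y : x \in [:: a; b; c; d] -> y \in [:: a; b; c; d] -> x \notin S -> y \notin S ->
    (pos x < pos y)%N -> 0 <= maximal_minor L v (x |: (y |: S)) /\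
    (maximal_minor L v (x |: (y |: S)) != 0) = (x |: (y |: S) \in bases M).
  move=> xs ys xS yS /neq xy; apply: vM; last by rewrite card2.
  by rewrite !subUset !sub1set !sE.
have [ia ib ic id] : [/\ a \in [:: a; b; c; d], b \in [:: a; b; c; d],
    c \in [:: a; b; c; d] & d \in [:: a; b; c; d]] by rewrite !inE !eqxx !orbT.
have [gab nab] := h a b ia ib aS bS ltab; rewrite bab in nab.
have [gcd ncd] := h c d ic id cS dS ltcd; rewrite bcd in ncd.
have [gac <-] := h a c ia ic aS cS ltac; have [gbd <-] := h b d ib id bS dS ltbd.
have [gad _] := h a d ia id aS dS ltad; have [gbc _] := h b c ib ic bS cS ltbc.
suff : maximal_minor L v (a |: (c |: S)) * maximal_minor L v (b |: (d |: S)) != 0.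
  by rewrite mulf_eq0 negb_or => /andP.
have -> : maximal_minor L v (a |: (c |: S)) * maximal_minor L v (b |: (d |: S)) =
    maximal_minor L v (a |: (b |: S)) * maximal_minor L v (c |: (d |: S)) +
    maximal_minor L v (a |: (d |: S)) * maximal_minor L v (b |: (c |: S)).
  pose sgn z : R := (-1) ^+ size [seq s <- drop (index z L).+1 L | s \in S].
  set w := map v (listed L S) in sw.
  have mE x y : x \notin S -> y \notin S -> (pos x < pos y)%N ->
      maximal_minor L v (x |: (y |: S)) = sgn x * sgn y * row_det (w ++ [:: v x; v y]).
    by move=> xS yS ltxy; apply: minor_pair.
  move: nab; rewrite !mE // => nab.
  have := @plucker3 _ _ w (v a) (v b) (v c) (v d) sw.
  move: nab; rewrite !mulf_eq0 !negb_or => /andP[_ nab] /(_ nab) e.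
  by rewrite mulrACA e; ring.
rewrite gt_eqF // ltr_wpDr ?mulr_ge0 // mulr_gt0 // lt0r ?nab ?ncd //.
Qed.

End LocalSorting.

(** * Matrices and vector configurations *)

Section RowSubsets.
Import GRing.Theory.
Local Open Scope ring_scope.
Variables (F : fieldType) (n r : nat) (N : 'M[F]_(n, r)).

Lemma rowsub_codom_le m1 m2 (h1 : 'I_m1 -> 'I_n) (h2 : 'I_m2 -> 'I_n) :
  {subset codom h1 <= codom h2} -> (rowsub h1 N <= rowsub h2 N)%MS.
Proof.
move=> sub; apply/row_subP => k.
have /codomP[l e] := sub _ (codom_f h1 k).
by apply: (eq_row_sub l); apply/rowP => c; rewrite !mxE e.
Qed.

Lemma row_free_rowsub_codom m1 m2 (h1 : 'I_m1 -> 'I_n) (h2 : 'I_m2 -> 'I_n) :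
  injective h1 -> injective h2 -> codom h1 =i codom h2 ->
  row_free (rowsub h1 N) = row_free (rowsub h2 N).
Proof.
move=> i1 i2 e; have em : m1 = m2.
  by rewrite -[m1]card_ord -[m2]card_ord -(card_codom i1) -(card_codom i2); apply: eq_card.
have er : \rank (rowsub h1 N) = \rank (rowsub h2 N).
  by apply/eqmx_rank/andP; split; apply: rowsub_codom_le => x; rewrite e.
by rewrite /row_free er em.
Qed.

Lemma row_free_rowsub m m' (h : 'I_m' -> 'I_m) (A : 'M[F]_(m, r)) :
  injective h -> row_free A -> row_free (rowsub h A).
Proof.
move=> ih /row_freeP[B AB]; apply/row_freeP; exists (B *m (rowsub h 1%:M)^T).
rewrite mulmxA mul_rowsub_mx AB; apply/matrixP => i j; rewrite !mxE.
under eq_bigr => k _ do rewrite !mxE.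
rewrite (bigD1 (h i)) //= eqxx mul1r big1 => [|k].
  by rewrite addr0 inj_eq // eq_sym.
by rewrite eq_sym => /negPf->; rewrite mul0r.
Qed.

Lemma row_free_extend m (h : 'I_m -> 'I_n) : row_full N -> injective h ->
  row_free (rowsub h N) ->
  exists f : 'I_r -> 'I_n, [/\ injective f, {subset codom h <= codom f}
    & row_free (rowsub f N)].
Proof.
move=> full; have [k] := ubnP (r - m)%N; elim: k m h => // k IHk m h ltk ih free.
have [e|ltmr] := eqVneq m r.
  case: r / e N full h ih free {IHk ltk} => N' _ h ih free; by exists h; split.
have le_mr : (m <= r)%N by rewrite -(eqP free) rank_leq_col.
have [j nj] : exists j, ~~ (row j N <= rowsub h N)%MS.
  apply/existsP; rewrite -negb_forall; apply: contra ltmr => /forallP all.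
  have /mxrankS : (N <= rowsub h N)%MS by apply/row_subP => j; apply: all.
  by rewrite (eqP full) (eqP free) eqn_leq le_mr => ->.
pose h' (x : 'I_m.+1) := if unlift ord0 x is Some y then h y else j.
have hj y : h y != j.
  by apply: contraNneq nj => <-; apply: (eq_row_sub y); apply/rowP => c; rewrite !mxE.
have ih' : injective h'.
  move=> x y; rewrite /h'; case: unliftP => [x' ->|->]; case: unliftP => [y' ->|->] // e.
  - by rewrite (ih _ _ e).
  - by have := hj x'; rewrite e eqxx.
  - by have := hj y'; rewrite -e eqxx.
have sub : {subset codom h <= codom h'}.
  move=> _ /codomP[y ->]; apply/codomP; exists (lift ord0 y).
  by rewrite /h' liftK.
have free' : row_free (rowsub h' N).
  rewrite /row_free eqn_leq rank_leq_row /=.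
  rewrite -{1}(eqP free); apply: rank_ltmx; rewrite ltmxE (rowsub_codom_le sub) /=.
  apply: contra nj; apply: submx_trans; apply: (eq_row_sub ord0).
  by apply/rowP => c; rewrite !mxE /h' unlift_none.
have [|f [jf sf ff]] := IHk _ h' _ ih' free'; first by move: ltk ltmr le_mr; clear; lia.
by exists f; split=> // x /sub/sf.
Qed.

End RowSubsets.

Section MatrixVectors.
Import Order.TTheory GRing.Theory Num.Theory.
Local Open Scope ring_scope.
Variables (R : realType) (T : finType) (M : matroid T) (le : rel T).
Local Notation E := (ground M).
Local Notation n := #|ground M|.
Local Notation r := (rank M).
Local Notation L0 := (sort le (enum E)).
Implicit Types (x y : T) (B X : {set T}).

(* Appending the elements outside the ground set makes [index] injective on [T]. *)
Definition full_listing := L0 ++ enum (~: E).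
Local Notation L := full_listing.

Lemma full_listing_uniq : uniq L.
Proof.
rewrite cat_uniq sort_uniq !enum_uniq andbT /=; apply/hasPn => x.
by rewrite mem_enum in_setC mem_sort mem_enum.
Qed.

Lemma mem_full_listing x : x \in L.
Proof. by rewrite mem_cat mem_sort !mem_enum in_setC orbN. Qed.

Lemma size_listing : size L0 = n.
Proof. by rewrite size_sort -cardE. Qed.

Lemma index_full_listing x : x \in E -> index x L = index x L0.
Proof. by move=> xE; rewrite index_cat mem_sort mem_enum xE. Qed.

Lemma index_listing_lt x : x \in E -> (index x L < n)%N.
Proof.
by move=> xE; rewrite index_full_listing // -size_listing index_mem mem_sort mem_enum.
Qed.

Lemma index_listing (j : 'I_n) : index (listing le j) L = j.
Proof.
rewrite /listing index_cat mem_nth ?size_listing // index_uniq ?size_listing //.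
by rewrite sort_uniq enum_uniq.
Qed.

Lemma listing_ground (j : 'I_n) : listing le j \in E.
Proof. by rewrite -mem_enum -(mem_sort le) mem_nth // size_listing. Qed.

Lemma listing_inj : injective (@listing T E le).
Proof. by move=> j k e; apply/val_inj; rewrite /= -index_listing e index_listing. Qed.

Lemma listing_index x (xE : x \in E) : listing le (Ordinal (index_listing_lt xE)) = x.
Proof. by apply: (index_listing_inj mem_full_listing); rewrite index_listing. Qed.

Lemma sorted_listed B : sorted ltn (map (index^~ L) (listed L B)).
Proof.
apply: (@subseq_sorted _ ltn ltn_trans _ (map (index^~ L) L)).
  exact/map_subseq/filter_subseq.
suff -> : map (index^~ L) L = iota 0 (size L) by apply: iota_ltn_sorted.
apply: (@eq_from_nth _ 0%N); rewrite ?size_iota size_map // => k ltk.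
case e: L ltk => [//|x0 s]; rewrite -e => ltk.
by rewrite (nth_map x0) // nth_iota // index_uniq // full_listing_uniq.
Qed.

Lemma column_listing B : B \subset E -> #|B| = r ->
  exists f : 'I_r -> 'I_n, [/\ injective f,
    forall i j : 'I_r, (i < j)%N -> (f i < f j)%N,
    map (fun i => listing le (f i)) (enum 'I_r) = listed L B &
    codom f =i [set j | listing le j \in B]].
Proof.
move=> sB cB; pose g := map (index^~ L) (listed L B).
have sg : size g = r by rewrite size_map size_listed ?full_listing_uniq // => x; exact: mem_full_listing.
have ltg (i : 'I_r) : (nth 0%N g i < n)%N.
  have : nth 0%N g i \in g by rewrite mem_nth // sg.
  case/mapP=> x; rewrite mem_filter => /andP[/(subsetP sB) xE _] ->.
  exact: index_listing_lt.
pose f i := Ordinal (ltg i).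
have fmono (i j : 'I_r) : (i < j)%N -> (f i < f j)%N.
  by move=> ltij /=; apply: (sorted_ltn_nth ltn_trans); rewrite ?inE ?sg // sorted_listed.
have em : map (fun i => listing le (f i)) (enum 'I_r) = listed L B.
  apply: (inj_map (index_listing_inj mem_full_listing)); rewrite -map_comp -/g.
  rewrite -[RHS](mkseq_nth 0%N) sg /mkseq -val_enum_ord -map_comp.
  by apply: eq_map => i; rewrite /= index_listing.
exists f; split=> //.
  move=> i j e; apply/val_inj; case: (ltngtP i j) => // /fmono.
    by rewrite e ltnn.
  by rewrite e ltnn.
move=> j; rewrite in_set; have -> : listing le j \in B = (listing le j \in listed L B).
  by rewrite mem_filter mem_full_listing andbT.
rewrite -em; apply/codomP/mapP => [[i ->]|[i _ /listing_inj->]]; last by exists i.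
by exists i; rewrite ?mem_enum.
Qed.

Lemma codom_enum_val (A : {set 'I_n}) : codom (@enum_val _ (mem A)) =i A.
Proof.
move=> j; apply/codomP/idP => [[i ->]|jA]; first exact: enum_valP.
by exists (enum_rank_in jA j); rewrite enum_rankK_in.
Qed.

Lemma increasing_codom (f g : 'I_r -> 'I_n) :
  (forall i j : 'I_r, (i < j)%N -> (f i < f j)%N) ->
  (forall i j : 'I_r, (i < j)%N -> (g i < g j)%N) ->
  codom f =i codom g -> f =1 g.
Proof.
move=> hf hg e; have srt (h : 'I_r -> 'I_n) :
    (forall i j : 'I_r, (i < j)%N -> (h i < h j)%N) ->
    sorted (relpre val ltn) (map h (enum 'I_r)).
  move=> hh; apply: (homo_sorted (e := relpre val ltn)) => [i j|]; first exact: hh.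
  by rewrite -sorted_map val_enum_ord iota_ltn_sorted.
have /eq_in_map eq_fg : map f (enum 'I_r) = map g (enum 'I_r).
  apply: (irr_sorted_eq (leT := relpre val ltn)) (srt f hf) (srt g hg) _.
  - by move=> y x z; apply: ltn_trans.
  - by move=> x; apply: ltnn.
  - exact: e.
by move=> i; apply: eq_fg; rewrite mem_enum.
Qed.

Lemma maximal_minorE (v : T -> 'rV[R]_r) B (f : 'I_r -> 'I_n) (A : 'M[R]_(r, n)) :
  map (fun i => listing le (f i)) (enum 'I_r) = listed L B ->
  (forall j, v (listing le j) = row j A^T) ->
  maximal_minor L v B = \det (colsub f A).
Proof.
move=> em vA; rewrite /maximal_minor /row_det -em -det_tr; congr (\det _).
apply/matrixP => k l; rewrite !mxE -map_comp (nth_map l) ?size_enum_ord //.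
by rewrite nth_ord_enum /= vA !mxE.
Qed.

Lemma row_free_det (A : 'M[R]_(r, n)) (f : 'I_r -> 'I_n) :
  row_free (rowsub f A^T) = (\det (colsub f A) != 0).
Proof.
have -> : rowsub f A^T = (colsub f A)^T by apply/matrixP => i j; rewrite !mxE.
by rewrite row_free_unit unitmx_tr unitmxE unitfE.
Qed.

Lemma base_setE X : X \subset E -> #|X| = r -> (X \in bases M) = (X \in indep M).
Proof. by move=> sX cX; apply/basesP/idP => [[]|]. Qed.

Lemma positroid_order_realization : positroid_order R M le ->
  exists v : T -> 'rV[R]_r, forall B, B \subset E -> #|B| = r ->
    0 <= maximal_minor L v B /\ (maximal_minor L v B != 0) = (B \in bases M).
Proof.
case=> A [repA nonnegA].
(* Elements outside the ground set have an index of at least [n], so [insub] fails and they receive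
   the zero vector. *)
exists (fun x => \row_l oapp (A l) 0 (insub (index x L))) => B sB cB.
have [f [fi fm em cf]] := column_listing sB cB.
rewrite (maximal_minorE em (A := A)); last first.
  by move=> j; apply/rowP => l; rewrite !mxE index_listing insubT //= => lt; congr (A l _); apply: val_inj.
split; first exact: nonnegA.
rewrite -row_free_det base_setE // repA //; apply: row_free_rowsub_codom => //.
  exact: enum_val_inj.
by move=> j; rewrite cf codom_enum_val.
Qed.

(** Minors only decide sets of size [r]. An independent set inherits freeness from a base around it;
    conversely, since the matrix has full rank, free columns extend to [r] free ones, which form a
    base. *)
Lemma realization_positroid_order (v : T -> 'rV[R]_r) :
  totally_nonneg_realization L M v -> positroid_order R M le.
Proof.
move=> vM; pose A : 'M[R]_(r, n) := \matrix_(l, j) v (listing le j) 0 l.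
have vA j : v (listing le j) = row j A^T by apply/rowP => l; rewrite !mxE.
have minorE (f : 'I_r -> 'I_n) B : B \subset E -> #|B| = r ->
    injective f -> codom f =i [set j | listing le j \in B] ->
    row_free (rowsub f A^T) = (B \in bases M).
  move=> sB cB fi cf; have [g [gi gm em cg]] := column_listing sB cB.
  rewrite (row_free_rowsub_codom _ fi gi); last by move=> j; rewrite cf cg.
  by rewrite row_free_det -(maximal_minorE em vA); case: (vM B cB).
have ex_base (f : 'I_r -> 'I_n) : injective f -> exists B,
    [/\ B \subset E, #|B| = r & codom f =i [set j | listing le j \in B]].
  move=> fi; exists [set listing le (f k) | k in 'I_r]; split.
  - by apply/subsetP => _ /imsetP[k _ ->]; apply: listing_ground.
  - by rewrite card_imset ?card_ord // => i j /listing_inj/fi.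
  - move=> j; rewrite in_set; apply/codomP/imsetP => [[k ->]|[k _ /listing_inj->]].
      by exists k.
    by exists k.
exists A; split=> [X sX|f fm]; last first.
  have fi : injective f.
    by move=> i j e; apply/val_inj; case: (ltngtP i j) => // /fm; rewrite e ltnn.
  have [B [sB cB cf]] := ex_base f fi.
  have [g [gi gm em cg]] := column_listing sB cB.
  have efg : f =1 g by apply: increasing_codom => // j; rewrite cf cg.
  suff -> : colsub f A = colsub g A by rewrite -(maximal_minorE em vA); case: (vM B cB).
  by apply/matrixP => k l; rewrite !mxE efg.
set h := @enum_val _ _; have hi : injective h by apply: enum_val_inj.
apply/idP/idP => [/indep_base[B b sXB]|free].
  have [f [fi _ _ cf]] := column_listing (base_ground b) (base_card b).
  have freef : row_free (rowsub f A^T) by rewrite (minorE f B (base_ground b) (base_card b) fi cf).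
  have sub : {subset codom h <= codom f}.
    by move=> j; rewrite codom_enum_val cf !in_set; apply: (subsetP sXB).
  have ht k : {l | f l == h k}.
    by apply/sigW; have /codomP[l e] := sub _ (codom_f h k); exists l; rewrite e.
  pose t k := sval (ht k); have ft k : f (t k) = h k by apply/eqP/(svalP (ht k)).
  have -> : rowsub h A^T = rowsub t (rowsub f A^T).
    by apply/matrixP => k l; rewrite !mxE ft.
  by apply: row_free_rowsub => // i j e; apply: hi; rewrite -!ft e.
have full : row_full A^T.
  have [B0 b0] := base_ex M.
  have [f [fi _ _ cf]] := column_listing (base_ground b0) (base_card b0).
  have freef : row_free (rowsub f A^T) by rewrite (minorE f B0 (base_ground b0) (base_card b0) fi cf).
  have /mxrankS : (rowsub f A^T <= A^T)%MS.
    by apply/row_subP => k; apply: (eq_row_sub (f k)); apply/rowP => l; rewrite !mxE.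
  by rewrite (eqP freef) => le_r; rewrite /row_full eqn_leq rank_leq_col le_r.
have [f [fi sub freef]] := row_free_extend full hi free.
have [B [sB cB cf]] := ex_base f fi.
rewrite (minorE f B) // in freef; apply: indepS (base_indep freef).
apply/subsetP => x xX; have xE := subsetP sX x xX.
have : Ordinal (index_listing_lt xE) \in codom f.
  by apply: sub; rewrite codom_enum_val in_set listing_index.
by rewrite cf in_set listing_index.
Qed.

End MatrixVectors.

(** * Crossing circuits *)

Section Minors.
Variables (T : finType) (M : matroid T).
Implicit Types (x y a b c d : T) (B C D F I J K S X Y : {set T}).
Local Notation r := (rank_of M).

Lemma flat_sub F : flat M F -> F \subset ground M.
Proof. by move=> <-; apply/subsetP => x; rewrite inE => /andP[]. Qed.

Lemma restrict_rank F X : rank_of (restrict M F) X = r (F :&: X).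
Proof.
by apply: eq_bigl => I; rewrite /= /restrict_indep !inE subsetI andbA.
Qed.

Lemma restrict_basesP F B : reflect [/\ B \in indep M, B \subset F & #|B| = r F]
  (B \in bases (restrict M F)).
Proof.
have e : rank (restrict M F) = r F.
  by rewrite /rank restrict_rank /= setICA setIid setIC rank_full.
apply: (iffP (basesP _ _)); rewrite e /= /restrict_indep inE.
  by case=> /andP[].
by case=> -> ->.
Qed.

Lemma restrict_circuitP F C : F \subset ground M ->
  reflect (C \in circuits M /\ C \subset F) (C \in circuits (restrict M F)).
Proof.
move=> sF; have iE X : (X \in indep (restrict M F)) = (X \in indep M) && (X \subset F).
  by rewrite inE.
have gE : ground (restrict M F) = F by rewrite /= (setIidPr sF).
apply: (iffP (circuitP _ _)); rewrite gE iE.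
  case=> sC; rewrite sC andbT => dC iC; split=> //; apply/circuitP; split=> //.
    exact: subset_trans sF.
  by move=> x xC; have := iC x xC; rewrite iE => /andP[].
case=> /circuitP[sC dC iC] sCF; rewrite (negPf dC); split=> // x xC.
by rewrite iE iC // (subset_trans (subsetDl _ _)).
Qed.

Lemma contract_indepE F B I : I \subset ground M :\: F -> B \in bases (restrict M F) ->
  (I \in indep (contract M F)) = (I :|: B \in indep M).
Proof. exact: contract_baseE. Qed.

(* Extending [C :\ a] and [D :\ b] to bases makes [a], [c] parallel and [b], [d]
   parallel over the contraction of a common set [S]. *)
Lemma crossing_circuits F C D a b c d : F \subset ground M ->
  C \in circuits M -> C \subset F -> a \in C -> c \in C -> a != c ->
  D \in circuits (contract M F) -> b \in D -> d \in D -> b != d ->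
  exists S, [/\ [/\ a \notin S, b \notin S, c \notin S & d \notin S],
    forall x y, x \in [:: a; c] -> y \in [:: b; d] -> x |: (y |: S) \in bases M &
    a |: (c |: S) \notin bases M].
Proof.
move=> sF cC sCF aC cC' nac /circuitP[/= sD dD iD] bD dD' nbd.
have [_ dC iC] := circuitP _ _ cC.
have [I [iI sCI sI cI]] : exists I, [/\ I \in indep M, C :\ a \subset I, I \subset F & #|I| = r F].
  by apply: rank_extend; [apply: iC|apply: subset_trans (subsetDl _ _) sCF].
have cI' : c \in I by apply: (subsetP sCI); rewrite !inE eq_sym nac.
have aI : a \notin I.
  apply: contra dC => aI; apply: indepS iI; rewrite -(setD1K aC) subUset sub1set aI //.
have aF : a \in F by apply: (subsetP sCF).
have bI : I \in bases (restrict M F) by apply/restrict_basesP.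
pose J := I :\ c; pose K := D :\ b :\ d.
have eI : I = c |: J by rewrite setD1K.
(* [a] and [c] are interchangeable over [J]: [c |: J] is a basis of [F], and [a |: J] contains
   [C :\ c], which spans [c]. *)
have spF X x : x \in [:: a; c] -> x |: J \subset X -> forall f, f \in F -> spans M X f.
  move=> xac sX; have sIX f : f \in I -> spans M X f.
    move=> fI; have [fJ|fJ] := boolP (f \in J).
      by apply: spans_in; apply: (subsetP sX); rewrite inE fJ orbT.
    have -> : f = c by move: fJ; rewrite !inE fI andbT negbK => /eqP.
    move: xac; rewrite !inE => /orP[] /eqP ex; rewrite ex in sX; last first.
      by apply: spans_in; apply: (subsetP sX); rewrite !inE eqxx.
    apply: spansS (circuit_spans cC cC'); apply: subset_trans sX.
    apply/subsetP => z /setD1P[zc zC]; rewrite !inE zc /=; case: eqVneq => //= za.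
    by apply: (subsetP sCI); rewrite !inE za.
  move=> f fF; apply: (spans_trans sIX); rewrite /spans (rank_indep iI) cI eqn_leq.
  rewrite [X in X && _]rankS ?subUset ?sub1set ?fF //=.
  by rewrite -cI -(rank_indep iI) rankS ?subsetUr.
have [bE dE] := (subsetP sD _ bD, subsetP sD _ dD').
have sKE : K \subset ground M :\: F.
  by apply: subset_trans sD; apply: subset_trans (subsetDl _ _) (subsetDl _ _).
have bK : b \notin K by rewrite !inE eqxx andbF.
have dK : d \notin K by rewrite !inE eqxx.
have eD1 : D :\ b = d |: K by rewrite setD1K // !inE eq_sym nbd.
have eD2 : D :\ d = b |: K.
  by apply/setP => z; rewrite !inE; case: (eqVneq z b) => [->|_] //=; rewrite nbd bD.
have iyK y : y \in [:: b; d] -> (y |: K) :|: I \in indep M.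
  rewrite !inE => yb; rewrite -(@contract_indepE F I) //.
    by case/orP: yb => /eqP->; rewrite -?eD1 -?eD2 iD.
  by rewrite subUset sKE andbT sub1set; case/orP: yb => /eqP->.
(* Likewise [b] and [d] are interchangeable over [K :|: I], because [D :|: I] is dependent in [M]
   while dropping [b] or [d] makes it independent. *)
have spD X y z : y \in [:: b; d] -> (y |: K) :|: I \subset X -> z \in D -> spans M X z.
  move=> yb sX zD; have iy := iyK y yb; have [zK|zK] := boolP (z \in (y |: K) :|: I).
    by apply: spans_in; apply: (subsetP sX).
  apply: spansS sX _; rewrite /spans (rank_indep iy).
  have eDz : D = z |: (y |: K).
    apply/setP => w; rewrite !inE; move: zK yb; rewrite !inE !negb_or => /andP[/andP[zy zK] _].
    move: zK; rewrite zD andbT negb_and !negbK => zbd /orP[] /eqP ey; rewrite ey in zy *.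
      have -> : z = d by move: zbd; rewrite (negPf zy) orbF => /eqP.
      by case: eqVneq => [->|_] /=; [rewrite dD'|case: eqVneq => [->|_] //=; rewrite bD].
    have -> : z = b by move: zbd; rewrite (negPf zy) => /eqP.
    by case: eqVneq => [->|_] /=; [rewrite bD|case: eqVneq => [->|_] //=; rewrite dD'].
  have := rank_le_card M (z |: ((y |: K) :|: I)).
  have dDI : D :|: I \notin indep M by rewrite -(@contract_indepE F I).
  move: dDI; rewrite eDz -setUA rank_indepE => h.
  rewrite leq_eqVlt (negPf h) /= cardsU1 zK add1n ltnS => le.
  by rewrite eqn_leq le -(rank_indep iy) rankS ?subsetUr.
(* The set [S] below is [B0] without [c] and [d], written so that it visibly contains [J] and
   [K]. *)
have [B0 b0 sB0] := indep_base (iyK d (mem_last b [:: d])).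
set S0 := (d |: K) :|: I in sB0; pose S := J :|: K :|: (B0 :\: S0).
have cS0 : c \in S0 by rewrite !inE cI' orbT.
have dS0 : d \in S0 by rewrite !inE eqxx.
have sS0S : B0 \subset c |: (d |: S).
  apply/subsetP => z zB; rewrite /S /S0 /J /K !inE zB; case: (eqVneq z c) => //= _.
  by case: (eqVneq z d) => //= _; case: (z \in I); case: (z \in D); case: (z == b).
have notF z : z \in ground M :\: F -> z \notin F by case/setDP.
have KF z : z \in K -> z \notin F by move/(subsetP sKE)/notF.
have [bF dF] := (notF b bE, notF d dE).
have cF : c \in F by apply: (subsetP sCF).
have JI : J \subset I by apply: subsetDl.
have IB0 : I \subset B0 by apply: subset_trans sB0; apply: subsetUr.
have aB0 : a \notin B0.
  apply: contra dC => aB; apply: indepS (base_indep b0).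
  by rewrite -(setD1K aC) subUset sub1set aB (subset_trans sCI).
have bB0 : b \notin B0.
  have : D :|: I \notin indep M by rewrite -(@contract_indepE F I).
  apply: contra => bB; apply: indepS (base_indep b0).
  rewrite subUset IB0 andbT -(setD1K bD) subUset sub1set bB eD1.
  exact: subset_trans (subsetUl _ _) sB0.
have sSB : S \subset B0.
  rewrite !subUset subsetDl andbT (subset_trans JI IB0) /=.
  by apply: subset_trans sB0; rewrite /S0 -setUA setUCA subsetUl.
have cS : c \notin S.
  rewrite !in_setU !negb_or in_setD cS0 andbT; apply/andP; split.
    by rewrite in_setD1 eqxx.
  by apply/negP => /KF; rewrite cF.
have dS : d \notin S.
  rewrite !in_setU !negb_or in_setD dS0 andbT dK andbT.
  by apply/negP => /(subsetP JI)/(subsetP sI); rewrite (negPf dF).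
have aS : a \notin S by apply: contra aB0; apply: (subsetP sSB).
have bS : b \notin S by apply: contra bB0; apply: (subsetP sSB).
have neF x y : x \in F -> y \notin F -> x != y by move=> xF; apply: contraNneq => <-.
have cardS x y : x \notin S -> y \notin S -> x != y -> #|x |: (y |: S)| = #|S|.+2.
  by move=> xS yS xy; rewrite !cardsU1 in_setU1 (negPf xS) (negPf yS) (negPf xy).
have cB0 : #|S|.+2 = rank M.
  rewrite -(base_card b0) -(cardS c d) //; last exact: neF.
  apply/eqP; rewrite eqn_leq [X in _ && X](subset_leq_card sS0S) andbT subset_leq_card //.
  by rewrite subUset sub1set (subsetP sB0 _ cS0) subUset sub1set (subsetP sB0 _ dS0) sSB.
exists S; split=> // [x y xac yb|].
  have xS : x \notin S by move: xac; rewrite in_cons mem_seq1 => /orP[] /eqP->.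
  have yS : y \notin S by move: yb; rewrite in_cons mem_seq1 => /orP[] /eqP->.
  have xF : x \in F by move: xac; rewrite in_cons mem_seq1 => /orP[] /eqP->.
  have yF : y \notin F by move: yb; rewrite in_cons mem_seq1 => /orP[] /eqP->.
  rewrite rank_baseE; last by rewrite cardS // neF.
  set X := x |: (y |: S).
  have SX : S \subset X by rewrite /X setUA subsetUr.
  have spXF f : f \in F -> spans M X f.
    apply: (spF _ x) => //; rewrite subUset sub1set setU11 /=.
    by apply: subset_trans SX; rewrite /S -setUA subsetUl.
  have spXd : spans M X d.
    apply: (@spans_trans _ _ _ ((y |: K) :|: I)); last exact: (spD _ y d yb (subxx _) dD').
    move=> z /setUP[zyK|/(subsetP sI)]; last exact: spXF.
    apply: spans_in; apply: subsetP zyK; rewrite subUset sub1set !inE eqxx orbT /=.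
    by apply: subset_trans SX; rewrite /S setUAC subsetUr.
  apply/eqP/anti_leq; rewrite rank_le -(base_card b0) -(rank_indep (base_indep b0)) /=.
  rewrite -(@spansU _ _ X B0); first by rewrite rankS ?subsetUr.
  move=> z /(subsetP sS0S) /setU1P[->|/setU1P[->//|zS]]; first exact: spXF.
  by apply: spans_in; apply: (subsetP SX).
apply/negP => /base_indep h; case/negP: dC; apply: indepS h.
rewrite -(setD1K aC) setUS // (subset_trans sCI) // eI setUS //.
by rewrite /S -setUA subsetUl.
Qed.

End Minors.

(** * Cyclic intervals *)

Section Shift.
Variable S : nat.
Implicit Types a b c d p : nat.

(* Comparing shifted positions is comparing in the cyclic order cut open at [p]. *)
Definition shifted p a := if a < p then a + S else a.

(** Cutting the circle at one point leaves at least one of the two arcs between [a] and [c] intact,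
    and each of them holds one of [b], [d]. *)
Lemma shifted_between p a b c d : a < S -> b < S -> c < S -> d < S -> p < S ->
  cyc4 id a b c d ->
  (shifted p a <= shifted p b <= shifted p c) || (shifted p c <= shifted p d <= shifted p a).
Proof.
rewrite /shifted => ? ? ? ? ? /or4P[] /and3P[? ? ?];
  case: (ltnP a p) => ?; case: (ltnP b p) => ?; case: (ltnP c p) => ?; case: (ltnP d p) => ?;
  apply/orP; first [exfalso; lia | left; lia | right; lia].
Qed.

Lemma shifted_inj p a b : a < S -> b < S -> shifted p a = shifted p b -> a = b.
Proof.
by rewrite /shifted => ? ?; case: (ltnP a p) => ?; case: (ltnP b p) => ? ?; lia.
Qed.

Lemma shifted_min p a : a < S -> p < S -> shifted p p <= shifted p a.
Proof. by rewrite /shifted ltnn => ? ?; case: (ltnP a p) => ?; lia. Qed.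

Lemma shifted_cyc4 p a b c d : a < S -> b < S -> c < S -> d < S ->
  shifted p a < shifted p b -> shifted p b < shifted p c -> shifted p c < shifted p d ->
  cyc4 id a b c d.
Proof.
rewrite /shifted => ? ? ? ?.
case: (ltnP a p) => ?; case: (ltnP b p) => ?; case: (ltnP c p) => ?; case: (ltnP d p) => ? ? ? ?;
  first [ exfalso; lia
      | apply/or4P; first [ by apply: Or41; apply/and3P; split; lia
               | by apply: Or42; apply/and3P; split; lia
               | by apply: Or43; apply/and3P; split; lia
               | by apply: Or44; apply/and3P; split; lia ] ].
Qed.

End Shift.

(** * From local sorting to the cyclic interval property *)

Section OrderConditions.
Variables (T : finType) (M : matroid T) (le : rel T).
Hypothesis le_linear : linear_order_on (ground M) le.
Local Notation E := (ground M).
Local Notation L0 := (sort le (enum E)).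
Local Notation L := (full_listing M le).
Local Notation pos := (fun x => index x L).
Local Notation r := (rank_of M).
Implicit Types (p x y a b c d : T) (A B C D F K U X : {set T}).

Let pos_inj : injective pos := index_listing_inj (mem_full_listing M le).

Let ltS x : x \in E -> pos x < #|E|. Proof. exact: index_listing_lt. Qed.

Lemma le_index : {in E &, forall x y, le x y = (pos x <= pos y)}.
Proof.
have [anti tr tot] := le_linear.
have refl : {in E, reflexive le} by move=> x xE; have := tot x x xE xE; rewrite orbb.
have sE : {subset L0 <= E} by move=> x; rewrite mem_sort mem_enum.
have srt : sorted le L0.
  by apply: (sort_sorted_in tot); apply/allP => x; rewrite mem_enum.
have le1 x y : x \in E -> y \in E -> pos x <= pos y -> le x y.
  move=> xE yE; rewrite !index_full_listing //; apply: sorted_leq_index_in srt _ _ _ _.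
  - by move=> u v w /sE uE /sE vE /sE wE; apply: tr.
  - by move=> u /sE; apply: refl.
  - by rewrite mem_sort mem_enum.
  - by rewrite mem_sort mem_enum.
move=> x y xE yE; apply/idP/idP => [lexy|]; last exact: le1.
rewrite leqNgt; apply/negP => ltyx; have leyx := le1 y x yE xE (ltnW ltyx).
by move: ltyx; rewrite (anti x y xE yE) ?ltnn // lexy.
Qed.

Let sh p x := shifted #|E| (pos p) (pos x).

Let shift_orderE p x y : p \in E -> x \in E -> y \in E ->
  shift_order le p x y = (sh p x <= sh p y).
Proof.
move=> pE xE yE; rewrite /shift_order !le_index // /sh /shifted.
have [] := (ltS xE, ltS yE); move: (index x L) (index y L) (index p L) #|E| => u v w s.
by case: (leqP w u); case: (leqP w v) => ? ? ? ? /=; lia.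
Qed.

Lemma order_interval_shiftP p A : p \in E -> A \subset E ->
  reflect (forall a b c, a \in A -> c \in A -> b \in E -> sh p a <= sh p b <= sh p c -> b \in A)
    (order_interval E (shift_order le p) A).
Proof.
move=> pE sA; rewrite /order_interval sA /=; apply: (iffP forall_inP) => [h a b c aA cA bE|h a aA].
  have := h a aA => /forall_inP/(_ c cA)/forall_inP/(_ b bE)/implyP.
  by rewrite !shift_orderE //; apply: (subsetP sA).
apply/forall_inP => c cA; apply/forall_inP => b bE; apply/implyP.
by rewrite !shift_orderE //; [apply: (h a b c)|apply: (subsetP sA)..].
Qed.

(** If [A] misses [p], it is an interval of the circle cut open at [p]: a gap [b] in it would
    alternate with [p]. If [A] is everything, any starting point serves, and nonemptiness provides
    one. *)
Lemma cyclic_intervalP A : E != set0 ->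
  reflect (A \subset E /\ cyc_convex pos E A) (cyclic_interval E le A).
Proof.
move=> /set0Pn/sigW[p0 p0E]; apply: (iffP exists_inP) => [[p pE /[dup] /andP[sA _] iA]|[sA cA]].
  split=> // a b c d aE bE cE dE cyc aA cA; have iA' := elimT (order_interval_shiftP pE sA) iA.
  have /orP[h|h] := shifted_between (ltS aE) (ltS bE) (ltS cE) (ltS dE) (ltS pE) cyc.
    by rewrite (iA' a b c).
  by rewrite (iA' c d a) ?orbT.
have [eA|/subsetPn[p pE pA]] := boolP (E \subset A).
  by exists p0 => //; apply/order_interval_shiftP => // a b c _ _ /(subsetP eA).
exists p => //; apply/order_interval_shiftP => // a b c aA cA' bE /andP[leab lebc].
apply/negPn/negP => bA; have [aE cE] := (subsetP sA a aA, subsetP sA c cA').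
have lt x y : x \in E -> y \in E -> x != y -> sh p x <= sh p y -> sh p x < sh p y.
  move=> xE yE xy; rewrite [sh p x <= sh p y]leq_eqVlt => /orP[/eqP|//].
  by move/(shifted_inj (ltS xE) (ltS yE))/pos_inj => e; rewrite e eqxx in xy.
have ltab : sh p a < sh p b by apply: lt => //; apply: contraNneq bA => <-.
have ltbc : sh p b < sh p c by apply: lt => //; apply: contraNneq bA => ->.
have ltpa : sh p p < sh p a.
  by apply: lt (shifted_min (ltS aE) (ltS pE)) => //; apply: contraNneq pA => ->.
have cyc : cyc4 pos p a b c.
  exact: (shifted_cyc4 (ltS pE) (ltS aE) (ltS bE) (ltS cE) ltpa ltab ltbc).
by have := cA a b c p aE bE cE pE; rewrite -[cyc4 _ _ _ _ _]cyc4_rot cyc aA cA' (negPf bA) (negPf pA) => /(_ isT isT isT).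
Qed.

(** Whichever of the four comes first in the linear order, the first two and the last two give
    bases, and sorting these produces the alternating pair [a], [c], which is not allowed because it
    completes the circuit [C]. *)
Lemma crossing_not_locally_sorting F C D a b c d : locally_sorting L M -> F \subset E ->
  C \in circuits M -> C \subset F -> D \in circuits (contract M F) ->
  a \in C -> c \in C -> b \in D -> d \in D -> cyc4 pos a b c d -> False.
Proof.
move=> W sF cC sCF cD aC cC' bD dD cyc.
have nac : a != c by apply: contraNneq (cyc4_neq cyc) => ->.
have nbd : b != d by apply: contraNneq (cyc4_neq (etrans (esym (cyc4_rot _ _ _ _ _)) cyc)) => ->.
have [S [[aS bS cS dS] bases4 nb]] :=
  crossing_circuits sF cC sCF aC cC' nac cD bD dD nbd.
have [a1 c1 b1 d1] : [/\ a \in [:: a; c], c \in [:: a; c], b \in [:: b; d] & d \in [:: b; d]].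
  by rewrite !inE !eqxx !orbT.
have [ab ad cb cd] := And4 (bases4 a b a1 b1) (bases4 a d a1 d1) (bases4 c b c1 b1) (bases4 c d c1 d1).
case/negP: nb; case/or4P: cyc => /and3P[h1 h2 h3].
- by have [] := W S a b c d _ h1 h2 h3 ab cd.
- rewrite setUCA in ad; rewrite setUCA in cb.
  by have [|_] := W S b c d a _ h1 h2 h3 cb ad; rewrite // setUCA.
- by have [|] := W S c d a b _ h1 h2 h3 cd ab; rewrite // setUCA.
- rewrite setUCA in ad; rewrite setUCA in cb.
  by have [|_] := W S d a b c _ h1 h2 h3 ad cb.
Qed.

Lemma locally_sorting_cyclic_interval : locally_sorting L M -> cyclic_interval_property M le.
Proof.
move=> W F /properP[sF _] flF conF F2 K.
case/imsetP=> x xK -> _; have /setDP[xE xF] : x \in E :\: F by [].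
have [p pF] : exists p, p \in F by apply/set0Pn; rewrite -card_gt0; lia.
have pE := subsetP sF p pF.
(* The gap of [F] around [x], in the order that starts at the point [p] of [F]. *)
pose A := [set y in E | [forall f in F, ~~ (minn (sh p x) (sh p y) <= sh p f <= maxn (sh p x) (sh p y))]].
have AP y : reflect (y \in E /\ forall f, f \in F ->
     ~~ (minn (sh p x) (sh p y) <= sh p f <= maxn (sh p x) (sh p y))) (y \in A).
  by rewrite inE; apply: (iffP andP) => -[yE /forall_inP h].
exists A; split.
- apply/exists_inP; exists p => //; apply/order_interval_shiftP => //.
    by apply/subsetP => y /AP[].
  move=> a b c /AP[aE ha] /AP[cE hc] bE h; apply/AP; split=> // f fF.
  have := ha f fF; have := hc f fF; move: h; clear.
  by move: (sh p a) (sh p b) (sh p c) (sh p x) (sh p f) => *; lia.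
- rewrite -setI_eq0 -subset0; apply/subsetP => y /setIP[/AP[yE h] yF].
  by have := h y yF; rewrite geq_minr leq_maxr.
apply/subsetP => y; rewrite inE => /andP[yK jxy]; have /setDP[yE yF] : y \in E :\: F by [].
(* Otherwise [p] and [f] in [F] separate [x] from [y] on the circle; the circuit joining [p] and [f]
   then crosses the one joining [x] and [y]. *)
apply/AP; split=> // f fF; apply/negP => bet; have fE := subsetP sF f fF.
have sh_neq u v : u \in E -> v \in E -> u \in F -> v \notin F -> sh p u != sh p v.
  move=> uE vE uF vF; apply/eqP => /(shifted_inj (ltS uE) (ltS vE))/pos_inj e.
  by rewrite -e uF in vF.
have [nfx nfy] := (sh_neq f x fE xE fF xF, sh_neq f y fE yE fF yF).
have [npx npy] := (sh_neq p x pE xE pF xF, sh_neq p y pE yE pF yF).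
have mx : sh p p <= sh p x := shifted_min (ltS xE) (ltS pE).
have my : sh p p <= sh p y := shifted_min (ltS yE) (ltS pE).
have nxy : x != y by apply: contraTneq bet => <-; rewrite minnn maxnn; move: nfx; clear; lia.
have [D [cD xD yD]] : exists D, [/\ D \in circuits (contract M F), x \in D & y \in D].
  by case/joinedP: jxy => // e; rewrite e eqxx in nxy.
have gF : ground (restrict M F) = F by rewrite /= (setIidPr sF).
have npf : p != f.
  apply: contraTneq bet => <-; move: mx my npx npy; clear.
  by move: (sh p p) (sh p x) (sh p y) => *; lia.
have [C [/(restrict_circuitP _ sF)[cC sC] pC fC]] :
    exists C, [/\ C \in circuits (restrict M F), p \in C & f \in C].
  have /joinedP[e|//] : joined (restrict M F) p f by apply: conF; rewrite gF.
  by rewrite e eqxx in npf.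
have [[lt1 lt2 lt3]|[lt1 lt2 lt3]] : [/\ sh p p < sh p x, sh p x < sh p f & sh p f < sh p y] \/
    [/\ sh p p < sh p y, sh p y < sh p f & sh p f < sh p x].
  move: bet nfx nfy mx my npx npy; clear.
  move: (sh p p) (sh p x) (sh p y) (sh p f) => u v w z *.
  by case: (ltnP v w) => ?; [left|right]; split; lia.
- have cyc : cyc4 pos p x f y by apply: (shifted_cyc4 (ltS pE) (ltS xE) (ltS fE) (ltS yE)) lt1 lt2 lt3.
  exact: crossing_not_locally_sorting W sF cC sC cD pC fC xD yD cyc.
- have cyc : cyc4 pos p y f x by apply: (shifted_cyc4 (ltS pE) (ltS yE) (ltS fE) (ltS xE)) lt1 lt2 lt3.
  exact: crossing_not_locally_sorting W sF cC sC cD pC fC yD xD cyc.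
Qed.

End OrderConditions.

(** * Direct sums over maximal cyclic intervals *)

Section DirectSums.
Variables (T : finType) (M : matroid T) (le : rel T).
Hypothesis le_linear : linear_order_on (ground M) le.
Local Notation E := (ground M).
Local Notation L := (full_listing M le).
Local Notation pos := (fun x => index x L).
Local Notation r := (rank_of M).
Implicit Types (p x y a b c d : T) (A B C D F I J K U V W X : {set T}).

Let pos_inj : injective pos := index_listing_inj (mem_full_listing M le).

Lemma rank_contract F W : W \subset E :\: F ->
  r (F :|: W) = r F + rank_of (contract M F) W.
Proof.
move=> sW; have [I bI] := contract_ex_base M F.
have [iI sI cI] := elimT (restrict_basesP _ _ _) bI.
apply/anti_leq/andP; split.
  have [K [iK sIK sK <-]] := rank_extend iI (subset_trans sI (subsetUl F W)).
  have eKF : K :&: F = I.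
    apply/esym/eqP; rewrite eqEcard subsetI sIK sI cI indep_le_rank ?subsetIr //.
    by apply: indepS iK; apply: subsetIl.
  rewrite -(cardsID F K) eKF cI leq_add2l; apply: indep_le_rank; last by rewrite subDset.
  rewrite (contract_indepE _ bI); last by apply: subset_trans sW; rewrite subDset.
  by rewrite setUC -eKF setID.
have [J [iJ sJ <-]] := rank_witness (contract M F) W.
have sJE := subset_trans sJ sW.
have iU : J :|: I \in indep M by rewrite -(contract_indepE sJE bI).
have dis : [disjoint J & I].
  rewrite -setI_eq0 -subset0; apply/subsetP => x /setIP[/(subsetP sJE)/setDP[_ xF]].
  by move/(subsetP sI); rewrite (negPf xF).
rewrite addnC -cI; have /eqP <- : #|J :|: I| == #|J| + #|I| by rewrite (leq_card_setU J I).2.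
by rewrite indep_le_rank // setUC setUSS.
Qed.

Lemma max_cyclic_intervalP F U : E != set0 -> U \in max_cyclic_intervals E le F ->
  [/\ U \subset E :\: F, cyc_convex pos E U &
      forall A, A \subset E :\: F -> cyc_convex pos E A -> U \subset A -> A = U].
Proof.
move=> E0; rewrite inE => /maxsetP[/= /andP[/(cyclic_intervalP le_linear _ E0)[sU cU] dU] mU].
split=> // [|A sA cA sUA]; first by rewrite subsetD sU.
apply: mU => //; move: sA; rewrite subsetD => /andP[sA ->]; rewrite andbT.
by apply/(cyclic_intervalP le_linear _ E0).
Qed.

Lemma max_cyclic_interval_ex F A : cyclic_interval E le A -> [disjoint A & F] ->
  exists2 U, U \in max_cyclic_intervals E le F & A \subset U.
Proof.
move=> cA dA; pose P := [pred A : {set T} | cyclic_interval E le A && [disjoint A & F]].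
have [|U mU sU] := @maxset_exists _ P A; first by rewrite /= cA.
by exists U; rewrite ?inE.
Qed.

Lemma cyc_convex_card_le1 A : #|A| <= 1 -> cyc_convex pos E A.
Proof.
move=> /card_le1_eqP A1 a b c d _ _ _ _ cyc aA cA.
by have := cyc4_neq cyc; rewrite (A1 a c) // eqxx.
Qed.

Lemma cyclic_interval_direct_sum : cyclic_interval_property M le ->
  forall F, flat M F -> 2 <= #|F| <= #|E| - 2 -> connected (restrict M F) ->
    is_direct_sum (contract M F) (max_cyclic_intervals E le F)
      (fun U => restrict (contract M F) U).
Proof.
move=> cip F flF /andP[F2 FE] conF; have sF := flat_sub flF.
have E0 : E != set0 by rewrite -card_gt0; lia.
have pF : F \proper E by rewrite properEcard sF; lia.
set N := contract M F; set Us := max_cyclic_intervals E le F.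
have gN : ground N = E :\: F by [].
have gU U : U \in Us -> ground (restrict N U) = U.
  by move=> /(max_cyclic_intervalP E0)[sU _ _]; rewrite /= (setIidPr sU).
have single x : x \in E :\: F -> exists2 U, U \in Us & x \in U.
  case/setDP=> xE xF; have [||U UU xU] := @max_cyclic_interval_ex F [set x].
  - apply/cyclic_intervalP => //; split; first by rewrite sub1set.
    by apply: cyc_convex_card_le1; rewrite cards1.
  - by rewrite disjoints1.
  - by exists U; rewrite // -sub1set.
have disj U V : U \in Us -> V \in Us -> U != V -> [disjoint U & V].
  move=> /(max_cyclic_intervalP E0)[sU cU mU] /(max_cyclic_intervalP E0)[sV cV mV].
  apply: contraR => dUV.
  have cUV : cyc_convex pos E (U :|: V).
    by apply: cyc_convexU => //; rewrite (setIidPr _) ?(subset_trans sU) ?subsetDl.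
  have sUV : U :|: V \subset E :\: F by rewrite subUset sU.
  by apply/eqP; rewrite -(mU _ sUV cUV (subsetUl _ _)) (mV _ sUV cUV (subsetUr _ _)).
(* A circuit lies in one component, hence in a cyclic interval and in a maximal one. One-element
   circuits go through [single], as the cyclic interval property speaks only of larger
   components. *)
have circ C : C \in circuits N -> exists2 U, U \in Us & C \subset U.
  move=> cC; have [sC dC _] := circuitP _ _ cC.
  have [x xC] : exists x, x \in C.
    by apply/set0Pn; apply: contraNneq dC => ->; apply: indep0.
  have xN := subsetP sC x xC; have [C1|C2] := leqP #|C| 1.
    have [U UU xU] := single x xN; exists U => //; apply/subsetP => y yC.
    by rewrite (card_le1_eqP C1 x y).
  pose K := [set y in ground N | joined N x y].
  have sCK : C \subset K.
    apply/subsetP => y yC; rewrite in_set (subsetP sC) //=; apply/joinedP; right.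
    by exists C.
  have [||A [cA dA sKA]] := cip F pF flF conF F2 K.
  - by apply/imsetP; exists x.
  - exact: leq_trans C2 (subset_leq_card sCK).
  have [U UU sAU] := max_cyclic_interval_ex cA dA; exists U => //.
  exact: subset_trans (subset_trans sCK sKA) sAU.
split.
- by move=> U V UU VU neq; rewrite !gU // disj.
- apply/setP => x; apply/idP/bigcupP => [/single[U UU xU]|[U UU]].
    by exists U; rewrite ?gU.
  by rewrite gU // => xU; have [/subsetP->] := max_cyclic_intervalP E0 UU.
move=> I; split=> [iI|[J iJ ->]].
  exists (fun U => I :&: U).
    by move=> U UU; rewrite inE subsetIr (indepS _ iI) ?subsetIl.
  rewrite -big_distrr /=; apply/esym/setIidPl; apply/subsetP => x xI.
  have [U UU xU] := single x (subsetP (indep_ground iI) x xI).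
  by apply/bigcupP; exists U.
have sJ U : U \in Us -> J U \subset U by move=> /iJ; rewrite inE => /andP[].
apply: contraT => dJ; have [|C cC sC] := dep_circuit _ dJ.
  apply/bigcupsP => U UU; apply: subset_trans (sJ U UU) _.
  by have [] := max_cyclic_intervalP E0 UU.
have [U UU sCU] := circ C cC; have [_ dC _] := circuitP _ _ cC; case/negP: dC.
have iJU : J U \in indep N by have := iJ U UU; rewrite inE => /andP[].
apply: indepS iJU; apply/subsetP => x xC.
have /bigcupP[V VU xV] := subsetP sC x xC.
have [-> //|neq] := eqVneq U V.
have := disj U V UU VU neq; rewrite -setI_eq0 => /eqP/setP/(_ x).
by rewrite !inE (subsetP sCU) // (subsetP (sJ V VU)).
Qed.

(** The inequality opposite to submodularity: an independent subset of [W], cut along the other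
    summands, can be joined to one of [U]. *)
Lemma direct_sum_rank (N : matroid T) (Us : {set {set T}}) U W :
  is_direct_sum N Us (fun U => restrict N U) -> U \in Us -> U \subset ground N ->
  W \subset ground N -> [disjoint W & U] ->
  rank_of N W + rank_of N U <= rank_of N (W :|: U).
Proof.
case=> _ gN iN UU sU sW dWU.
have [J1 [i1 s1 <-]] := rank_witness N W; have [J2 [i2 s2 <-]] := rank_witness N U.
have dJ : [disjoint J1 & J2] by apply: disjointWr s2 _; apply: disjointWl s1 _.
have /eqP <- : #|J1 :|: J2| == #|J1| + #|J2| by rewrite (leq_card_setU J1 J2).2.
apply: indep_le_rank; last exact: setUSS.
apply/iN; exists (fun V => if V == U then J2 else J1 :&: V) => [V VU|].
  case: eqP => [->|_]; rewrite inE; first by rewrite i2.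
  by rewrite subsetIr (indepS _ i1) ?subsetIl.
apply/eqP; rewrite eqEsubset; apply/andP; split; last first.
  apply/bigcupsP => V VU; case: eqP => _; first exact: subsetUr.
  exact: subset_trans (subsetIl _ _) (subsetUl _ _).
rewrite subUset; apply/andP; split; apply/subsetP => x xJ; apply/bigcupP; last first.
  by exists U; rewrite ?eqxx.
have : x \in ground N by apply: (subsetP sW); apply: (subsetP s1).
rewrite gN => /bigcupP[V VU /setIP[_ xV]]; exists V => //.
have -> : V == U = false; last by rewrite inE xJ.
apply: contraTF dWU => /eqP eV; apply/pred0Pn; exists x; rewrite /= (subsetP s1) //.
by rewrite -eV.
Qed.

End DirectSums.

(** * Rank inequalities of cyclic intervals *)

Section Separators.
Variables (T : finType) (M : matroid T).
Local Notation r := (rank_of M).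
Implicit Types (x y : T) (X Y : {set T}).

Lemma rank_gt0 X x : loopless M -> x \in ground M -> x \in X -> 0 < r X.
Proof.
move=> noloop xE xX; apply: leq_trans (rankS M (_ : [set x] \subset X)); last first.
  by rewrite sub1set.
suff ix : [set x] \in indep M by rewrite (rank_indep ix) cards1.
apply: contraR (noloop x xE) => dx; apply/circuitP; split=> //; first by rewrite sub1set.
by move=> y /set1P->; rewrite setDv indep0.
Qed.

(** A circuit inside [I1 :|: I2] lies in neither set, so it would join an element of the class [Y]
    to an element outside it. *)
Lemma disconnected_separation X Y e : X \subset ground M ->
  Y = [set y in X | joined (restrict M X) e y] -> r Y + r (X :\: Y) <= r X.
Proof.
move=> sX eY; have [I1 [i1 s1 <-]] := rank_witness M Y.
have [I2 [i2 s2 <-]] := rank_witness M (X :\: Y).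
have sYX : Y \subset X by rewrite eY; apply/subsetP => y; rewrite inE => /andP[].
have s1X := subset_trans s1 sYX; have s2X := subset_trans s2 (subsetDl X Y).
have d12 : [disjoint I1 & I2].
  apply: disjointWr s2 _; apply: disjointWl s1 _.
  by rewrite -setI_eq0; apply/eqP/setP => z; rewrite !inE; case: (z \in Y).
have /eqP <- : #|I1 :|: I2| == #|I1| + #|I2| by rewrite (leq_card_setU I1 I2).2.
apply: indep_le_rank; last by rewrite subUset s1X.
apply: contraT => dI; have [|C cC sC] := dep_circuit _ dI.
  by rewrite subUset !(subset_trans _ sX).
have sCX : C \subset X by apply: subset_trans sC _; rewrite subUset s1X.
have [_ dC _] := circuitP _ _ cC.
have [y yC y2] : exists2 y, y \in C & y \notin I2.
  by apply/subsetPn; apply: contra dC => s; apply: indepS i2.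
have [z zC z1] : exists2 z, z \in C & z \notin I1.
  by apply/subsetPn; apply: contra dC => s; apply: indepS i1.
have y1 : y \in I1 by have := subsetP sC y yC; rewrite inE (negPf y2) orbF.
have z2 : z \in I2 by have := subsetP sC z zC; rewrite inE (negPf z1).
have := subsetP s2 z z2; rewrite eY !inE (subsetP sCX) // andbT /= => /negP[].
have := subsetP s1 y y1; rewrite eY inE => /andP[_ jey]; apply: joined_trans jey _.
by apply/joinedP; right; exists C; split=> //; apply/restrict_circuitP.
Qed.

End Separators.

Section Determined.
Variables (T : finType) (M : matroid T) (le : rel T).
Hypothesis le_linear : linear_order_on (ground M) le.
Hypothesis noloop : loopless M.
Local Notation E := (ground M).
Local Notation L := (full_listing M le).
Local Notation pos := (fun x => index x L).
Local Notation r := (rank_of M).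
Implicit Types (p x y a b c d : T) (A B C D F I J K U V W X : {set T}).

(* If [F] violates its rank inequality at [B], so does [F :|: U] for a summand [U]
   of [M / F]: by modularity the excess of [F] is shared with [E :\: U], the
   complement of a cyclic interval. *)
Lemma direct_sum_determined :
  (forall F, flat M F -> 2 <= #|F| <= #|E| - 2 -> connected (restrict M F) ->
    is_direct_sum (contract M F) (max_cyclic_intervals E le F)
      (fun U => restrict (contract M F) U)) ->
  forall B, B \subset E -> #|B| = rank M ->
    (forall A, A \subset E -> cyc_convex pos E A -> #|B :&: A| <= r A) -> B \in bases M.
Proof.
move=> sum B sB cB h; apply: contraT => nb.
have E0 : E != set0.
  apply: contraNneq nb => e; have := base_ex M => -[B0 b0].
  suff -> : B = B0 by [].
  by have := base_ground b0; rewrite e subset0 => /eqP->; move: sB; rewrite e subset0 => /eqP.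
pose viol X := (X \subset E) && (r X < #|B :&: X|).
have vB : viol B.
  rewrite /viol sB setIid cB ltn_neqAle rank_le andbT.
  by move: nb; rewrite rank_baseE.
(* A lexicographic measure: first least rank, which gives connectedness, then largest size, which
   gives flatness. *)
pose f X := r X * #|T|.+1 + (#|T| - #|X|).
have [X /andP[sX vX] minX] := @arg_minnP _ B viol f vB.
have leT (A : {set T}) : #|A| <= #|T| by apply: max_card.
have lowrank X' : X' \subset E -> r X' < r X -> #|B :&: X'| <= r X'.
  move=> sX' lt; rewrite leqNgt; apply/negP => v; have := minX X'; rewrite /viol sX' v => /(_ isT).
  rewrite leqNgt => /negP[]; rewrite /f; apply: (@leq_ltn_trans (r X' * #|T|.+1 + #|T|)).
    by rewrite leq_add2l leq_subr.
  by apply: (@leq_trans ((r X').+1 * #|T|.+1)); [rewrite mulSn; lia|rewrite -[leqLHS]addn0 leq_add ?leq_mul2r ?lt ?orbT].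
have ncX : ~ cyc_convex pos E X by move=> /(h X sX); rewrite leqNgt vX.
have flX : flat M X.
  apply/eqP; rewrite /closure_of eqEsubset; apply/andP; split; last first.
    apply/subsetP => x xX; rewrite inE (subsetP sX) //=; exact: spans_in.
  apply/subsetP => x; rewrite inE => /andP[xE /eqP e]; apply: contraT => xX.
  have := minX (x |: X); rewrite /viol subUset sub1set xE sX e /=.
  rewrite (leq_trans vX) ?subset_leq_card ?setIS ?subsetUr // => /(_ isT).
  rewrite /f e leq_add2l cardsU1 xX; have := leT (x |: X); rewrite cardsU1 xX.
  by clear; lia.
have X2 : 2 <= #|X|.
  by rewrite ltnNge; apply/negP => /(@cyc_convex_card_le1 _ M le) /ncX.
have XE : #|X| <= #|E| - 2.
  suff : 2 <= #|E :\: X| by have := cardsID X E; rewrite (setIidPr sX); clear; lia.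
  rewrite ltnNge; apply/negP => /(@cyc_convex_card_le1 _ M le)/cyc_convexC/cyc_convex_setI.
  suff -> : ~: (E :\: X) :&: E = X by [].
  apply/setP => z; rewrite !inE negb_and negbK; case zX: (z \in X); first exact: (subsetP sX).
  by rewrite /= andNb.
(* Without loops both sides of a separation have positive rank, hence smaller rank than [X]. Neither
   is violated, and their inequalities add up to that of [X]. *)
have conX : connected (restrict M X).
  move=> e g; rewrite /= (setIidPr sX) => eX gX; apply: contraT => nj.
  set Y := [set y in X | joined (restrict M X) e y].
  have le_r := disconnected_separation sX (erefl Y).
  have sYX : Y \subset X by apply/subsetP => y; rewrite inE => /andP[].
  have eY : e \in Y by rewrite inE eX; apply/joinedP; left.
  have gY : g \in X :\: Y by rewrite !inE gX (negPf nj).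
  have rY := rank_gt0 noloop (subsetP sX e eX) eY.
  have rXY := rank_gt0 noloop (subsetP sX g gX) gY.
  have l1 : #|B :&: Y| <= r Y.
    by apply: lowrank; [apply: subset_trans sX|move: le_r rXY; clear; lia].
  have l2 : #|B :&: (X :\: Y)| <= r (X :\: Y).
    by apply: lowrank; [apply: subset_trans (subsetDl _ _) sX|move: le_r rY; clear; lia].
  have := cardsID Y (B :&: X); rewrite -setIA (setIidPr sYX) -setIDA.
  by move: l1 l2 le_r vX; clear; lia.
have sumX := sum X flX (introT andP (conj X2 XE)) conX.
set N := contract M X in sumX; set Us := max_cyclic_intervals E le X in sumX.
have UsP U : U \in Us -> U \subset E :\: X /\ cyc_convex pos E U.
  by case/(max_cyclic_intervalP le_linear E0).
have [dis cov _] := sumX.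
have gU U : U \in Us -> ground (restrict N U) = U.
  by case/UsP=> sU _; rewrite /= (setIidPr sU).
have disU U V : U \in Us -> V \in Us -> U != V -> [disjoint U & V].
  by move=> UU VU neq; have := dis U V UU VU neq; rewrite !gU.
(* A maximal such family must omit a summand: with all of them the set is [E], where #|B| = rank M
   leaves no violation. *)
pose P := [pred S : {set {set T}} | (S \subset Us) && (r (X :|: cover S) < #|B :&: (X :|: cover S)|)].
have P0 : P set0 by rewrite /= sub0set /cover big_set0 setU0.
have [S /maxsetP[/andP[sS vS] mS] _] := @maxset_exists _ P set0 P0.
have sSE U : U \in S -> U \subset E :\: X by move=> /(subsetP sS)/UsP[].
have [sUS|/subsetPn[U UU US]] := boolP (Us \subset S).
  have eE : X :|: cover S = E.
    have -> : cover S = E :\: X.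
      rewrite -[E :\: X]/(ground N) cov; have -> : S = Us by apply/eqP; rewrite eqEsubset sS.
      by apply: eq_bigr => U /gU->.
    by rewrite setDE setUIr setUCr setIT (setUidPr sX).
  by move: vS; rewrite eE (setIidPl sB) cB ltnn.
have [sU cU] := UsP U UU; set Z := cover S in vS.
have sZ : Z \subset E :\: X by apply/bigcupsP => V /sSE.
have dZU : [disjoint Z & U].
  rewrite -setI_eq0 -subset0; apply/subsetP => x /setIP[/bigcupP[V VS xV] xU].
  have neq : V != U by apply: contraNneq US => <-.
  by have /pred0P/(_ x) := disU V U (subsetP sS V VS) UU neq; rewrite /= xV xU.
have dXU : [disjoint X & U].
  by rewrite disjoint_sym; move: sU; rewrite subsetD => /andP[].
have dXZ : [disjoint X & Z].
  by rewrite disjoint_sym; move: sZ; rewrite subsetD => /andP[].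
suff : P (U |: S).
  by move/mS => /(_ (subsetUr _ _)) e; move: US; rewrite -e setU11.
rewrite /= subUset sub1set UU sS /=.
have -> : cover (U |: S) = Z :|: U by rewrite /cover bigcup_setU big_set1 setUC.
set W := E :\: X :\: U; have sW : W \subset E :\: X by apply: subsetDl.
have hW : #|B :&: (X :|: W)| <= r (X :|: W).
  have -> : X :|: W = ~: U :&: E.
    apply/setP => x; rewrite !inE; case xX: (x \in X).
      rewrite (subsetP sX) // andbT /=.
      by have /pred0P/(_ x) := dXU; rewrite /= xX /= => ->.
    by rewrite /=.
  by apply: h; [apply: subsetIr|apply/cyc_convex_setI/cyc_convexC].
have dWU : [disjoint W & U] by rewrite -setI_eq0 setIDAC -setIDA setDv setI0.
have eWU : W :|: U = E :\: X.
  by rewrite /W setDE setUIl [~: U :|: U]setUC setUCr setIT (setUidPl sU).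
have hr := direct_sum_rank sumX UU sU sW dWU; rewrite eWU in hr.
have hsub := rank_submod N Z U.
have rZ : r (X :|: (Z :|: U)) <= r X + (rank_of N Z + rank_of N U).
  rewrite rank_contract ?subUset ?sZ // leq_add2l; apply: leq_trans hsub; exact: leq_addr.
have eE : X :|: (E :\: X) = E by rewrite setDE setUIr setUCr setIT (setUidPr sX).
have rE := rank_contract (subxx (E :\: X)); rewrite eE -/(rank M) in rE.
rewrite rank_contract // in hW; rewrite rank_contract // -/N in vS.
have cardU (Y1 Y2 : {set T}) : [disjoint Y1 & Y2] -> #|B :&: (Y1 :|: Y2)| = #|B :&: Y1| + #|B :&: Y2|.
  move=> dY; rewrite setIUr; apply/eqP; rewrite (leq_card_setU _ _).2.
  exact: disjointWl (subsetIr _ _) (disjointWr (subsetIr _ _) dY).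
have dXW : [disjoint X & W] by rewrite disjoint_sym; move: sW; rewrite subsetD => /andP[].
have cardE : #|B| = #|B :&: X| + #|B :&: W| + #|B :&: U|.
  have dXWU : [disjoint X :|: W & U].
    by rewrite -setI_eq0 setIUl setU_eq0 !setI_eq0 dXU dWU.
  by rewrite -cardU // -cardU // -setUA eWU eE (setIidPl sB).
apply: leq_ltn_trans rZ _.
have dZUX : [disjoint X & Z :|: U].
  by rewrite disjoint_sym -setI_eq0 setIUl setU_eq0 !setI_eq0 disjoint_sym dXZ disjoint_sym dXU.
(* The bound for [X :|: W] and #|B| = rank M give rank_of N U <= #|B :&: U|, so adding [U] raises
   the count at least as much as the rank bound. *)
move: hW vS; rewrite !cardU // -/N => hW vS.
move: hr rE hW vS cardE cB; rewrite -/N; clear; lia.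
Qed.

End Determined.

(** * Sorting bases *)

(** Replaces positions in a sorted list by counts, which treats repeated entries uniformly and makes
    the sorted union of two bases computable. *)
Lemma sorted_onth (s : seq nat) i v : sorted leq s ->
  (onth s i == Some v) = (count (fun u => u < v) s <= i < count (fun u => u <= v) s).
Proof.
elim: s i => [|x s IHs] i; first by rewrite onth0n.
rewrite /= (path_sortedE leq_trans) => /andP[/allP ge_x srt].
have lt0 : v <= x -> count (fun u => u < v) s = 0.
  move=> le_vx; apply/eqP; rewrite -leqn0 leqNgt -has_count; apply/hasPn => u us.
  by rewrite -leqNgt (leq_trans le_vx) ?ge_x.
have le0 : v < x -> count (fun u => u <= v) s = 0.
  move=> lt_vx; apply/eqP; rewrite -leqn0 leqNgt -has_count; apply/hasPn => u us.
  by rewrite -ltnNge (leq_trans lt_vx) ?ge_x.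
case: i => [|i] /=; last rewrite IHs //; case: (ltngtP x v) => [lt|gt|e].
- by rewrite add1n ltn0; apply/eqP => -[e]; rewrite e ltnn in lt.
- by rewrite le0 // ltn0 andbF; apply/eqP => -[e]; rewrite e ltnn in gt.
- by rewrite lt0 ?e // eqxx.
- by rewrite !add1n !ltnS.
- by rewrite le0 // !ltn0 !andbF.
- by rewrite lt0 ?e // add1n ltnS.
Qed.

Section Sorting.
Variables (T : finType) (M : matroid T) (le : rel T).
Hypothesis le_linear : linear_order_on (ground M) le.
Local Notation E := (ground M).
Local Notation L := (full_listing M le).
Local Notation pos := (fun x => index x L).
Local Notation r := (rank_of M).
Implicit Types (x y a b c d : T) (A B S X Y : {set T}).

Let pos_inj : injective pos := index_listing_inj (mem_full_listing M le).

Definition below X t := #|[set y in X | pos y < t]|.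

Lemma belowS X t : below X t.+1 = below X t + [exists x in X, pos x == t].
Proof.
rewrite /below; case: exists_inP => [[x xX /eqP ex]|nx].
  have -> : [set y in X | pos y < t.+1] = x |: [set y in X | pos y < t].
    apply/setP => y; rewrite !inE ltnS leq_eqVlt andb_orr; congr (_ || _).
    apply/andP/eqP => [[_ /eqP ey]|->]; last by rewrite xX ex.
    by apply: pos_inj; rewrite ey ex.
  by rewrite cardsU1 !inE ex ltnn andbF addn1.
rewrite addn0; apply: eq_card => y; rewrite !inE ltnS leq_eqVlt.
case yX: (y \in X) => //=; case: eqP => //= ey; case: nx; exists y => //; exact/eqP.
Qed.

Lemma belowU1 X x t : x \notin X -> below (x |: X) t = (pos x < t) + below X t.
Proof.
move=> xX; rewrite /below; case lt: (pos x < t).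
  have -> : [set y in x |: X | pos y < t] = x |: [set y in X | pos y < t].
    apply/setP => y; rewrite !inE; case: eqP => [->|] //=; by rewrite lt.
  by rewrite cardsU1 !inE (negPf xX).
apply: eq_card => y; rewrite !inE; case: eqP => [->|] //=; by rewrite lt andbF.
Qed.

Lemma below_all X : below X (size L) = #|X|.
Proof. by apply: eq_card => y; rewrite !inE index_mem mem_full_listing andbT. Qed.

Section Merge.
Variables B B' : {set T}.
Hypotheses (bB : B \in bases M) (bB' : B' \in bases M).

Let cnt t := below B t + below B' t.

Lemma merged_onth i x :
  (onth (merged le B B') i == Some x) =
    (cnt (pos x) <= i < cnt (pos x) + (x \in B) + (x \in B')).
Proof.
have -> : (onth (merged le B B') i == Some x) =
    (onth (map pos (merged le B B')) i == Some (pos x)).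
  by apply/eqP/eqP => [e|/(inj_onth_map pos_inj)//]; rewrite onth_map e.
have all_E : all [in E] (enum B ++ enum B').
  apply/allP => y; rewrite mem_cat !mem_enum => /orP[].
    exact: (subsetP (base_ground bB)).
  exact: (subsetP (base_ground bB')).
have [_ _ tot] := le_linear.
have srt : sorted leq (map pos (merged le B B')).
  rewrite sorted_map; apply: (sub_in_sorted (P := [in E]) (e := le)).
  - by move=> u v uE vE; rewrite /= (le_index le_linear).
  - by rewrite /merged all_sort.
  - by apply: (sort_sorted_in tot).
have countE (P : pred nat) (Y : {set T}) :
    count P (map pos (enum Y)) = #|[set y in Y | P (pos y)]|.
  rewrite count_map -size_filter cardE; apply: perm_size; apply: uniq_perm.
  - by rewrite filter_uniq ?enum_uniq.
  - exact: enum_uniq.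
  - by move=> y; rewrite mem_filter !mem_enum in_set andbC.
have belowE (Y : {set T}) : #|[set y in Y | pos y <= pos x]| = below Y (pos x) + (x \in Y).
  rewrite -[LHS]/(below Y (pos x).+1) belowS; congr (_ + nat_of_bool _).
  apply/exists_inP/idP => [[y yY /eqP/pos_inj <-//]|xY]; by exists x.
rewrite (sorted_onth _ _ srt) !count_map.
rewrite !(permP (permEl (perm_sort le _))) !count_cat -!count_map !countE !belowE.
by rewrite /cnt !addnA [X in _ < X + _]addnAC.
Qed.

Let sizeE x : cnt (pos x) + (x \in B) + (x \in B') <= (rank M).*2.
Proof.
have le_base (Y : {set T}) : Y \in bases M -> below Y (pos x) + (x \in Y) <= rank M.
  move=> b; rewrite -(base_card b) /below.
  have -> : below Y (pos x) + (x \in Y) = #|[set y in Y | pos y <= pos x]|.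
    rewrite -[RHS]/(below Y (pos x).+1) belowS; congr (_ + nat_of_bool _).
    by apply/idP/exists_inP => [xY|[y yY /eqP/pos_inj <-//]]; exists x.
  by apply: subset_leq_card; apply/subsetP => y; rewrite inE => /andP[].
have := le_base B bB; have := le_base B' bB'; rewrite /cnt.
by move: (below _ _) (below _ _) (nat_of_bool _) (nat_of_bool _); clear; lia.
Qed.

(** [cnt (pos x)] entries precede [x]. A common element takes two consecutive places, one of each
    parity; an element of one base takes only place [cnt (pos x)], and places counted from 0 reverse
    the parity in the name. *)
Lemma odd_partE x : (x \in odd_part M le B B') =
  (x \in B) && (x \in B') || ((x \in B) (+) (x \in B')) && ~~ odd (cnt (pos x)).
Proof.
have := sizeE x; rewrite inE; set c := cnt (pos x) => le_c.
apply/existsP/idP => [[k]|h].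
  rewrite merged_onth -/c; case: (x \in B); case: (x \in B') => //=; clear; lia.
(* Rounding up selects place [c] if [c] is even and the second copy, at [c.+1], if [c] is odd; the
   even part rounds down for the same reason. *)
have lt : c.+1./2 < rank M.
  by move: le_c h; case: (x \in B); case: (x \in B') => //=; clear; lia.
exists (Ordinal lt); rewrite merged_onth -/c /=.
by move: h; case: (x \in B); case: (x \in B') => //=; clear; lia.
Qed.

Lemma even_partE x : (x \in even_part M le B B') =
  (x \in B) && (x \in B') || ((x \in B) (+) (x \in B')) && odd (cnt (pos x)).
Proof.
have := sizeE x; rewrite inE; set c := cnt (pos x) => le_c.
apply/existsP/idP => [[k]|h].
  rewrite merged_onth -/c; case: (x \in B); case: (x \in B') => //=; clear; lia.
have lt : c./2 < rank M.
  by move: le_c h; case: (x \in B); case: (x \in B') => //=; clear; lia.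
exists (Ordinal lt); rewrite merged_onth -/c /=.
by move: h; case: (x \in B); case: (x \in B') => //=; clear; lia.
Qed.

(** Sorted entries alternate between the two parts, so an initial segment is split evenly up to
    rounding; differences of these counts handle intervals. *)
Lemma below_parts t :
  below (odd_part M le B B') t = uphalf (cnt t) /\ below (even_part M le B B') t = (cnt t)./2.
Proof.
elim: t => [|t [IHo IHe]].
  have b0 X : below X 0 = 0 by apply: eq_card0 => y; rewrite !inE ltn0 andbF.
  by rewrite /cnt !b0.
have [lt|ge] := ltnP t (size L); last first.
  have bS X : below X t.+1 = below X t.
    rewrite belowS; case: exists_inP => [[x _ /eqP e]|_]; last by rewrite addn0.
    by have := ge; rewrite -e leqNgt index_mem mem_full_listing.
  by rewrite /cnt !bS.
have [x ex] : exists x, pos x = t.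
  case e: L lt => [//|x0 s]; rewrite -e => lt; exists (nth x0 L t).
  by rewrite index_uniq ?full_listing_uniq.
have bS X : below X t.+1 = below X t + (x \in X).
  rewrite belowS; congr (_ + nat_of_bool _).
  apply/exists_inP/idP => [[y yX /eqP]|xX]; last by exists x; rewrite // ex.
  by rewrite -ex => /pos_inj <-.
have := odd_partE x; have := even_partE x; rewrite ex /cnt !bS IHo IHe => -> ->.
rewrite /cnt; move: (below B t) (below B' t) => u v.
by case: (x \in B); case: (x \in B') => /=; clear; lia.
Qed.

Lemma card_parts : #|odd_part M le B B'| = rank M /\ #|even_part M le B B'| = rank M.
Proof.
have [] := below_parts (size L); rewrite /cnt !below_all (base_card bB) (base_card bB').
by move=> -> ->; clear; lia.
Qed.

End Merge.

Lemma below_interval X A s t : s <= t -> X \subset E ->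
  {in E, forall y, (y \in A) = (s <= pos y < t)} -> below X t = below X s + #|X :&: A|.
Proof.
move=> le_st sX hA; rewrite /below -(cardsID [set y | pos y < s] [set y in X | pos y < t]).
congr (_ + _); apply: eq_card => y; rewrite !inE; case yX: (y \in X); rewrite ?andbF //=.
  by case: (ltnP _ s) => [lt|_]; rewrite ?andbF // (leq_trans lt).
by rewrite hA ?(subsetP sX) // -leqNgt.
Qed.

(** Whichever of [A] and its complement misses the first element of [E] does not wrap around, so it
    is an interval of positions. *)
Lemma cyc_convex_interval A : A \subset E -> cyc_convex pos E A ->
  exists s t, s <= t /\
    ({in E, forall y, (y \in A) = (s <= pos y < t)} \/
     {in E, forall y, (y \in E :\: A) = (s <= pos y < t)}).
Proof.
move=> sA cA; have [E0|[e eE]] := set_0Vmem E.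
  by exists 0, 0; split=> //; left => y; rewrite E0 inE.
have [x0 x0E min0] := @arg_minnP T e (fun x => x \in E) (fun x => index x L) eE.
suff H (X : {set T}) : X \subset E -> cyc_convex pos E X -> x0 \notin X -> exists s t,
    s <= t /\ {in E, forall y, (y \in X) = (s <= pos y < t)}.
  have [x0A|x0A] := boolP (x0 \in A); last first.
    by have [s [t [le_st h]]] := H A sA cA x0A; exists s, t; split=> //; left.
  have [||s [t [le_st h]]] := H (E :\: A) (subsetDl _ _).
  - by have := cyc_convex_setI (cyc_convexC cA); rewrite setIC -setDE.
  - by rewrite inE x0A.
  - by exists s, t; split=> //; right.
move=> sX cX x0X; have [X0|[z zX]] := set_0Vmem X.
  by exists 0, 0; split=> // y yE; rewrite X0 inE.
have [a aX mina] := @arg_minnP T z (fun x => x \in X) (fun x => index x L) zX.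
have [c cX' maxc] := @arg_maxnP T z (fun x => x \in X) (fun x => index x L) zX.
exists (pos a), (pos c).+1; split; first by rewrite (leq_trans (mina c cX')).
move=> y yE; apply/idP/andP => [yX|[le1 le2]]; first by split; [apply: mina|apply: maxc].
apply: contraT => yX.
have lt u v : u \in E -> v \in E -> u != v -> pos u <= pos v -> pos u < pos v.
  move=> uE vE neq; rewrite [pos u <= _]leq_eqVlt => /orP[/eqP/pos_inj e'|//].
  by rewrite e' eqxx in neq.
have [aE cE] := (subsetP sX a aX, subsetP sX c cX').
have cyc : cyc4 pos x0 a y c.
  apply/or4P; apply: Or41; apply/and3P; split; apply: lt => //.
  - by apply: contraNneq x0X => ->.
  - exact: min0.
  - by apply: contraNneq yX => <-.
  - by apply: contraNneq yX => ->.
by have := cX a y c x0 aE yE cE x0E; rewrite -cyc4_rot cyc aX cX' (negPf yX) (negPf x0X) => /(_ isT isT isT).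
Qed.

(** If [B] and [B'] meet [A] in m elements altogether, each part meets [A] in at most m/2 rounded
    up, and m is at most twice the rank of [A]. When only the complement of [A] is an interval, the
    same bound follows since all four sets have size [rank M]. *)
Lemma determined_base_sorting :
  (forall B, B \subset E -> #|B| = rank M ->
    (forall A, A \subset E -> cyc_convex pos E A -> #|B :&: A| <= r A) -> B \in bases M) ->
  base_sorting_order M le.
Proof.
move=> det B B' b b'; have [co ce] := card_parts b b'.
have sB := base_ground b; have sB' := base_ground b'.
have so : odd_part M le B B' \subset E.
  apply/subsetP => x; rewrite odd_partE //.
  case xB: (x \in B); first by move=> _; apply: (subsetP sB).
  by case xB': (x \in B') => // _; apply: (subsetP sB').
have se : even_part M le B B' \subset E.
  apply/subsetP => x; rewrite even_partE //.
  case xB: (x \in B); first by move=> _; apply: (subsetP sB).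
  by case xB': (x \in B') => // _; apply: (subsetP sB').
suff H A : A \subset E -> cyc_convex pos E A ->
    #|odd_part M le B B' :&: A| <= r A /\ #|even_part M le B B' :&: A| <= r A.
  by split; apply: det => // A sA cA; have [] := H A sA cA.
move=> sA cA; have := base_leq_rank A b; have := base_leq_rank A b'.
have [s [t [le_st [h|h]]]] := cyc_convex_interval sA cA.
  have [os es] := below_parts b b' s; have [ot et] := below_parts b b' t.
  have := below_interval le_st so h; have := below_interval le_st se h.
  have := below_interval le_st sB h; have := below_interval le_st sB' h.
  by rewrite os es ot et; clear; lia.
have [os es] := below_parts b b' s; have [ot et] := below_parts b b' t.
have := below_interval le_st so h; have := below_interval le_st se h.
have := below_interval le_st sB h; have := below_interval le_st sB' h.
have cut X : X \subset E -> #|X| = rank M -> #|X :&: A| + #|X :&: (E :\: A)| = rank M.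
  by move=> sX <-; rewrite -(cardsID A X) setIDA (setIidPl sX).
have := cut _ so co; have := cut _ se ce.
have := cut _ sB (base_card b); have := cut _ sB' (base_card b').
by rewrite os es ot et; clear; lia.
Qed.

(** Elements of [S] occur twice in the merged list and do not disturb parity: [a] and [c] fall on
    odd places, [b] and [d] on even ones. *)
Lemma base_sorting_locally_sorting : base_sorting_order M le -> locally_sorting L M.
Proof.
move=> bs S a b c d [aS bS cS dS] ltab ltbc ltcd b1 b2.
have ltac := ltn_trans ltab ltbc; have ltbd := ltn_trans ltbc ltcd.
have ltad := ltn_trans ltab ltbd.
have neq x y : pos x < pos y -> x == y = false.
  by move=> lt; apply/eqP => e; rewrite e ltnn in lt.
have [nab nac nad] := And3 (neq a b ltab) (neq a c ltac) (neq a d ltad).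
have [nbc nbd ncd] := And3 (neq b c ltbc) (neq b d ltbd) (neq c d ltcd).
have [eB oB] := bs _ _ b1 b2.
have below1 t : below (a |: (b |: S)) t = (pos a < t) + ((pos b < t) + below S t).
  by rewrite !belowU1 // !inE nab.
have below2 t : below (c |: (d |: S)) t = (pos c < t) + ((pos d < t) + below S t).
  by rewrite !belowU1 // !inE ncd.
have cardS x y : x \notin S -> y \notin S -> x == y = false -> #|x |: (y |: S)| = #|S|.+2.
  by move=> xS yS xy; rewrite !cardsU1 in_setU1 (negPf xS) (negPf yS) xy.
have rS : rank M = #|S|.+2 by rewrite -(base_card b1) cardS.
have cmp x y : pos x < pos y -> (pos x < pos y = true) * (pos y < pos x = false).
  by move=> lt; rewrite lt ltnNge (ltnW lt).
have cs := (cmp a b ltab, cmp a c ltac, cmp a d ltad, cmp b c ltbc, cmp b d ltbd, cmp c d ltcd).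
have eqs := (nab, nac, nad, nbc, nbd, ncd).
have eqs' := (etrans (eq_sym b a) nab, etrans (eq_sym c a) nac, etrans (eq_sym d a) nad,
  etrans (eq_sym c b) nbc, etrans (eq_sym d b) nbd, etrans (eq_sym d c) ncd).
split.
  suff -> : a |: (c |: S) = odd_part M le (a |: (b |: S)) (c |: (d |: S)) by [].
  apply/eqP; rewrite eqEcard (base_card oB) cardS // rS leqnn andbT.
  apply/subsetP => x; rewrite odd_partE // !below1 !below2 !in_setU1.
  case/or3P => [/eqP->|/eqP->|->]; last by rewrite !orbT.
    rewrite !eqxx !eqs !cs !ltnn (negPf aS) /=; clear; lia.
  rewrite !eqxx !eqs' !eqs !cs !ltnn (negPf cS) /=; clear; lia.
suff -> : b |: (d |: S) = even_part M le (a |: (b |: S)) (c |: (d |: S)) by [].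
apply/eqP; rewrite eqEcard (base_card eB) cardS // rS leqnn andbT.
apply/subsetP => x; rewrite even_partE // !below1 !below2 !in_setU1.
case/or3P => [/eqP->|/eqP->|->]; last by rewrite !orbT.
  rewrite !eqxx !eqs' !eqs !cs !ltnn (negPf bS) /=; clear; lia.
rewrite !eqxx !eqs' !cs !ltnn (negPf dS) /=; clear; lia.
Qed.

End Sorting.

Theorem theorem3p2 (R : realType) (T : finType) (M : matroid T) (le : rel T)
    (M_loopless : loopless M) (le_linear : linear_order_on (ground M) le) :
  [<-> positroid_order R M le;
       base_sorting_order M le;
       forall F : {set T}, flat M F -> 2 <= #|F| <= #|ground M| - 2 ->
         connected (restrict M F) ->
         is_direct_sum (contract M F) (max_cyclic_intervals (ground M) le F)
           (fun U => restrict (contract M F) U);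
       cyclic_interval_property M le].
Proof.
pose L := full_listing M le.
have L_full x : x \in L by apply: mem_full_listing.
have L_uniq : uniq L by apply: full_listing_uniq.
have cip_sum := cyclic_interval_direct_sum le_linear.
have local_cip := locally_sorting_cyclic_interval le_linear.
have sum_det := direct_sum_determined le_linear M_loopless.
have sum_sorting h := determined_base_sorting le_linear (sum_det h).
have sorting_local := base_sorting_locally_sorting le_linear.
have pos_sum : positroid_order R M le -> forall F : {set T}, flat M F ->
    2 <= #|F| <= #|ground M| - 2 -> connected (restrict M F) ->
    is_direct_sum (contract M F) (max_cyclic_intervals (ground M) le F)
      (fun U => restrict (contract M F) U).
  case/positroid_order_realization => v vM; apply/cip_sum/local_cip.
  exact: realization_locally_sorting vM.
tfae.
- by move/pos_sum/sum_sorting.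
- by move/sorting_local/local_cip/cip_sum.
- by move/sum_sorting/sorting_local/local_cip.
(* Sets convex over the ground set are convex over its nontrivial elements, so the bounds assumed
   here include those of all cyclic intervals. *)
move=> cip; have det : cyclically_determined (fun x => index x L) M.
  move=> B sB cB hB; apply: (sum_det (cip_sum cip)) => // A sA cA; apply: hB => //.
  by apply: cyc_convexS cA; apply: nontrivial_ground.
have [v vM] := cyclically_determined_realization R L_uniq L_full det.
exact: realization_positroid_order vM.
Qed.
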